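(* Let $\mathcal F$ be a family of ordered pairs $(f,g)$ of non-negative measurable functions on $\mathbb R^n$ with the following property: for some $p_0$, $0<p_0<\infty$, and every $w\in A_\infty$, $$\int_{\mathbb R^n} f(x)^{p_0}w(x)\,dx\le C\int_{\mathbb R^n} g(x)^{p_0}w(x)\,dx$$ for all $(f,g)\in\mathcal F$ such that the left-hand side is finite, where $C$ depends only on the $A_\infty$ constant of $w$. Let $\theta\ge 1$ and $u\in A_1$. Suppose that $v_i$, $i=1,\dots,m$, are weights such that for some $\delta_i>0$, $v_i^{\delta_i}\in A_\infty$, $i=1,\dots,m$, and put $v=\prod_{i=1}^m v_i$. Then there is a constant $C$ such that $$\Big\|\frac{f}{v^\theta}\Big\|_{L^{1/\theta,\infty}(uv)}\le C\,\Big\|\frac{g}{v^\theta}\Big\|_{L^{1/\theta,\infty}(uv)}$$ for all $(f,g)\in\mathcal F$ such that the left-hand side is finite. Similarly, for $0<q<\infty$, there is a constant $C$ such that $$\Big\|\frac{\big(\sum_j (f_j)^q\big)^{1/q}}{v^\theta}\Big\|_{L^{1/\theta,\infty}(uv)}\le C\,\Big\|\frac{\big(\sum_j (g_j)^q\big)^{1/q}}{v^\theta}\Big\|_{L^{1/\theta,\infty}(uv)}$$ for any sequence $\{(f_j,g_j)\}_j\subset\mathcal F$ such that the left-hand side is finite.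
   Context: A weight is a non-negative measurable function on $\mathbb R^n$; $A_1$ and $A_\infty$ are the usual Muckenhoupt classes on $\mathbb R^n$. Note that the $v_i$ themselves are not assumed locally integrable (only $v_i^{\delta_i}\in A_\infty$). For $0<p<\infty$ and a non-negative measurable function $\mu$ on $\mathbb R^n$, $\|h\|_{L^{p,\infty}(\mu)}=\sup_{t>0}t\,\big(\mu(\{x:|h(x)|>t\})\big)^{1/p}$, where $\mu(E)=\int_E\mu(x)\,dx$; here $\mu=uv$ is the pointwise product. The constants $C$ in the conclusions do not depend on the pair $(f,g)$ or the sequence $\{(f_j,g_j)\}_j$. *)

(* Defs.v *)
From HB Require Import structures.
From mathcomp Require Import all_boot all_order all_algebra.
From mathcomp Require Import all_classical all_reals all_analysis.
From mathcomp Require Import measurable_realfun.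

Set Implicit Arguments.
Unset Strict Implicit.
Unset Printing Implicit Defensive.

Import Order.TTheory GRing.Theory Num.Theory.
Import numFieldNormedType.Exports.

Local Open Scope classical_set_scope.
Local Open Scope ring_scope.
Local Open Scope ereal_scope.

(* Lebesgue measure on R^n is the restriction of the Lebesgue outer measure to
   its Caratheodory sigma-algebra, so measurable means Lebesgue measurable.
   It is only declared to be a measure for n.+1: in dimension 0 no box is empty
   and box_vol is constantly 1. *)
Section lebesgue_outer_measure.
Context {R : realType} {n : nat}.
Implicit Types (a b : 'rV[R]_n) (E : set 'rV[R]_n).

Definition box a b : set 'rV[R]_n :=
  [set x | forall i, (a ord0 i <= x ord0 i <= b ord0 i)%R].

Definition box_vol a b : R := (\prod_(i < n) Num.max 0 (b ord0 i - a ord0 i))%R.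

Definition box_cover E (B : nat -> 'rV[R]_n * 'rV[R]_n) : Prop :=
  E `<=` \bigcup_k box (B k).1 (B k).2.

Definition leb_outer E : \bar R :=
  ereal_inf [set \sum_(k <oo) (box_vol (B k).1 (B k).2)%:E | B in box_cover E].

Lemma box_vol_ge0 a b : (0 <= box_vol a b)%R.
Proof. by apply: prodr_ge0 => i _; rewrite le_max lexx. Qed.

Lemma leb_outer_ge0 E : 0 <= leb_outer E.
Proof.
apply: le_ereal_inf_tmp => _ /= [B _ <-].
by apply: nneseries_ge0 => k _ _; rewrite lee_fin box_vol_ge0.
Qed.

Lemma le_leb_outer : {homo leb_outer : A B / A `<=` B >-> A <= B}.
Proof.
move=> A B AB; apply: ereal_inf_le_tmp => _ [C BC <-].
by exists C => //; exact: subset_trans BC.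
Qed.

Lemma leb_outer_sigma_subadditive : sigma_subadditive leb_outer.
Proof.
move=> A; have [[i ioo]|] := pselect (exists i, leb_outer (A i) = +oo).
  rewrite (eseries_pinfty _ _ ioo) ?leey// => k _.
  by rewrite -ltNye (lt_le_trans _ (leb_outer_ge0 _)).
rewrite -forallNE => Aoo.
suff add2e (e : {posnum R}) :
    leb_outer (\bigcup_k A k) <= \sum_(i <oo) leb_outer (A i) + e%:num%:E.
  by apply/lee_addgt0Pr => _/posnumP[].
rewrite (le_trans _ (epsilon_trick _ _ _))//; last first.
  by move=> k; exact: leb_outer_ge0.
pose vol (B : 'rV[R]_n * 'rV[R]_n) := (box_vol B.1 B.2)%:E.
have vol_ge0 B : 0 <= vol B by rewrite lee_fin box_vol_ge0.
pose P k B := box_cover (A k) B /\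
  \sum_(j <oo) vol (B j) <= leb_outer (A k) + (e%:num / (2 ^ k.+1)%:R)%:E.
have [G PG] : {G : nat -> nat -> 'rV[R]_n * 'rV[R]_n & forall k, P k (G k)}.
  apply: (@choice _ _ P) => k; rewrite /P /leb_outer.
  set S := (X in ereal_inf X); move infS : (ereal_inf S) => iS.
  case: iS infS => [r Sr|Soo|Soo].
  - have en1 : (0 < e%:num / (2 ^ k.+1)%:R)%R by [].
    have /(lb_ereal_inf_adherent en1) : ereal_inf S \is a fin_num by rewrite Sr.
    move=> [x [B AB volBx] xS].
    by exists B; split => //; rewrite /vol volBx -Sr; exact/ltW.
  - by have := Aoo k; rewrite /leb_outer Soo.
  - suff : lbound S 0 by move/le_ereal_inf_tmp; rewrite Soo.
    by move=> /= _ [B AB <-]; apply: nneseries_ge0 => *; exact: vol_ge0.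
apply: (@le_trans _ _ (\esum_(i in setT) (vol \o uncurry G) i)).
  rewrite /leb_outer; apply: ereal_inf_lbound => /=.
  have /card_esym/ppcard_eqP[f] := card_nat2.
  exists (uncurry G \o f).
    move=> t [i _ At]; have [j _ Gt] := (PG i).1 t At.
    by exists (f^-1%FUN (i, j)) => //=; rewrite invK ?inE.
  rewrite -(esum_pred_image (vol \o uncurry G) _ xpredT) ?[fun=> _]set_true//.
    by rewrite image_eq.
  by move=> *; exact: vol_ge0.
rewrite (_ : esum _ _ = \sum_(i <oo) \sum_(j <oo) vol (G i j)); last first.
  pose J : nat -> set (nat * nat) := fun i => [set (i, j) | j in setT].
  rewrite (_ : setT = \bigcup_k J k); last first.
    by rewrite predeqE => -[a b]; split => // _; exists a => //; exists b.
  rewrite esum_bigcupT /=; last 2 first.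
    - apply/trivIsetP => i j _ _ ij.
      rewrite predeqE => -[k m] /=; split => //= -[] [_] _ [<-{k} _].
      by move=> [m' _] [] /esym/eqP; rewrite (negbTE ij).
    - by move=> /= [k m]; exact: vol_ge0.
  rewrite -(image_id [set: nat]) -fun_true esum_pred_image//; last first.
    by move=> k _; apply: esum_ge0 => *; exact: vol_ge0.
  apply: eq_eseriesr => /= j _.
  rewrite -(esum_pred_image (vol \o uncurry G) (pair j) predT)//=; last first.
    by move=> ? ? _ _; exact: (@can_inj _ _ _ snd).
  by congr esum; rewrite predeqE => -[a b]; split; move=> [i _ <-]; exists i.
apply: lee_lim.
- by apply: is_cvg_nneseries => k _ _; apply: nneseries_ge0 => *; exact: vol_ge0.
- by apply: is_cvg_nneseries => *; apply: adde_ge0 => //; exact: leb_outer_ge0.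
- by near=> k; apply: lee_sum => i _; exact: (PG i).2.
Unshelve. all: by end_near. Qed.

End lebesgue_outer_measure.

Section lebesgue_outer_measure_pos_dim.
Context {R : realType} {n : nat}.

Lemma leb_outer0 : @leb_outer R n.+1 set0 = 0.
Proof.
apply/eqP; rewrite eq_le leb_outer_ge0 andbT; apply: ereal_inf_lbound.
exists (fun=> (0%R, 0%R)) => //; apply: eseries0 => k _ _.
by rewrite /box_vol big_ord_recl !mxE subrr maxxx mul0r.
Qed.

HB.instance Definition _ := isOuterMeasure.Build R _ (@leb_outer R n.+1)
  leb_outer0 leb_outer_ge0 le_leb_outer leb_outer_sigma_subadditive.

End lebesgue_outer_measure_pos_dim.

Definition Rn (R : realType) (n : nat) : Type := 'rV[R]_n.

HB.instance Definition _ (R : realType) (n : nat) :=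
  Measurable.copy (Rn R n.+1)
    (caratheodory_type (@leb_outer R n.+1)).

Section lebesgue_measure_Rn.
Context {R : realType} {n : nat}.

Definition leb : set (Rn R n.+1) -> \bar R := @leb_outer R n.+1.

Let leb0 : leb set0 = 0.
Proof. exact: leb_outer0. Qed.

Let leb_ge0 (E : set (Rn R n.+1)) : 0 <= leb E.
Proof. exact: leb_outer_ge0. Qed.

Let leb_semi_sigma_additive : semi_sigma_additive leb.
Proof. by move=> *; exact: caratheodory_measure_sigma_additive. Qed.

HB.instance Definition _ := isMeasure.Build _ _ _ leb
  leb0 leb_ge0 leb_semi_sigma_additive.

End lebesgue_measure_Rn.

Section weights.
Context {R : realType} {n : nat}.
Local Notation T := (Rn R n.+1).
Implicit Types (f h mu w : T -> \bar R) (Q E : set T) (p : R).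

Definition nonneg_measurable h : Prop :=
  (forall x, 0 <= h x) /\ measurable_fun [set: T] h.

(* Cubes have sides parallel to the axes. *)
Definition is_cube Q : Prop :=
  exists (a : 'rV[R]_n.+1) (l : R),
    (0 < l)%R /\ Q = box a (\row_i (a ord0 i + l))%R.

Definition locally_integrable_weight w : Prop :=
  nonneg_measurable w /\ forall Q, is_cube Q -> \int[leb]_(x in Q) w x < +oo.

Definition average f Q : \bar R := (leb Q)^-1 * \int[leb]_(x in Q) `|f x|.

Definition maximal f (x : T) : \bar R :=
  ereal_sup [set average f Q | Q in [set Q | is_cube Q /\ Q x]].

Definition A1 w : Prop :=
  locally_integrable_weight w /\
  exists C : R, {ae leb, forall x, maximal w x <= C%:E * w x}.

(* The negative power of w is written as an inverse because poweR, unlike the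
   inverse of extended reals, sends 0 to 0 for a negative exponent. *)
Definition Ap_const p w : \bar R :=
  ereal_sup [set average w Q *
    (average (fun x => (w x `^ (p - 1)^-1)^-1) Q) `^ (p - 1) | Q in is_cube].

Definition Ap p w : Prop :=
  locally_integrable_weight w /\ Ap_const p w < +oo.

Definition Ainfty w : Prop := exists p, (1 < p)%R /\ Ap p w.

Definition weighted mu E : \bar R := \int[leb]_(x in E) mu x.

(* Fujii-Wilson constant *)
Definition Ainfty_const w : \bar R :=
  ereal_sup [set (weighted w Q)^-1 * \int[leb]_(x in Q) maximal (w \_ Q) x
            | Q in is_cube].

Definition weakLnorm p mu h : \bar R :=
  ereal_sup [set t%:E * (weighted mu [set x | t%:E < `|h x|]) `^ p^-1
            | t in [set t : R | (0 < t)%R]].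

End weights.

(* Main.v *)
(* The constant in the hypothesis depends on the weight in an uncontrolled way, so
   every step goes by contradiction: pairs (f_k, g_k) that violate the conclusion with
   constants growing geometrically are refuted all at once by one A_infinity weight W,
   glued with coefficients 2^-k from majorants given by the Rubio de Francia algorithm.
   In this way the hypothesis extrapolates from p_0 to every exponent p > 0.  At the
   exponent q it can be summed over a sequence, so the vector-valued inequality is the
   scalar one for the family of pairs of l^q sums.

   For the endpoint take p = 1 / (2 theta) and G = (g / v^theta)^p, so that the norm of
   g controls uv{G > t} by a multiple of 1 / t^2.  Let E be a superlevel set of
   f / v^theta that nearly attains the norm of f, and U = u v^(1/2).  For s close to 2,
   on either side, u^(1-s) v^(1-s/2) is an A_s weight, by the reverse Hölder inequality
   for u and because v^d is in A_2 for small d.  Hence 1_E U has an A_1 majorant H such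
   that the integral of (H / U)^s uv is at most 2 uv(E) for one s < 2 and one s > 2.
   Interpolating between the two bounds the integral of G (H / U) uv, which is that of
   g^p H, by a multiple of the p-th power of the norm of g times uv(E)^(1/2), whereas
   f^p H >= f^p U on E and f^p U = (f / v^theta)^p uv. *)
Require Import Defs.
From mathcomp Require Import all_boot all_order all_algebra.
From mathcomp Require Import all_classical all_reals all_analysis.
From mathcomp Require Import measurable_realfun ring lra zify.
Import Order.TTheory GRing.Theory Num.Theory.
Import numFieldNormedType.Exports.

Set Implicit Arguments.
Unset Strict Implicit.
Unset Printing Implicit Defensive.

Local Open Scope classical_set_scope.
Local Open Scope ring_scope.
Local Open Scope ereal_scope.

(** At [s = 2] the dual weight [u^(1-s) v^(1-s/2)] is [u^-1], free of [v]. This explains the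
    exponent [1/(2 theta)]: near 2 only a tiny power of [v] enters, and that is all the hypothesis
    on the [v_i] controls. Since [G] is merely in weak [L^2], the level sums at [s = 2] itself
    diverge, hence the two exponents.

    Maximal operators are dyadic. A weighted dyadic maximal function satisfies Doob's inequality
    with a constant independent of the weight, which replaces covering lemmas, and finitely many
    shifted grids recover all cubes by the one-third trick. Gluing is possible since majorants
    produced with one constant [K] can be added with any nonnegative coefficients without changing
    [K].

    Two kinds of degeneration are split off before the main argument is applied. The unit cube has
    an unevaluated volume [c], and [c = 0] would make every set null. A weight may also vanish or be
    infinite at points: either some factor vanishes almost everywhere and all norms are 0, or every
    weight has a positive finite representative. *)

Section extended_real_inequalities.
Context {R : realType}.
Implicit Types (x y : \bar R) (p l : R).

Lemma le_poweR2r p x y : (0 <= p)%R -> 0 <= x -> x <= y -> x `^ p <= y `^ p.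
Proof.
move=> p0 x0 xy; apply: gt0_ler_poweR => //.
- by rewrite in_itv/= x0 leey.
- by rewrite in_itv/= (le_trans x0 xy) leey.
Qed.

Lemma poweRK p x : (p != 0)%R -> 0 <= x -> (x `^ p) `^ p^-1 = x.
Proof. by move=> p0 x0; rewrite -poweRrM divff// poweRe1. Qed.

Lemma poweRVK p x : (p != 0)%R -> 0 <= x -> (x `^ p^-1) `^ p = x.
Proof. by move=> p0 x0; rewrite -poweRrM mulVf// poweRe1. Qed.

Lemma poweRD_gt0 (r s : R) x : (0 < r)%R -> (0 < s)%R ->
  x `^ (r + s) = x `^ r * x `^ s.
Proof.
by move=> r0 s0; rewrite poweRD// add_neq0_poweRD_def// gt_eqF// addr_gt0.
Qed.

Lemma young_powR l (a b : R) : (0 < l < 1)%R -> (0 <= a)%R -> (0 <= b)%R ->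
  (a `^ l * b `^ (1 - l) <= l * a + (1 - l) * b)%R.
Proof.
move=> /andP[l0 l1] a0 b0; have l1' : (0 < 1 - l)%R by rewrite subr_gt0.
have := @conjugate_powR R (a `^ l)%R (b `^ (1 - l))%R l^-1%R (1 - l)^-1%R
  (powR_ge0 _ _) (powR_ge0 _ _).
rewrite !invr_gt0 => /(_ l0 l1'); rewrite !invrK addrC subrK => /(_ erefl).
rewrite -!powRrM !divff ?gt_eqF// !powRr1// => /le_trans; apply.
by rewrite (mulrC a) (mulrC b).
Qed.

Lemma young_poweR l x y : (0 < l < 1)%R -> 0 <= x -> 0 <= y ->
  x `^ l * y `^ (1 - l) <= l%:E * x + (1 - l)%:E * y.
Proof.
move=> l01; have /andP[l0 l1] := l01; have l1' : (0 < 1 - l)%R by rewrite subr_gt0.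
case: x => [a| |]//; case: y => [b| |]// a0 b0.
- by rewrite -!EFinM -EFinD lee_fin; exact: young_powR.
- by rewrite gt0_muley ?lte_fin// addeC addye ?leey// -EFinM.
- by rewrite gt0_muley ?lte_fin// addye ?leey// -EFinM.
- by rewrite gt0_muley ?lte_fin// gt0_muley ?lte_fin// leey.
Qed.

Lemma ltey_EFin x : 0 <= x -> x < +oo -> exists2 r : R, (0 <= r)%R & x = r%:E.
Proof. by case: x => [r r0 _| |]//; exists r. Qed.

Lemma lee_addl_cancel (a b x : \bar R) : 0 <= x -> x < +oo ->
  a + x <= b + x -> a <= b.
Proof.
by move=> x0 xoo; rewrite leeD2rE// ge0_fin_numE.
Qed.

(** Absorption step of the reverse Hölder inequality. It rests on the finiteness of [x], so it is
    applied to running maxima up to a finite level, before the limit. *)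
Lemma le_half_absorb x y : 0 <= x -> x < +oo -> x <= (2^-1)%:E * x + y ->
  x <= 2%:E * y.
Proof.
move=> x0 xoo; have [r r0 ->] := ltey_EFin x0 xoo.
case: y => [s| |]//=; last by rewrite gt0_muley ?lte_fin// leey.
by rewrite -!EFinM -EFinD !lee_fin => H; lra.
Qed.

Lemma EFinK_mule (r : R) x : (r != 0)%R -> (r^-1)%:E * (r%:E * x) = x.
Proof. by move=> r0; rewrite muleA -EFinM mulVf// mul1e. Qed.

Lemma poweR_maxe p x y : (0 <= p)%R -> 0 <= x -> 0 <= y ->
  (maxe x y) `^ p <= x `^ p + y `^ p.
Proof.
by move=> p0 x0 y0; case: (leP x y) => _; [apply: leeDr|apply: leeDl];
  rewrite poweR_ge0.
Qed.

End extended_real_inequalities.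

Section nonnegative_measurable_functions.
Context d (T : measurableType d) (R : realType).
Implicit Types (f g : T -> \bar R) (w : T -> R).

(* Locked, so that [split] and [by] do not see a conjunction. *)
Fact nnm_key : unit. Proof. exact: tt. Qed.
Definition nnm f : Prop :=
  locked_with nnm_key ((forall x, 0 <= f x) /\ measurable_fun [set: T] f).

Lemma nnmP f : nnm f <-> (forall x, 0 <= f x) /\ measurable_fun [set: T] f.
Proof. by rewrite /nnm unlock. Qed.

Lemma nnm_ge0 f x : nnm f -> 0 <= f x.
Proof. by move=> /nnmP[]. Qed.

Lemma nnm_measurable f : nnm f -> measurable_fun [set: T] f.
Proof. by move=> /nnmP[]. Qed.

Lemma nnm_cst (c : \bar R) : 0 <= c -> nnm (fun=> c).
Proof. by move=> c0; apply/nnmP; split => //; exact: measurable_cst. Qed.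

Lemma nnmD f g : nnm f -> nnm g -> nnm (fun x => f x + g x).
Proof.
move=> /nnmP[f0 mf] /nnmP[g0 mg]; apply/nnmP; split; first by move=> x; rewrite adde_ge0.
exact: emeasurable_funD.
Qed.

Lemma nnmM f g : nnm f -> nnm g -> nnm (fun x => f x * g x).
Proof.
move=> /nnmP[f0 mf] /nnmP[g0 mg]; apply/nnmP; split; first by move=> x; rewrite mule_ge0.
exact: emeasurable_funM.
Qed.

Lemma nnmMl c f : 0 <= c -> nnm f -> nnm (fun x => c * f x).
Proof. by move=> c0 nf; apply: (@nnmM (fun=> c)) => //; exact: nnm_cst. Qed.

Lemma nnm_max f g : nnm f -> nnm g -> nnm (fun x => maxe (f x) (g x)).
Proof.
move=> /nnmP[f0 mf] /nnmP[g0 mg]; apply/nnmP; split; first by move=> x; rewrite le_max f0.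
exact: measurable_maxe.
Qed.

Lemma nnm_pow f p : nnm f -> nnm (fun x => f x `^ p).
Proof.
move=> /nnmP[f0 mf]; apply/nnmP; split; first by move=> x; rewrite poweR_ge0.
exact: (measurableT_comp (measurable_poweR p) mf).
Qed.

Lemma nnm_EFin w : (forall x, 0 <= w x)%R -> measurable_fun setT w ->
  nnm (fun x => (w x)%:E).
Proof.
move=> w0 mw; apply/nnmP; split; first by move=> x; rewrite lee_fin.
exact/measurable_EFinP.
Qed.

Lemma nnm_indic (A : set T) : measurable A -> nnm (fun x => (\1_A x)%:E).
Proof. by move=> mA; apply: nnm_EFin => // x; exact: measurable_indic. Qed.

Lemma nnm_sup (F : nat -> T -> \bar R) : (forall n, nnm (F n)) ->
  nnm (fun x => ereal_sup (range (F ^~ x))).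
Proof.
move=> nF; apply/nnmP; split.
  move=> x; apply: le_ereal_sup_tmp; exists (F 0%N x); first by exists 0%N.
  exact: nnm_ge0.
have -> : (fun x => ereal_sup (range (F ^~ x))) =
          (fun x => esups (F ^~ x) 0%N).
  apply/funext => x; congr ereal_sup; apply/seteqP; split => y /=.
    by move=> [n _ <-]; exists n.
  by move=> [n _ <-]; exists n.
by apply: measurable_fun_esups => n; exact: nnm_measurable (nF n).
Qed.

Lemma nnm_series (F : nat -> T -> \bar R) : (forall n, nnm (F n)) ->
  nnm (fun x => \sum_(n <oo) F n x).
Proof.
move=> nF; apply/nnmP; split; first by move=> x; apply: nneseries_ge0 => n _ _; exact: nnm_ge0.
by apply: ge0_emeasurable_sum => n *; [exact: nnm_ge0|exact: nnm_measurable (nF n)].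
Qed.

Lemma nnm_bigmax (I : Type) (r : seq I) (F : I -> T -> \bar R) :
  (forall i, nnm (F i)) -> nnm (fun x => \big[maxe/0]_(i <- r) F i x).
Proof.
move=> nF; elim: r => [|i r IH].
  by under eq_fun do rewrite big_nil; exact: nnm_cst.
by under eq_fun do rewrite big_cons; exact: nnm_max.
Qed.

Lemma nnm_sum (I : Type) (r : seq I) (F : I -> T -> \bar R) :
  (forall i, nnm (F i)) -> nnm (fun x => \sum_(i <- r) F i x).
Proof.
move=> nF; elim: r => [|i r IH].
  by under eq_fun do rewrite big_nil; exact: nnm_cst.
by under eq_fun do rewrite big_cons; exact: nnmD.
Qed.

End nonnegative_measurable_functions.

Lemma le_bigmaxe (R : realType) (I : eqType) (r : seq I) (F : I -> \bar R) i :
  i \in r -> F i <= \big[maxe/0]_(j <- r) F j.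
Proof.
elim: r => // j r IH; rewrite in_cons big_cons => /predU1P[->|/IH ir].
  by rewrite le_max lexx.
by rewrite le_max ir orbT.
Qed.

Lemma bigmaxe_le (R : realType) (I : eqType) (r : seq I) (F : I -> \bar R) z :
  0 <= z -> (forall i, i \in r -> F i <= z) -> \big[maxe/0]_(j <- r) F j <= z.
Proof.
move=> z0 Fz; rewrite big_seq; apply: (big_ind (fun x => x <= z)) => //.
by move=> x y xz yz; rewrite ge_max xz.
Qed.

Lemma poweR_bigmax (R : realType) (I : Type) (r : seq I) (F : I -> \bar R)
    (p : R) : (0 < p)%R -> (forall i, 0 <= F i) ->
  (\big[maxe/0]_(i <- r) F i) `^ p <= \sum_(i <- r) F i `^ p.
Proof.
move=> p0 F0; elim: r => [|i r IH]; first by rewrite !big_nil poweR0r ?gt_eqF.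
rewrite !big_cons (le_trans (poweR_maxe (ltW p0) _ _))//.
  by elim/big_ind : _ => // x y x0 y0; rewrite le_max x0.
by rewrite leeD2l.
Qed.

Section nonnegative_integral.
Context d (T : measurableType d) (R : realType).
Variable mu : {measure set T -> \bar R}.
Implicit Types (f g : T -> \bar R) (A : set T).

Lemma nnm_int_ge0 f A : nnm f -> 0 <= \int[mu]_(x in A) f x.
Proof. by move=> /nnmP[f0 _]; apply: integral_ge0. Qed.

Lemma nnm_le_int f g A : measurable A -> nnm f -> nnm g ->
  (forall x, A x -> f x <= g x) ->
  \int[mu]_(x in A) f x <= \int[mu]_(x in A) g x.
Proof.
move=> mA /nnmP[f0 mf] /nnmP[g0 mg] fg; apply: ge0_le_integral => //.
- exact: measurable_funTS.
- exact: measurable_funTS.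
Qed.

Lemma nnm_le_ae_int f g A : measurable A -> nnm f -> nnm g ->
  {ae mu, forall x, A x -> f x <= g x} ->
  \int[mu]_(x in A) f x <= \int[mu]_(x in A) g x.
Proof.
move=> mA /nnmP[f0 mf] /nnmP[g0 mg] fg; apply: ae_ge0_le_integral => //.
- exact: measurable_funTS.
- exact: measurable_funTS.
Qed.

Lemma nnm_eq_ae_int f g A : measurable A -> nnm f -> nnm g ->
  {ae mu, forall x, f x = g x} ->
  \int[mu]_(x in A) f x = \int[mu]_(x in A) g x.
Proof.
move=> mA /nnmP[f0 mf] /nnmP[g0 mg] fg; apply: ge0_ae_eq_integral => //.
- exact: measurable_funTS.
- exact: measurable_funTS.
- by apply: filterS fg => x /= ->.
Qed.

Lemma nnm_intZ c f A : measurable A -> 0 <= c -> nnm f ->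
  \int[mu]_(x in A) (c * f x) = c * \int[mu]_(x in A) f x.
Proof.
move=> mA c0 /nnmP[f0 mf]; apply: ge0_integralZl => //.
exact: measurable_funTS.
Qed.

Lemma nnm_intD f g A : measurable A -> nnm f -> nnm g ->
  \int[mu]_(x in A) (f x + g x) =
  \int[mu]_(x in A) f x + \int[mu]_(x in A) g x.
Proof.
move=> mA /nnmP[f0 mf] /nnmP[g0 mg]; apply: ge0_integralD => //.
- exact: measurable_funTS.
- exact: measurable_funTS.
Qed.

Lemma nnm_subset_int f A B : measurable A -> measurable B -> nnm f ->
  A `<=` B -> \int[mu]_(x in A) f x <= \int[mu]_(x in B) f x.
Proof.
move=> mA mB /nnmP[f0 mf] AB; apply: ge0_subset_integral => //.
exact: measurable_funTS.
Qed.

Lemma nnm_int_indic f A : measurable A ->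
  \int[mu]_(x in A) f x = \int[mu]_x (f x * (\1_A x)%:E).
Proof.
move=> mA; rewrite integral_mkcond.
by rewrite epatch_indic.
Qed.

Lemma nnm_int_sup (F : nat -> T -> \bar R) A : measurable A ->
  (forall n, nnm (F n)) ->
  (forall x, {homo F ^~ x : n m / (n <= m)%N >-> n <= m}) ->
  \int[mu]_(x in A) ereal_sup (range (F ^~ x)) =
  ereal_sup (range (fun n => \int[mu]_(x in A) F n x)).
Proof.
move=> mA nF hF.
have -> : (fun x => ereal_sup (range (F ^~ x))) = (fun x => limn (F ^~ x)).
  apply/funext => x; apply/esym/cvg_lim => //.
  exact: ereal_nondecreasing_cvgn.
rewrite monotone_convergence//.
- apply: cvg_lim => //; apply: ereal_nondecreasing_cvgn => n m nm.
  by apply: nnm_le_int => // x _; exact: hF.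
- by move=> n; apply: measurable_funTS; exact: nnm_measurable (nF n).
- by move=> n x _; exact: nnm_ge0.
Qed.

Lemma nnm_int_series (F : nat -> T -> \bar R) A : measurable A ->
  (forall n, nnm (F n)) ->
  \int[mu]_(x in A) (\sum_(n <oo) F n x) =
  \sum_(n <oo) \int[mu]_(x in A) F n x.
Proof.
move=> mA nF; apply: integral_nneseries => //.
- by move=> n; apply: measurable_funTS; exact: nnm_measurable (nF n).
- by move=> n x _; exact: nnm_ge0.
Qed.

Lemma nnm_int_sum (I : Type) (r : seq I) (F : I -> T -> \bar R) A : measurable A ->
  (forall n, nnm (F n)) ->
  \int[mu]_(x in A) (\sum_(n <- r) F n x) =
  \sum_(n <- r) \int[mu]_(x in A) F n x.
Proof.
move=> mA nF; elim: r => [|i r IH].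
  by under eq_fun do rewrite big_nil; rewrite big_nil integral0.
under eq_fun do rewrite big_cons.
by rewrite big_cons nnm_intD// ?IH//; exact: nnm_sum.
Qed.

Lemma nnm_int_fin_ae f A : measurable A -> nnm f ->
  \int[mu]_(x in A) f x < +oo -> {ae mu, forall x, A x -> f x < +oo}.
Proof.
move=> mA /nnmP[f0 mf] foo.
have fi : mu.-integrable A f.
  apply/integrableP; split; first exact: measurable_funTS.
  by under eq_integral do rewrite gee0_abs//.
have := integrable_ae mA fi; apply: filterS => x /= H /H.
by rewrite ge0_fin_numE.
Qed.

Lemma nnm_int_eq0_ae f A : measurable A -> nnm f ->
  \int[mu]_(x in A) f x = 0 -> {ae mu, forall x, A x -> f x = 0}.
Proof.
move=> mA /nnmP[f0 mf] f0'.
by apply/(ae_eq_integral_abs mu mA (measurable_funTS mf));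
  under eq_integral do rewrite gee0_abs//.
Qed.

(** Young's inequality for [f / a] and [g / b], integrated. Stating Hölder's inequality through
    positive real upper bounds rather than norms removes the cases of zero and infinite
    integrals. *)
Lemma holder_le f g A (l a b : R) : measurable A -> nnm f -> nnm g ->
  (0 < l < 1)%R -> (0 < a)%R -> (0 < b)%R ->
  \int[mu]_(x in A) f x <= a%:E -> \int[mu]_(x in A) g x <= b%:E ->
  \int[mu]_(x in A) (f x `^ l * g x `^ (1 - l)) <= (a `^ l * b `^ (1 - l))%:E.
Proof.
move=> mA nf ng l01 a0 b0 fa gb; have /andP[l0 l1] := l01.
have l1' : (0 < 1 - l)%R by rewrite subr_gt0.
set c := (a `^ l * b `^ (1 - l))%R.
have c0 : (0 < c)%R by rewrite mulr_gt0// powR_gt0.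
have H x : f x `^ l * g x `^ (1 - l) <=
    c%:E * ((l * a^-1)%:E * f x + ((1 - l) * b^-1)%:E * g x).
  have fx0 := nnm_ge0 x nf; have gx0 := nnm_ge0 x ng.
  have ia0 : 0 <= (a^-1)%:E :> \bar R by rewrite lee_fin invr_ge0 ltW.
  have ib0 : 0 <= (b^-1)%:E :> \bar R by rewrite lee_fin invr_ge0 ltW.
  have := young_poweR l01 (mule_ge0 ia0 fx0) (mule_ge0 ib0 gx0).
  rewrite !poweRM// !poweR_EFin muleACA -EFinM.
  rewrite (muleA l%:E) (muleA (1 - l)%:E) -!EFinM => /(lee_wpmul2l (ltW c0 : 0 <= c%:E)).
  (* [k] is [a^-l b^-(1-l)], the factor that the normalization pulls out of the left side; [c] was
     chosen as its inverse. *)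
  rewrite [X in X <= _ -> _](muleA c%:E) -EFinM; set k := (X in (c * X)%R).
  suff -> : (c * k = 1)%R by rewrite mul1e.
  rewrite /k /c -(@powR_inv1 _ a) ?ltW// -(@powR_inv1 _ b) ?ltW//.
  by rewrite -!powRrM !mulN1r !powRN; field; rewrite !gt_eqF ?powR_gt0.
apply: (@le_trans _ _ (\int[mu]_(x in A)
    (c%:E * ((l * a^-1)%:E * f x + ((1 - l) * b^-1)%:E * g x)))).
  apply: nnm_le_int => //; first by apply: nnmM; exact: nnm_pow.
  apply: nnmMl; first by rewrite lee_fin ltW.
  by apply: nnmD; apply: nnmMl => //; rewrite lee_fin ltW// mulr_gt0 ?invr_gt0.
have ? : 0 <= (l / a)%:E :> \bar R by rewrite lee_fin ltW// mulr_gt0 ?invr_gt0.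
have ? : 0 <= ((1 - l) / b)%:E :> \bar R by rewrite lee_fin ltW// mulr_gt0 ?invr_gt0.
rewrite nnm_intZ// ?lee_fin ?(ltW c0)//; last by apply: nnmD; exact: nnmMl.
rewrite nnm_intD//; [|exact: nnmMl|exact: nnmMl].
rewrite !nnm_intZ//.
rewrite -[leRHS]mule1; apply: lee_wpmul2l; first by rewrite lee_fin ltW.
apply: (@le_trans _ _ ((l / a)%:E * a%:E + ((1 - l) / b)%:E * b%:E)).
  by apply: leeD; exact: lee_wpmul2l.
by rewrite -!EFinM -EFinD !divfK ?gt_eqF// addrC subrK.
Qed.

End nonnegative_integral.

(** * Averages over the fibers of a countable partition *)

Section conditional_average.
Context d (T : measurableType d) (R : realType) (I : countType).
Variable mu : {measure set T -> \bar R}.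
Implicit Types (f g : T -> \bar R) (w : T -> R) (j : T -> I).

Definition fiber j x : set T := [set y | j y = j x].

(** The conditional expectation of [f / w] for the measure [w mu]: the weight divides but does not
    multiply [f]. This is the form used by Lerner's bound, and [w = 1] gives plain averages. *)
Definition wavg w j f x : \bar R :=
  (\int[mu]_(y in fiber j x) (w y)%:E)^-1 * \int[mu]_(y in fiber j x) f y.

Definition partition_measurable j := forall i, measurable [set y | j y = i].

Definition fiberwise_finite w j := forall x,
  0 < \int[mu]_(y in fiber j x) (w y)%:E < +oo.

Lemma measurable_fiber j x : partition_measurable j -> measurable (fiber j x).
Proof. by apply. Qed.

Lemma fiberE j x y : j x = j y -> fiber j x = fiber j y.
Proof. by rewrite /fiber => ->. Qed.

Lemma wavg_fiber w j f x y : j x = j y -> wavg w j f x = wavg w j f y.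
Proof. by move=> /fiberE xy; rewrite /wavg xy. Qed.

Lemma fiber_constant_measurable j g : partition_measurable j ->
  (forall x y, j x = j y -> g x = g y) -> measurable_fun [set: T] g.
Proof.
move=> mj gj _ Y mY; rewrite setTI.
have -> : g @^-1` Y = \bigcup_(i in j @` (g @^-1` Y)) [set y | j y = i].
  apply/seteqP; split => [x Yx|y [i [x Yx <-]] /= jyx].
    by exists (j x) => //; exists x.
  by rewrite (gj y x).
rewrite bigcup_mkcond; apply: countable_bigcupT_measurable => [|i].
  exact: countableP.
by case: ifPn.
Qed.

Lemma fiber_constant_nnm j g : partition_measurable j -> (forall x, 0 <= g x) ->
  (forall x y, j x = j y -> g x = g y) -> nnm g.
Proof. by move=> mj g0 gj; apply/nnmP; split => //; exact: fiber_constant_measurable gj. Qed.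

Lemma wavg_nnm w j f : partition_measurable j -> (forall x, 0 <= w x)%R ->
  (forall x, 0 <= f x) -> nnm (wavg w j f).
Proof.
move=> mj w0 f0; apply: (fiber_constant_nnm mj) => [x|]; last exact: wavg_fiber.
apply: mule_ge0; last exact: integral_ge0.
by rewrite inve_ge0; apply: integral_ge0 => y _; rewrite lee_fin.
Qed.

Lemma partition_integral j f : partition_measurable j -> nnm f ->
  \int[mu]_x f x = \sum_(n <oo) \int[mu]_(x in [set y | pickle (j y) = n]) f x.
Proof.
move=> mj /nnmP[f0 mf].
have mF n : measurable [set y | pickle (j y) = n].
  have [[i <-]|nE] := pselect (exists i : I, pickle i = n).
    by have := mj i; congr measurable; apply/seteqP; split => y /= => [->//|];
      exact: (pcan_inj pickleK).
  rewrite (_ : [set _ | _] = set0)//; apply/seteqP; split => // y /= yn.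
  by apply: nE; exists (j y).
have UF : \bigcup_n [set y | pickle (j y) = n] = setT.
  by apply/seteqP; split => // y _; exists (pickle (j y)).
rewrite -[in LHS]UF ge0_integral_bigcup//; first by rewrite UF.
by move=> n m _ _ [y [/= <- <-]].
Qed.

Lemma partition_le j f g : partition_measurable j -> nnm f -> nnm g ->
  (forall x, \int[mu]_(y in fiber j x) f y <= \int[mu]_(y in fiber j x) g y) ->
  \int[mu]_x f x <= \int[mu]_x g x.
Proof.
move=> mj nf ng fg; rewrite (partition_integral mj nf) (partition_integral mj ng).
apply: lee_nneseries => [n _ _|n _]; first exact: nnm_int_ge0.
have [[x <-]|nE] := pselect (exists x, pickle (j x) = n).
  have -> : [set y | pickle (j y) = pickle (j x)] = fiber j x.
    by apply/seteqP; split => y /= => [|->//]; exact: (pcan_inj pickleK).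
  exact: fg.
rewrite (_ : [set y | _] = set0) ?integral_set0//.
by apply/seteqP; split => // y /= yn; apply: nE; exists y.
Qed.

Lemma wavg_mul w j f x : fiberwise_finite w j ->
  wavg w j f x * \int[mu]_(y in fiber j x) (w y)%:E = \int[mu]_(y in fiber j x) f y.
Proof.
move=> /(_ x)/andP[w0 woo]; rewrite /wavg muleAC mulVe ?mul1e ?gt_eqF//.
by rewrite ge0_fin_numE// ltW.
Qed.

(* The tower property, for the measure [w mu]. *)
Lemma wavg_int w j f g : partition_measurable j -> fiberwise_finite w j ->
  nnm (EFin \o w) -> nnm f -> (forall x, 0 <= g x) ->
  (forall x y, j x = j y -> g x = g y) ->
  \int[mu]_x (g x * wavg w j f x * (w x)%:E) = \int[mu]_x (g x * f x).
Proof.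
move=> mj fw nw nf g0 gj.
have ng : nnm g := fiber_constant_nnm mj g0 gj.
have nE : nnm (wavg w j f).
  apply: wavg_nnm => // x; last exact: nnm_ge0.
  by have := nnm_ge0 x nw; rewrite lee_fin.
have H x : \int[mu]_(y in fiber j x) (g y * wavg w j f y * (w y)%:E) =
           \int[mu]_(y in fiber j x) (g y * f y).
  transitivity (\int[mu]_(y in fiber j x) (g x * wavg w j f x * (w y)%:E)).
    by apply: eq_integral => y /set_mem yx; rewrite (gj y x)// (wavg_fiber _ _ yx).
  rewrite nnm_intZ//; [|exact: measurable_fiber|by rewrite mule_ge0// nnm_ge0].
  rewrite -muleA wavg_mul//.
  rewrite -nnm_intZ//; last exact: measurable_fiber.
  by apply: eq_integral => y /set_mem yx; rewrite (gj y x).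
have nl : nnm (fun x => g x * wavg w j f x * (w x)%:E) by do 2 apply: nnmM => //.
have nr : nnm (fun x => g x * f x) by exact: nnmM.
by apply/eqP; rewrite eq_le; apply/andP; split; apply: (partition_le mj) => // x;
  rewrite H.
Qed.

End conditional_average.

(** * Doob's maximal inequality for nested partitions, with a weight *)

Section doob_inequality.
Context d (T : measurableType d) (R : realType) (I : countType).
Variable mu : {measure set T -> \bar R}.
Implicit Types (f g : T -> \bar R) (a b : \bar R).

(** Prepares Hölder's inequality against [w]: the natural integrand is [f^p w^(1-p)], which is
    [(f / w)^p w]. *)
Lemma weight_split (p : R) f (w : T -> R) x : (1 < p)%R -> 0 <= f x ->
  (0 < w x)%R ->
  (f x `^ p * (w x `^ (1 - p))%:E) `^ p^-1 * (w x)%:E `^ (1 - p^-1) = f x.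
Proof.
move=> p1 f0 w0; have p0 : (0 < p)%R by lra.
rewrite poweRM ?poweR_ge0 ?lee_fin ?powR_ge0// poweRK ?gt_eqF// -muleA.
rewrite !poweR_EFin -EFinM -powRrM -powRD; last by apply/implyP => _; rewrite gt_eqF.
have -> : ((1 - p) * p^-1 + (1 - p^-1) = 0)%R by field; rewrite gt_eqF.
by rewrite powRr0 mule1.
Qed.

(** Reduces a bound by a possibly zero or infinite quantity to positive real bounds, the form in
    which [holder_le] accepts them. *)
Lemma le_of_le_gt (a b : \bar R) : (forall r : R, (0 < r)%R -> b <= r%:E -> a <= r%:E) ->
  0 <= b -> a <= b.
Proof.
move=> H b0; have [boo|] := ltP b +oo; last by rewrite leye_eq => /eqP ->; rewrite leey.
have [r r0 br] := ltey_EFin b0 boo; rewrite br; apply/lee_addgt0Pr => e e0.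
rewrite -EFinD; apply: H; first exact: ltr_wpDl. by rewrite br lee_fin lerDl ltW.
Qed.

(** Jensen's inequality for the conditional expectation of [f / w], cell by cell from Hölder's. It
    provides the finiteness that [doob_runmax] needs before dividing by a norm. *)
Lemma wavg_jensen (j : T -> I) (w : T -> R) f (p : R) : (1 < p)%R ->
  partition_measurable j -> fiberwise_finite mu w j ->
  (forall x, 0 < w x)%R -> measurable_fun setT w -> nnm f ->
  \int[mu]_x (wavg mu w j f x `^ p * (w x)%:E) <=
  \int[mu]_x (f x `^ p * (w x `^ (1 - p))%:E).
Proof.
move=> p1 mj fw w0 mw nf; have p0 : (0 < p)%R by lra.
have nw : nnm (EFin \o w) by apply: nnm_EFin => // x; exact: ltW.
have nw' : nnm (fun x => (w x `^ (1 - p))%:E).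
  by have := nnm_pow (1 - p)%R nw.
have nE : nnm (wavg mu w j f) by apply: wavg_nnm => // x; [exact: ltW|exact: nnm_ge0].
have nJ : nnm (fun x => f x `^ p * (w x `^ (1 - p))%:E) by apply: nnmM => //; exact: nnm_pow.
apply: (partition_le mj) => // [|x].
  by apply: nnmM => //; exact: nnm_pow.
have mQ : measurable (fiber j x) by exact: measurable_fiber.
under eq_integral => y /set_mem yx do rewrite (wavg_fiber mu w f yx).
rewrite nnm_intZ ?poweR_ge0//.
have /andP[b0 boo] := fw x; have [b b0' bE] := ltey_EFin (ltW b0) boo.
have {b0'} bgt0 : (0 < b)%R by rewrite -lte_fin -bE.
apply: le_of_le_gt; last exact: nnm_int_ge0.
move=> a a0 Ja.
have l01 : (0 < p^-1 < 1)%R by rewrite invr_gt0 p0 invf_lt1.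
have := holder_le mQ nJ nw l01 a0 bgt0 Ja; rewrite -bE lexx => /(_ isT).
under eq_integral do rewrite weight_split ?(nnm_ge0 _ nf)//.
move=> fQ.
have cle : wavg mu w j f x <= (a `^ p^-1 * b `^ (- p^-1))%:E.
  rewrite /wavg bE inver gt_eqF//.
  apply: (le_trans (lee_wpmul2l _ fQ)); first by rewrite lee_fin invr_ge0 ltW.
  rewrite -EFinM lee_fin mulrCA ler_pM2l ?powR_gt0// -(@powR_inv1 _ b) ?(ltW bgt0)//.
  rewrite -powRD ?(gt_eqF bgt0) ?implybT//.
  by have -> : (-1 + (1 - p^-1) = - p^-1)%R by ring.
rewrite bE; apply: (@le_trans _ _ ((a `^ p^-1 * b `^ (- p^-1))%:E `^ p * b%:E)).
  apply: lee_wpmul2r; first by rewrite lee_fin ltW.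
  by apply: le_poweR2r => //; [exact: ltW|exact: nnm_ge0].
rewrite poweR_EFin powRM ?powR_ge0// -!powRrM mulNr mulVf ?gt_eqF// powRr1 ?(ltW a0)//.
by rewrite powR_inv1 ?(ltW bgt0)// -EFinM -mulrA mulVf ?mulr1// gt_eqF.
Qed.

(** Pathwise form of Doob's inequality: for [X' = max(X, e)], [X'^p - X^p <= p/(p-1) e (X'^(p-1) -
    X^(p-1))], with the negative terms moved across because the values may be infinite. Where the
    maximum jumps, this is Young's inequality for [b a^(p-1)]. *)
Lemma doob_step (p : R) a b : (1 < p)%R -> 0 <= a -> 0 <= b ->
  maxe a b `^ p + (p / (p - 1))%:E * (b * a `^ (p - 1)) <=
  a `^ p + (p / (p - 1))%:E * (b * maxe a b `^ (p - 1)).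
Proof.
move=> p1 a0 b0; have p0 : (0 < p)%R by lra.
have p10 : (0 < p - 1)%R by lra.
have q0 : (0 < p / (p - 1))%R by rewrite divr_gt0.
case: (leP b a) => [//|ab].
have -> : b * b `^ (p - 1) = b `^ p.
  rewrite -[X in X * _]poweRe1// -poweRD_gt0//; congr (_ `^ _); lra.
have [boo|] := ltP b +oo; last first.
  rewrite leye_eq => /eqP ->; rewrite [in leRHS]poweRyr ?gt_eqF//.
  rewrite (gt0_muley (_ : 0 < (p / (p - 1))%:E)) ?lte_fin//.
  by rewrite addey ?leey// gt_eqF// (lt_le_trans _ (poweR_ge0 _ _)).
have [r r0 bE] := ltey_EFin b0 boo; subst b.
have [s s0 aE] := ltey_EFin a0 (lt_trans ab boo); subst a.
rewrite !poweR_EFin -!EFinM -!EFinD lee_fin.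
have l01 : (0 < p^-1 < 1)%R by rewrite invr_gt0 p0 invf_lt1.
have := young_powR l01 (powR_ge0 r p) (powR_ge0 s p).
rewrite -!powRrM divff ?gt_eqF// powRr1//.
rewrite (_ : p * (1 - p^-1) = p - 1)%R; last by field; rewrite gt_eqF.
move=> /(ler_wpM2l (ltW q0)).
rewrite (_ : p / (p - 1) * (p^-1 * r `^ p + (1 - p^-1) * s `^ p) =
   p / (p - 1) * r `^ p - r `^ p + s `^ p)%R; first by lra.
by field; rewrite !gt_eqF.
Qed.

Variables (idx : nat -> T -> I) (w : T -> R) (p : R).
Hypothesis p1 : (1 < p)%R.
Hypothesis midx : forall k, partition_measurable (idx k).
Hypothesis nested : forall k x y, idx k.+1 x = idx k.+1 y -> idx k x = idx k y.
Hypothesis fw : forall k, fiberwise_finite mu w (idx k).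
Hypothesis w0 : forall x, (0 < w x)%R.
Hypothesis mw : measurable_fun setT w.

Fixpoint runmax f k x : \bar R :=
  if k is k'.+1 then maxe (runmax f k' x) (wavg mu w (idx k'.+1) f x)
  else wavg mu w (idx 0) f x.

Lemma nnm_weight : nnm (EFin \o w).
Proof. by apply: nnm_EFin => // x; exact: ltW. Qed.

Lemma nnm_wavg f k : nnm f -> nnm (wavg mu w (idx k) f).
Proof. by move=> nf; apply: wavg_nnm => // x; [exact: ltW|exact: nnm_ge0]. Qed.

Lemma nnm_runmax f k : nnm f -> nnm (runmax f k).
Proof.
move=> nf; elim: k => [|k IH]; first exact: nnm_wavg.
by apply: nnm_max => //; exact: nnm_wavg.
Qed.

Lemma runmax_fiber f k x y : idx k x = idx k y -> runmax f k x = runmax f k y.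
Proof.
elim: k x y => [|k IH] x y xy; first exact: wavg_fiber.
by rewrite /= (IH x y (nested xy)) (wavg_fiber _ _ _ xy).
Qed.

Lemma le_runmax f k i x : (i <= k)%N -> wavg mu w (idx i) f x <= runmax f k x.
Proof.
elim: k => [|k IH]; first by rewrite leqn0 => /eqP ->.
rewrite leq_eqVlt => /predU1P[->|ik]; first by rewrite /= le_max lexx orbT.
by rewrite /= le_max IH.
Qed.

Lemma runmax_le f k x z : (forall i, (i <= k)%N -> wavg mu w (idx i) f x <= z) ->
  runmax f k x <= z.
Proof.
elim: k => [|k IH] H; first exact: H.
by rewrite /= ge_max IH ?H// => i ik; apply: H; exact: leqW.
Qed.

(** Telescoping of [doob_step] over the levels. Both the old and the new running maximum are
    constant on the cells of the new level, so after integration the tower property replaces the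
    average [e] by [f]. *)
Lemma doob_induction f k : nnm f ->
  \int[mu]_x (runmax f k x `^ p * (w x)%:E) <=
  (p / (p - 1))%:E * \int[mu]_x (runmax f k x `^ (p - 1) * f x).
Proof.
move=> nf; have p0 : (0 < p)%R by exact: lt_trans ltr01 p1.
have p10 : (0 < p - 1)%R by rewrite subr_gt0.
set q := (p / (p - 1))%R.
have q1 : (1 <= q)%R by rewrite /q ler_pdivlMr// mul1r gerBl ler01.
have qgt0 : (0 < q)%R by exact: lt_le_trans ltr01 q1.
have q0 : 0 <= q%:E by rewrite lee_fin ltW.
have nw := nnm_weight.
elim: k => [|k IH].
  have nE := nnm_wavg 0 nf.
  have -> : \int[mu]_x (runmax f 0 x `^ p * (w x)%:E) =
            \int[mu]_x (runmax f 0 x `^ (p - 1) * f x).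
    rewrite -(wavg_int (midx 0) (fw 0) nw nf).
    - apply: eq_integral => x _; congr (_ * _).
      rewrite -[X in _ * X]poweRe1; last exact: nnm_ge0.
      by rewrite -poweRD_gt0// subrK.
    - by move=> x; rewrite poweR_ge0.
    - by move=> x y xy; rewrite (runmax_fiber _ xy).
  rewrite -[X in X <= _]mul1e; apply: lee_wpmul2r; last by rewrite lee_fin.
  by apply: nnm_int_ge0; apply: nnmM => //; exact: nnm_pow.
set X := runmax f k in IH *; set X' := runmax f k.+1; pose e := wavg mu w (idx k.+1) f.
have nX : nnm X := nnm_runmax k nf; have nX' : nnm X' := nnm_runmax k.+1 nf.
have ne : nnm e := nnm_wavg k.+1 nf.
have tower Y : nnm Y -> (forall x y, idx k.+1 x = idx k.+1 y -> Y x = Y y) ->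
    \int[mu]_x (e x * Y x `^ (p - 1) * (w x)%:E) =
    \int[mu]_x (Y x `^ (p - 1) * f x).
  move=> nY Yk; rewrite -(wavg_int (midx k.+1) (fw k.+1) nw nf).
  - by apply: eq_integral => x _; rewrite (muleC (e x)).
  - by move=> x; rewrite poweR_ge0.
  - by move=> x y xy; rewrite (Yk x y).
have neY Y : nnm Y -> nnm (fun x => e x * Y x `^ (p - 1) * (w x)%:E).
  by move=> nY; apply: nnmM => //; apply: nnmM => //; exact: nnm_pow.
have nYp Y : nnm Y -> nnm (fun x => Y x `^ p * (w x)%:E).
  by move=> nY; apply: nnmM => //; exact: nnm_pow.
have key : \int[mu]_x (X' x `^ p * (w x)%:E) +
      q%:E * \int[mu]_x (X x `^ (p - 1) * f x) <=
    \int[mu]_x (X x `^ p * (w x)%:E) + q%:E * \int[mu]_x (X' x `^ (p - 1) * f x).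
  rewrite -(tower X nX); last by move=> x y /nested; exact: runmax_fiber.
  rewrite -(tower X' nX'); last by move=> x y; exact: runmax_fiber.
  rewrite -!nnm_intZ//; try exact: neY.
  rewrite -!nnm_intD//; try exact: nYp; try by apply: nnmMl => //; exact: neY.
  apply: nnm_le_int => //.
  - by apply: nnmD; [exact: nYp|apply: nnmMl => //; exact: neY].
  - by apply: nnmD; [exact: nYp|apply: nnmMl => //; exact: neY].
  move=> x _.
  have := doob_step p1 (nnm_ge0 x nX) (nnm_ge0 x ne).
  move=> /(lee_wpmul2r (nnm_ge0 x nw)) /=.
  have h Z : 0 <= q%:E * (e x * Z `^ (p - 1)).
    exact: mule_ge0 q0 (mule_ge0 (nnm_ge0 x ne) (poweR_ge0 _ _)).
  rewrite !ge0_muleDl ?poweR_ge0 ?h//.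
  by rewrite -!muleA.
have nXf : nnm (fun x => X x `^ (p - 1) * f x) by apply: nnmM => //; exact: nnm_pow.
(* The term to be cancelled must be finite. If it is not, the right-hand side is infinite too, as
   the running maximum increases. *)
have [oo|] := ltP (\int[mu]_x (X x `^ (p - 1) * f x)) +oo; last first.
  rewrite leye_eq => /eqP oo.
  have : \int[mu]_x (X x `^ (p - 1) * f x) <= \int[mu]_x (X' x `^ (p - 1) * f x).
    apply: nnm_le_int => //; first by apply: nnmM => //; exact: nnm_pow.
    by move=> y _; apply: lee_wpmul2r; [exact: nnm_ge0|apply: le_poweR2r;
      [exact: ltW|exact: nnm_ge0|rewrite /X' /= le_max lexx]].
  by rewrite oo leye_eq => /eqP ->; rewrite gt0_muley ?leey// lte_fin.
apply: (@lee_addl_cancel _ _ _ (q%:E * \int[mu]_x (X x `^ (p - 1) * f x))).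
- by rewrite mule_ge0// nnm_int_ge0.
- by have [r r0 ->] := ltey_EFin (nnm_int_ge0 mu setT nXf) oo; rewrite -EFinM ltry.
by apply: (le_trans key); rewrite addeC; exact: leeD2l.
Qed.

(** Hölder's inequality bounds the right-hand side of [doob_induction] by a product in which the
    left-hand side [b] reappears with power [1 - 1/p]; dividing by that power leaves a constant
    depending on [p] alone. *)
Lemma doob_runmax f k : nnm f ->
  \int[mu]_x (runmax f k x `^ p * (w x)%:E) <=
  ((p / (p - 1)) `^ p)%:E * \int[mu]_x (f x `^ p * (w x `^ (1 - p))%:E).
Proof.
move=> nf; have p0 : (0 < p)%R by exact: lt_trans ltr01 p1.
have p10 : (0 < p - 1)%R by rewrite subr_gt0.
set q := (p / (p - 1))%R.
have q0 : (0 < q)%R by rewrite divr_gt0.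
have nw := nnm_weight.
have nw' : nnm (fun x => (w x `^ (1 - p))%:E) by have := nnm_pow (1 - p)%R nw.
have nX := nnm_runmax k nf.
have nXw : nnm (fun x => runmax f k x `^ p * (w x)%:E) by apply: nnmM => //; exact: nnm_pow.
have nJ : nnm (fun x => f x `^ p * (w x `^ (1 - p))%:E) by apply: nnmM => //; exact: nnm_pow.
apply: le_of_le_gt; last by rewrite mule_ge0 ?lee_fin ?powR_ge0// nnm_int_ge0.
move=> a' a'0 Ja'.
pose a := ((q `^ p)^-1 * a')%R.
have a0 : (0 < a)%R by rewrite mulr_gt0// invr_gt0 powR_gt0.
have Ja : \int[mu]_x (f x `^ p * (w x `^ (1 - p))%:E) <= a%:E.
  rewrite /a EFinM -[leLHS](@EFinK_mule _ (q `^ p)%R) ?gt_eqF ?powR_gt0//.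
  by apply: lee_wpmul2l => //; rewrite lee_fin invr_ge0 powR_ge0.
have a'E : a' = (q `^ p * a)%R by rewrite /a mulrA divff ?mul1r// gt_eqF ?powR_gt0.
(* Finitely many levels only: the maximum is at most the sum of the averages, and each of these
   obeys Jensen's inequality. *)
have Xoo : \int[mu]_x (runmax f k x `^ p * (w x)%:E) < +oo.
  apply: (@le_lt_trans _ _ (\sum_(i <- iota 0 k.+1)
      \int[mu]_x (wavg mu w (idx i) f x `^ p * (w x)%:E))); last first.
    elim: (iota _ _) => [|i r IHr]; first by rewrite big_nil ltry.
    rewrite big_cons lte_add_pinfty//.
    by apply: (le_lt_trans (wavg_jensen p1 (midx i) (fw i) w0 mw nf));
      rewrite (le_lt_trans Ja) ?ltry.
  have nEp i : nnm (fun x => wavg mu w (idx i) f x `^ p * (w x)%:E).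
    by apply: nnmM => //; apply: nnm_pow; exact: nnm_wavg.
  rewrite -nnm_int_sum//; apply: nnm_le_int => //; first exact: nnm_sum.
  move=> x _; rewrite -ge0_sume_distrl; last by move=> *; exact: poweR_ge0.
  apply: lee_wpmul2r; first exact: (nnm_ge0 x nw).
  apply: (@le_trans _ _ ((\big[maxe/0]_(i <- iota 0 k.+1) wavg mu w (idx i) f x) `^ p)).
    apply: le_poweR2r; [exact: ltW|exact: nnm_ge0|].
    apply: runmax_le => i ik; apply: (@le_bigmaxe R _ _ (fun i => wavg mu w (idx i) f x)).
    by rewrite mem_iota.
  by apply: poweR_bigmax => // i; exact: (nnm_ge0 _ (nnm_wavg i nf)).
have [b b0 bE] := ltey_EFin (nnm_int_ge0 mu setT nXw) Xoo.
have [b0E|bn0] := eqVneq b 0%R; first by rewrite bE b0E lee_fin ltW.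
have bgt0 : (0 < b)%R by rewrite lt_neqAle eq_sym bn0.
have l01 : (0 < p^-1 < 1)%R by rewrite invr_gt0 p0 invf_lt1.
have := holder_le (@measurableT _ _) nJ nXw l01 a0 bgt0 Ja; rewrite bE lexx => /(_ isT).
have -> : \int[mu]_x ((f x `^ p * (w x `^ (1 - p))%:E) `^ p^-1 *
     (runmax f k x `^ p * (w x)%:E) `^ (1 - p^-1)) =
   \int[mu]_x (runmax f k x `^ (p - 1) * f x).
  apply: eq_integral => x _.
  rewrite (poweRM _ (poweR_ge0 _ _) (nnm_ge0 x nw)) -poweRrM.
  rewrite (_ : p * (1 - p^-1) = p - 1)%R; last by field; rewrite gt_eqF.
  by rewrite muleCA weight_split//; exact: nnm_ge0.
move=> H; have := doob_induction k nf; rewrite bE => /le_trans.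
move=> /(_ _ (lee_wpmul2l (ltW q0 : 0 <= q%:E) H)).
rewrite -EFinM !lee_fin mulrA => {}H.
have {H} : (b `^ p^-1 <= q * a `^ p^-1)%R.
  move: H; rewrite powRB ?(gt_eqF bgt0) ?implybT// powRr1 ?(ltW bgt0)//.
  rewrite mulrA ler_pdivlMr ?powR_gt0// (mulrC b) ler_pM2r//.
move=> /(@ge0_ler_powR _ p (ltW p0) _ _ (powR_ge0 _ _)).
rewrite nnegrE mulr_ge0 ?powR_ge0 ?(ltW q0)// => /(_ isT).
rewrite powRM ?powR_ge0 ?(ltW q0)// -!powRrM !mulVf ?gt_eqF// !powRr1 ?(ltW a0) ?(ltW bgt0)//.
by rewrite a'E.
Qed.

End doob_inequality.

(** * The dyadic maximal function *)

Section dyadic_maximal_function.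
Context d (T : measurableType d) (R : realType) (I : countType).
Variable mu : {measure set T -> \bar R}.
Variable idx : int -> T -> I.
Hypothesis midx : forall k, partition_measurable (idx k).
Hypothesis nested : forall k x y, idx (k + 1) x = idx (k + 1) y -> idx k x = idx k y.
Implicit Types (f g : T -> \bar R) (w : T -> R).

Definition positive_weight w : Prop :=
  locked_with nnm_key ((forall x, (0 < w x)%R) /\ measurable_fun [set: T] w).

Lemma positive_weightP w :
  positive_weight w <-> (forall x, (0 < w x)%R) /\ measurable_fun [set: T] w.
Proof. by rewrite /positive_weight unlock. Qed.

Lemma weight_gt0 w x : positive_weight w -> (0 < w x)%R.
Proof. by move=> /positive_weightP[]. Qed.

Lemma positive_weight_pow w (r : R) : positive_weight w ->
  positive_weight (fun x => w x `^ r)%R.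
Proof.
move=> /positive_weightP[w0 mw]; apply/positive_weightP; split.
  by move=> x; exact: powR_gt0.
exact: (measurableT_comp (measurable_powR r) mw).
Qed.

Lemma positive_weightM w w' : positive_weight w -> positive_weight w' ->
  positive_weight (fun x => w x * w' x)%R.
Proof.
move=> /positive_weightP[w0 mw] /positive_weightP[w0' mw'].
apply/positive_weightP; split; first by move=> x; exact: mulr_gt0.
exact: measurable_funM.
Qed.

Lemma positive_weightZ (r : R) w : (0 < r)%R -> positive_weight w ->
  positive_weight (fun x => r * w x)%R.
Proof. by move=> r0; apply: positive_weightM; apply/positive_weightP; split. 
Qed.

Lemma positive_weight1 : positive_weight (fun=> 1%R : R).
Proof. by apply/positive_weightP; split => //; exact: measurable_cst. Qed.

Lemma positive_weight_nnm w : positive_weight w -> nnm (fun x => (w x)%:E).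
Proof. by move=> /positive_weightP[w0 mw]; apply: nnm_EFin => // x; exact: ltW. Qed.

(** The window of levels [-N, ..., N], renumbered from 0 so that Doob's inequality for a one-sided
    sequence applies; [dmax] lets the window grow. *)
Definition level N i := idx (i%:Z - N%:Z).

Definition dmax w f x : \bar R :=
  ereal_sup (range (fun N => runmax mu (level N) w f (2 * N) x)).

Lemma level_nested N k x y : level N k.+1 x = level N k.+1 y ->
  level N k x = level N k y.
Proof.
rewrite /level => H; apply: nested.
by have -> : ((k%:Z - N%:Z) + 1 = k.+1%:Z - N%:Z)%R by rewrite -addn1 PoszD; ring.
Qed.

Lemma wavg_le_dmax w f k x : wavg mu w (idx k) f x <= dmax w f x.
Proof.
pose N := `|k|%N; pose i := `|(k + N%:Z)%R|%N.
apply: le_ereal_sup_tmp; exists (runmax mu (level N) w f (2 * N) x); first by exists N.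
have -> : idx k = level N i by rewrite /level /i /N; congr idx; lia.
by apply: le_runmax; rewrite /i /N; lia.
Qed.

Lemma dmax_le w f x z : (forall k, wavg mu w (idx k) f x <= z) -> dmax w f x <= z.
Proof.
move=> H; apply: ge_ereal_sup => _ [N _ <-]; apply: runmax_le => i _; exact: H.
Qed.

Lemma nnm_dmax w f : positive_weight w -> nnm f -> nnm (dmax w f).
Proof.
by move=> /positive_weightP[w0 _] nf; apply: nnm_sup => N; apply: nnm_runmax => // k; exact: midx.
Qed.

Lemma runmax_level_mono w f x : {homo (fun N => runmax mu (level N) w f (2 * N) x) :
  n m / (n <= m)%N >-> n <= m}.
Proof.
move=> n m nm; apply: runmax_le => i ik.
have -> : level n i = level m (i + (m - n))%N.
  by rewrite /level; congr idx; lia.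
by apply: le_runmax; lia.
Qed.

(** Monotone convergence in every cell. This continuity from below is what lets the Rubio de Francia
    majorant be a supremum of iterates. *)
Lemma dmax_sup w (F : nat -> T -> \bar R) x z : (forall n, nnm (F n)) ->
  (forall x, {homo F ^~ x : n m / (n <= m)%N >-> n <= m}) ->
  (forall k, fiberwise_finite mu w (idx k)) ->
  (forall n, dmax w (F n) x <= z) ->
  dmax w (fun x => ereal_sup (range (F ^~ x))) x <= z.
Proof.
move=> nF hF fw H; apply: dmax_le => k; rewrite /wavg.
rewrite nnm_int_sup//; last exact: measurable_fiber.
have /andP[b0 boo] := fw k x; have [b b0' bE] := ltey_EFin (ltW b0) boo.
have bgt0 : (0 < b)%R by rewrite -lte_fin -bE.
rewrite bE inver gt_eqF// -ereal_sup_pZl ?invr_gt0//.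
apply: ge_ereal_sup => _ [_ [n _ <-] <-].
apply: le_trans (H n); apply: le_trans (wavg_le_dmax _ _ k x).
by rewrite /wavg bE inver gt_eqF.
Qed.

(** The constant is the same for all weights, which the proof of Muckenhoupt's theorem exploits with
    [w = om] and with [w = sig]. Positivity and finiteness of [w x] allow the power and the weight
    to be moved through the supremum. *)
Lemma doob_dmax w f (p : R) : (1 < p)%R -> positive_weight w ->
  (forall k, fiberwise_finite mu w (idx k)) -> nnm f ->
  \int[mu]_x (dmax w f x `^ p * (w x)%:E) <=
  ((p / (p - 1)) `^ p)%:E * \int[mu]_x (f x `^ p * (w x `^ (1 - p))%:E).
Proof.
move=> p1 pw fw nf; have /positive_weightP[w0 mw] := pw; have p0 : (0 < p)%R by lra.
pose F N x := runmax mu (level N) w f (2 * N) x `^ p * (w x)%:E.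
have nw := positive_weight_nnm pw.
have nr N : nnm (runmax mu (level N) w f (2 * N)).
  by apply: nnm_runmax => // k; exact: midx.
have nF N : nnm (F N) by apply: nnmM => //; exact: nnm_pow.
apply: (@le_trans _ _ (\int[mu]_x ereal_sup (range (F ^~ x)))).
  apply: nnm_le_int => //; [|exact: nnm_sup|].
    by apply: nnmM => //; apply: nnm_pow; exact: nnm_dmax.
  move=> x _; set G := ereal_sup _.
  suff H : dmax w f x `^ p <= G * ((w x)^-1)%:E.
    apply: (le_trans (lee_wpmul2r (nnm_ge0 x nw) H)).
    by rewrite -muleA -EFinM mulVf ?mule1// gt_eqF.
  have GV0 : 0 <= G * ((w x)^-1)%:E.
    rewrite mule_ge0 ?lee_fin ?invr_ge0 ?(ltW (w0 x))//.
    apply: le_ereal_sup_tmp; exists (F 0%N x); [by exists 0%N|exact: nnm_ge0].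
  have : dmax w f x <= (G * ((w x)^-1)%:E) `^ p^-1.
    apply: ge_ereal_sup => _ [N _ <-].
    rewrite -[leLHS](@poweRK _ p) ?gt_eqF ?(nnm_ge0 x (nr N))//.
    apply: le_poweR2r; rewrite ?invr_ge0 ?(ltW p0) ?poweR_ge0//.
    apply: (@le_trans _ _ (F N x * ((w x)^-1)%:E)).
      by rewrite /F -muleA -EFinM divff ?mule1// gt_eqF.
    apply: lee_wpmul2r; first by rewrite lee_fin invr_ge0 ltW.
    by apply: ereal_sup_ubound; exists N.
  move=> /(le_poweR2r (ltW p0)); rewrite poweRVK ?gt_eqF//; apply.
  exact: (nnm_ge0 x (nnm_dmax pw nf)).
rewrite nnm_int_sup//; last first.
  move=> x n m nm; apply: lee_wpmul2r; first exact: (nnm_ge0 x nw).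
  by apply: le_poweR2r; [exact: ltW|exact: nnm_ge0|exact: runmax_level_mono].
apply: ge_ereal_sup => _ [N _ <-].
apply: doob_runmax => //.
- by move=> k; exact: midx.
- by move=> k x y; exact: level_nested.
- by move=> k; exact: fw.
Qed.

Let one : T -> R := fun=> 1%R.
Hypothesis fone : forall k, fiberwise_finite mu one (idx k).

(* Muckenhoupt's theorem for one dyadic grid, by Lerner's pointwise bound
   [(M f)^(s-1) <= K M_om((M_sig f)^(s-1))], where [sig = om^(-1/(s-1))]. *)
Lemma muckenhoupt_dyadic (s K : R) (om : T -> R) : (1 < s)%R -> (0 < K)%R ->
  positive_weight om ->
  (forall k, fiberwise_finite mu om (idx k)) ->
  (forall k, fiberwise_finite mu (fun x => om x `^ (- (s - 1)^-1))%R (idx k)) ->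
  (forall k x, \int[mu]_(y in fiber (idx k) x) (om y)%:E *
     (\int[mu]_(y in fiber (idx k) x) (om y `^ (- (s - 1)^-1))%:E) `^ (s - 1) <=
     K%:E * (\int[mu]_(y in fiber (idx k) x) (one y)%:E) `^ s) ->
  exists2 B : R, (0 < B)%R & forall f, nnm f ->
    \int[mu]_x (dmax one f x `^ s * (om x)%:E) <=
    B%:E * \int[mu]_x (f x `^ s * (om x)%:E).
Proof.
move=> s1 K0 pom fom; set sig := (fun x => _) => fsig Hap.
have psig : positive_weight sig by exact: positive_weight_pow.
have s0 : (0 < s)%R by lra.
have s10 : (0 < s - 1)%R by lra.
have pone := positive_weight1.
(* The conjugate exponent, for which [y^s' = (M_sig f)^s] and [om^(1-s') = sig]. *)
pose s' := (s / (s - 1))%R.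
have s'1 : (1 < s')%R by rewrite /s' ltr_pdivlMr//; lra.
have s'0 : (0 < s')%R by lra.
pose C1 := ((s' / (s' - 1)) `^ s')%R; pose C2 := ((s / (s - 1)) `^ s)%R.
have C10 : (0 < C1)%R by rewrite powR_gt0// divr_gt0//; lra.
have C20 : (0 < C2)%R by rewrite powR_gt0// divr_gt0//; lra.
exists (K `^ s' * (C1 * C2))%R; first by rewrite !mulr_gt0// powR_gt0.
move=> f nf.
pose y x := dmax sig f x `^ (s - 1).
have nds : nnm (dmax sig f) by exact: nnm_dmax.
have ny : nnm y by exact: nnm_pow.
have nN : nnm (dmax om y) by exact: nnm_dmax.
have nD : nnm (dmax one f) by exact: nnm_dmax.
have nom := positive_weight_nnm pom.
have ptw x : dmax one f x <= (K%:E * dmax om y x) `^ (s - 1)^-1.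
  apply: dmax_le => k.
  have Z0 : 0 <= wavg mu one (idx k) f x.
    exact: (nnm_ge0 x (nnm_wavg _ (fun _ => midx k) (w:=one) (fun=> ltr01) 0 nf)).
  rewrite -[leLHS](@poweRK _ (s - 1)%R) ?gt_eqF//.
  apply: le_poweR2r; rewrite ?invr_ge0 ?(ltW s10) ?poweR_ge0//.
  have mQ : measurable (fiber (idx k) x) by exact: measurable_fiber.
  have /andP[W0 Woo] := fom k x; have [W _ WE] := ltey_EFin (ltW W0) Woo.
  have /andP[S0 Soo] := fsig k x; have [S _ SE] := ltey_EFin (ltW S0) Soo.
  have /andP[m0 moo] := fone k x; have [m _ mE] := ltey_EFin (ltW m0) moo.
  have {}W0 : (0 < W)%R by rewrite -lte_fin -WE.
  have {}S0 : (0 < S)%R by rewrite -lte_fin -SE.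
  have {}m0 : (0 < m)%R by rewrite -lte_fin -mE.
  have := Hap k x; rewrite WE SE mE !poweR_EFin -!EFinM lee_fin => WSm.
  have A0 : 0 <= \int[mu]_(y in fiber (idx k) x) f y by exact: nnm_int_ge0.
  apply: (@le_trans _ _ (K%:E * wavg mu om (idx k) y x)); last first.
    by apply: lee_wpmul2l; [rewrite lee_fin ltW|exact: wavg_le_dmax].
  (* Throughout the cell, [y] is at least the power [s - 1] of the [sig]-average over that same
     cell, a constant. *)
  have H : m%:E * (wavg mu sig (idx k) f x) `^ (s - 1) <=
           \int[mu]_(z in fiber (idx k) x) y z.
    rewrite muleC -mE -nnm_intZ//; last 2 first.
    - exact: poweR_ge0.
    - exact: positive_weight_nnm.
    apply: nnm_le_int => //.
      by apply: (nnmM (nnm_cst _ (poweR_ge0 _ _))); exact: positive_weight_nnm.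
    move=> z zx; rewrite mule1 -(wavg_fiber mu sig f zx).
    apply: le_poweR2r; [exact: ltW| |exact: wavg_le_dmax].
    exact: (nnm_ge0 z (nnm_wavg _ (fun _ => midx k) (w:=sig) (fun x => weight_gt0 x psig) 0 nf)).
  rewrite [in leRHS]/wavg WE.
  have WV : 0 <= W%:E^-1 :> \bar R by rewrite inve_ge0 lee_fin ltW.
  apply: (@le_trans _ _ (K%:E * (W%:E^-1 * (m%:E * wavg mu sig (idx k) f x `^ (s - 1))))).
    2: by apply: lee_wpmul2l; [rewrite lee_fin ltW|exact: lee_wpmul2l].
  rewrite /wavg SE mE !inver !gt_eqF//.
  rewrite !poweRM ?lee_fin ?invr_ge0 ?(ltW m0) ?(ltW S0)//.
  rewrite !muleA !poweR_EFin -!EFinM; apply: lee_wpmul2r; first exact: poweR_ge0.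
  rewrite lee_fin -(@powR_inv1 _ m) ?(ltW m0)// -(@powR_inv1 _ S) ?(ltW S0)//.
  rewrite -!powRrM !mulN1r !powRN.
  rewrite ler_pdivlMr ?powR_gt0// mulrC ler_pdivrMr ?powR_gt0//.
  rewrite -(ler_pM2l W0); apply: (le_trans WSm).
  rewrite -(mulr_powRB1 (ltW m0) s0).
  by rewrite le_eqVlt; apply/orP; left; apply/eqP; field; rewrite gt_eqF.
apply: (@le_trans _ _ (\int[mu]_x ((K `^ s')%:E * (dmax om y x `^ s' * (om x)%:E)))).
  apply: nnm_le_int => //.
  - by apply: nnmM => //; exact: nnm_pow.
  - by apply: nnmMl; [rewrite lee_fin powR_ge0|apply: nnmM => //; exact: nnm_pow].
  move=> x _; rewrite muleA; apply: lee_wpmul2r; first exact: (nnm_ge0 x nom).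
  apply: (le_trans (le_poweR2r (ltW s0) (nnm_ge0 x nD) (ptw x))).
  by rewrite -poweRrM mulrC poweRM ?lee_fin ?(ltW K0)//; exact: nnm_ge0.
rewrite nnm_intZ ?lee_fin ?powR_ge0//; last by apply: nnmM => //; exact: nnm_pow.
rewrite EFinM -muleA; apply: lee_wpmul2l; first by rewrite lee_fin powR_ge0.
apply: (le_trans (doob_dmax s'1 pom fom ny)).
rewrite EFinM -muleA; apply: lee_wpmul2l; first by rewrite lee_fin ltW.
(* The output of Doob's inequality for [om] is the input of the one for [sig]; afterwards
   [sig^(1-s) = om] closes the circle. *)
have -> : \int[mu]_x (y x `^ s' * (om x `^ (1 - s'))%:E) =
          \int[mu]_x (dmax sig f x `^ s * (sig x)%:E).
  apply: eq_integral => x _; rewrite /y -poweRrM /s' /sig.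
  rewrite (_ : (s - 1) * (s / (s - 1)) = s)%R; last by field; rewrite gt_eqF.
  by rewrite (_ : 1 - s / (s - 1) = - (s - 1)^-1)%R//; field; rewrite gt_eqF.
apply: (le_trans (doob_dmax s1 psig fsig nf)).
apply: lee_wpmul2l; first by rewrite lee_fin ltW.
rewrite le_eqVlt; apply/orP; left; apply/eqP; apply: eq_integral => x _.
rewrite /sig -powRrM (_ : - (s - 1)^-1 * (1 - s) = 1)%R; last by field; rewrite gt_eqF.
by rewrite powRr1// ltW// weight_gt0.
Qed.

End dyadic_maximal_function.

(** * The Rubio de Francia algorithm *)

Section rubio_de_francia.
Context d (T : measurableType d) (R : realType) (Theta : finType).
Variable mu : {measure set T -> \bar R}.
Variable M : Theta -> (T -> \bar R) -> T -> \bar R.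
Hypothesis nnm_M : forall t f, nnm f -> nnm (M t f).
Hypothesis le_M : forall t f g, nnm f -> nnm g ->
  (forall x, f x <= g x) -> forall x, M t f x <= M t g x.
Hypothesis M_sup : forall t (F : nat -> T -> \bar R) x z,
  (forall n, nnm (F n)) ->
  (forall x, {homo F ^~ x : n m / (n <= m)%N >-> n <= m}) ->
  (forall n, M t (F n) x <= z) -> M t (fun x => ereal_sup (range (F ^~ x))) x <= z.

(** Maxima take the place of the classical series of iterates [M^n h / (2 ||M||)^n]. The sequence
    increases, and monotonicity and continuity from below of the [M t] give [c M t H <= H] for its
    supremum, for all grids simultaneously. *)
Fixpoint rdf_iter (c : R) (h : T -> \bar R) n : T -> \bar R :=
  if n is n'.+1 then
    fun x => maxe (h x) (\big[maxe/0]_(t <- enum Theta) (c%:E * M t (rdf_iter c h n') x))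
  else h.

Lemma nnm_rdf_iter c h n : (0 < c)%R -> nnm h -> nnm (rdf_iter c h n).
Proof.
move=> c0 nh; elim: n => [//|n IH] /=.
apply: nnm_max => //; apply: nnm_bigmax => t; apply: nnmMl; last exact: nnm_M.
by rewrite lee_fin ltW.
Qed.

Lemma rdf_iter_mono c h x : (0 < c)%R -> nnm h ->
  {homo (fun n => rdf_iter c h n x) : n m / (n <= m)%N >-> n <= m}.
Proof.
move=> c0 nh; apply: homo_leq => //; first by move=> y z t; exact: le_trans.
move=> n; elim: n x => [|n IH] x; first by rewrite /= le_max lexx.
rewrite [leRHS]/= [leLHS]/=; rewrite ge_max !le_max lexx/=; apply/orP; right.
apply: bigmaxe_le => [|t tT].
  by elim/big_ind : _ => // [y z y0 z0|t _]; [rewrite le_max y0|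
    rewrite mule_ge0 ?lee_fin ?(ltW c0)//; exact/nnm_ge0/nnm_M/(nnm_rdf_iter n.+1)].
apply: le_trans (le_bigmaxe (fun t => c%:E * M t (rdf_iter c h n.+1) x) tT).
apply: lee_wpmul2l; first by rewrite lee_fin ltW.
by apply: le_M => //; exact: nnm_rdf_iter.
Qed.

Theorem rubio_de_francia (L : (R * (T -> R)) -> Prop) (B : R) : (0 < B)%R ->
  (forall s om, L (s, om) -> [/\ (1 < s)%R, positive_weight om &
     forall t f, nnm f -> \int[mu]_x (M t f x `^ s * (om x)%:E) <=
                   B%:E * \int[mu]_x (f x `^ s * (om x)%:E)]) ->
  exists2 c : R, (0 < c)%R & forall h, nnm h -> exists H : T -> \bar R,
    [/\ nnm H, forall x, h x <= H x, forall t x, c%:E * M t H x <= H x &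
        forall s om, L (s, om) -> \int[mu]_x (H x `^ s * (om x)%:E) <=
                        2%:E * \int[mu]_x (h x `^ s * (om x)%:E)].
Proof.
move=> B0 LP; pose N : R := (#|Theta|.+1)%:R.
have N1 : (1 <= N)%R by rewrite ler1n.
have N0 : (0 < N)%R by exact: lt_le_trans ltr01 N1.
(* This gives [N c B <= 1/2], so the invariant [int F_n^s om <= 2 J] survives an iteration: the new
   terms add at most [N c B] times [2 J], that is [J]. Since [c <= 1], [c^s <= c] for every [s > 1],
   and one [c] serves all of [L]. *)
pose c := (1 + 2 * N * B)^-1%R.
have den0 : (0 < 1 + 2 * N * B)%R by rewrite addr_gt0// !mulr_gt0.
have c0 : (0 < c)%R by rewrite invr_gt0.
have c1 : (c <= 1)%R by rewrite invf_le1// lerDl ltW// !mulr_gt0.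
have cB : (N * (c * B) <= 2^-1)%R.
  rewrite /c mulrCA mulrC ler_pdivrMr// mulrDr mulr1 mulrA mulrA mulVf// mul1r.
  by rewrite lerDr invr_ge0.
exists c => // h nh; pose F := rdf_iter c h.
have nF n : nnm (F n) by exact: nnm_rdf_iter.
have mF x : {homo F ^~ x : n m / (n <= m)%N >-> n <= m} by exact: rdf_iter_mono.
exists (fun x => ereal_sup (range (F ^~ x))); split.
- exact: nnm_sup.
- by move=> x; apply: ereal_sup_ubound; exists 0%N.
- move=> t x; set H := fun x => ereal_sup _.
  suff : M t H x <= (c^-1)%:E * H x.
    move=> /(lee_wpmul2l (ltW c0 : 0 <= c%:E)) /le_trans; apply.
    by rewrite muleA -EFinM divff ?mul1e// gt_eqF.
  apply: M_sup => // n.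
  rewrite -[leLHS](@EFinK_mule _ c) ?gt_eqF//.
  apply: lee_wpmul2l; first by rewrite lee_fin invr_ge0 ltW.
  apply: le_ereal_sup_tmp; exists (F n.+1 x); first by exists n.+1.
  rewrite /F /= le_max; apply/orP; right.
  apply: (@le_bigmaxe R _ _ (fun t => c%:E * M t (rdf_iter c h n) x)).
  by rewrite mem_enum.
move=> s om Lso; have [s1 pom Mb] := LP _ _ Lso.
have s0 : (0 < s)%R by exact: lt_trans ltr01 s1.
have nom := positive_weight_nnm pom.
have nFs n : nnm (fun x => F n x `^ s * (om x)%:E) by apply: nnmM => //; exact: nnm_pow.
apply: (@le_trans _ _ (\int[mu]_x ereal_sup (range (fun n => F n x `^ s * (om x)%:E)))).
  apply: nnm_le_int => //.
  - by apply: nnmM => //; apply: nnm_pow; exact: nnm_sup.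
  - exact: (nnm_sup (F := fun n x => F n x `^ s * (om x)%:E)).
  move=> x _; set G := ereal_sup (range (fun n => _ * _)).
  have om0 : (0 < om x)%R by exact: weight_gt0.
  have G0 : 0 <= G.
    apply: le_ereal_sup_tmp; exists (F 0%N x `^ s * (om x)%:E); first by exists 0%N.
    exact: (nnm_ge0 x (nFs 0%N)).
  suff H : ereal_sup (range (F ^~ x)) `^ s <= G * ((om x)^-1)%:E.
    apply: (le_trans (lee_wpmul2r (nnm_ge0 x nom) H)).
    by rewrite -muleA -EFinM mulVf ?mule1// gt_eqF.
  have GV0 : 0 <= G * ((om x)^-1)%:E by rewrite mule_ge0 ?lee_fin ?invr_ge0 ?(ltW om0).
  have : ereal_sup (range (F ^~ x)) <= (G * ((om x)^-1)%:E) `^ s^-1.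
    apply: ge_ereal_sup => _ [n _ <-].
    rewrite -[leLHS](@poweRK _ s) ?gt_eqF ?(nnm_ge0 x (nF n))//.
    apply: le_poweR2r; rewrite ?invr_ge0 ?(ltW s0) ?poweR_ge0//.
    apply: (@le_trans _ _ (F n x `^ s * (om x)%:E * ((om x)^-1)%:E)).
      by rewrite -muleA -EFinM divff ?mule1// gt_eqF.
    apply: lee_wpmul2r; first by rewrite lee_fin invr_ge0 ltW.
    by apply: ereal_sup_ubound; exists n.
  move=> /(le_poweR2r (ltW s0)); rewrite poweRVK ?gt_eqF//; apply.
  exact: (nnm_ge0 x (nnm_sup nF)).
rewrite nnm_int_sup//; last first.
  move=> x n m nm; apply: lee_wpmul2r; first exact: (nnm_ge0 x nom).
  by apply: le_poweR2r; [exact: ltW|exact: nnm_ge0|exact: mF].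
apply: ge_ereal_sup => _ [n _ <-].
set J := \int[mu]_x (h x `^ s * (om x)%:E).
have nh' : nnm (fun x => h x `^ s * (om x)%:E) by apply: nnmM => //; exact: nnm_pow.
have J0 : 0 <= J by exact: nnm_int_ge0.
elim: n => [|n IH]; first by rewrite -[leLHS]mul1e; apply: lee_wpmul2r => //; rewrite lee_fin ler1n.
pose G t x := (c%:E * M t (F n) x) `^ s * (om x)%:E.
have nG t : nnm (G t).
  apply: nnmM => //; apply: nnm_pow; apply: nnmMl; last exact: nnm_M.
  by rewrite lee_fin ltW.
have cM0 t x : 0 <= c%:E * M t (F n) x.
  by rewrite mule_ge0 ?lee_fin ?(ltW c0)//; exact/nnm_ge0/nnm_M.
apply: (@le_trans _ _ (\int[mu]_x (h x `^ s * (om x)%:E + \sum_(t <- enum Theta) G t x))).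
  apply: nnm_le_int => //; first by apply: nnmD => //; exact: nnm_sum.
  move=> x _; rewrite -[X in _ + X]ge0_sume_distrl; last by move=> t _; exact: poweR_ge0.
  rewrite -ge0_muleDl ?poweR_ge0 ?sume_ge0//; last by move=> t _; exact: poweR_ge0.
  apply: lee_wpmul2r; first exact: (nnm_ge0 x nom).
  pose m := \big[maxe/0]_(t <- enum Theta) (c%:E * M t (F n) x).
  rewrite -[F n.+1 x]/(maxe (h x) m).
  have m0 : 0 <= m by rewrite /m; elim/big_ind : _ => // y z y0 z0; rewrite le_max y0.
  apply: (le_trans (poweR_maxe (ltW s0) (nnm_ge0 x nh) m0)).
  by apply: leeD => //; exact: poweR_bigmax.
rewrite nnm_intD//; last exact: nnm_sum.
rewrite nnm_int_sum// -/J.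
have GB t : \int[mu]_x G t x <= (2 * (c * B))%:E * J.
  rewrite /G; under eq_integral do rewrite poweRM ?lee_fin ?(ltW c0) ?(nnm_ge0 _ (nnm_M _ (nF n)))// -muleA.
  rewrite nnm_intZ ?poweR_ge0//; last by apply: nnmM => //; apply: nnm_pow; exact: nnm_M.
  rewrite poweR_EFin; apply: (@le_trans _ _ ((c * B)%:E * (2%:E * J))).
    apply: (@le_trans _ _ (c%:E * (B%:E * \int[mu]_x (F n x `^ s * (om x)%:E)))).
      apply: lee_pmul; rewrite ?lee_fin ?powR_ge0//; last exact: Mb.
        by apply: nnm_int_ge0; apply: nnmM => //; apply: nnm_pow; exact: nnm_M.
      by rewrite ge1r_powR// ?c0// ltW.
    rewrite muleA -EFinM; apply: lee_wpmul2l => //.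
    by rewrite lee_fin mulr_ge0 ?(ltW c0) ?(ltW B0).
  by rewrite muleA -EFinM (mulrC _ 2%R).
apply: (@le_trans _ _ (J + (\sum_(t <- enum Theta) (2 * (c * B)))%:E * J)).
  apply: leeD => //; rewrite -sumEFin ge0_sume_distrl; first exact: lee_sum.
  by move=> t _; rewrite lee_fin !mulr_ge0// ltW.
rewrite -[X in X + _]mul1e -ge0_muleDl//; last first.
  by rewrite lee_fin sumr_ge0// => t _; rewrite !mulr_ge0// ltW.
apply: lee_wpmul2r => //; rewrite -EFinD lee_fin.
rewrite big_const_seq count_predT iter_addr_0 -cardE.
have : (#|Theta|%:R * (c * B) <= N * (c * B))%R.
  by rewrite ler_pM2r ?mulr_gt0// /N ler_nat.
rewrite -mulr_natl; lra.
Qed.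

End rubio_de_francia.

(** * Cubes and shifted dyadic grids *)

Section boxes.
Context {R : realType} {n : nat}.
Implicit Types (a b t : 'rV[R]_n) (l s : R) (E : set 'rV[R]_n).

Definition cube a l : set 'rV[R]_n := box a (\row_i (a ord0 i + l))%R.

Lemma cubeP a l x : cube a l x <-> forall i, (a ord0 i <= x ord0 i <= a ord0 i + l)%R.
Proof. by split => H i; have := H i; rewrite mxE. Qed.

Lemma box_vol_cube a l : (0 <= l)%R ->
  box_vol a (\row_i (a ord0 i + l))%R = (l ^+ n)%R.
Proof.
move=> l0; rewrite /box_vol (eq_bigr (fun=> l)); last first.
  by move=> i _; rewrite mxE addrC addKr max_r.
by rewrite big_const_ord iter_mulr_1.
Qed.

Lemma leb_outer_affine s t E : (0 < s)%R ->
  leb_outer [set (s *: x + t)%R | x in E] <= (s ^+ n)%:E * leb_outer E.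
Proof.
move=> s0; have sn0 : (0 < s ^+ n)%R by rewrite exprn_gt0.
rewrite -[leLHS](@EFinK_mule _ (s ^+ n)^-1%R) ?invrK ?invr_eq0 ?gt_eqF//.
apply: lee_wpmul2l; first by rewrite lee_fin ltW.
apply: le_ereal_inf_tmp => _ [B BE <-].
rewrite -[leRHS](@EFinK_mule _ (s ^+ n)%R) ?gt_eqF//.
apply: lee_wpmul2l; first by rewrite lee_fin invr_ge0 ltW.
rewrite -nneseriesZl; last by move=> k _; rewrite lee_fin box_vol_ge0.
apply: ereal_inf_lbound; exists (fun k => (s *: (B k).1 + t, s *: (B k).2 + t)%R).
  move=> _ [x Ex <-]; have [k _ Bk] := BE x Ex; exists k => //= i.
  have /andP[h1 h2] := Bk i.
  by rewrite !mxE !lerD2r !ler_pM2l// h1.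
apply: eq_eseriesr => k _; rewrite -EFinM; congr EFin; rewrite /box_vol /=.
rewrite -[X in (s ^+ X)%R]card_ord -prodr_const -big_split/=.
apply: eq_bigr => i _; rewrite !mxE [RHS]mulrC maxr_pMl ?(ltW s0)// mul0r.
by congr Num.max; ring.
Qed.

End boxes.

Section boxes_measure.
Context {R : realType} {n : nat}.
Implicit Types (a b : 'rV[R]_n.+1) (l : R).
Local Notation T := (Rn R n.+1).

Lemma leb_outer_box a b : leb_outer (box a b) <= (box_vol a b)%:E.
Proof.
pose B (k : nat) : 'rV[R]_n.+1 * 'rV[R]_n.+1 := if k is 0%N then (a, b) else (0%R, 0%R).
have H : leb_outer (box a b) <= \sum_(k <oo) (box_vol (B k).1 (B k).2)%:E.
  by apply: ereal_inf_lbound; exists B => // x xab; exists 0%N.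
apply: (le_trans H).
rewrite (@nneseries_split _ _ 0 1) => [|k _]; last by rewrite lee_fin box_vol_ge0.
rewrite big_nat1 eseries0 ?adde0// => -[|k]//= _ _.
by rewrite /box_vol big_ord_recl !mxE subrr maxxx mul0r.
Qed.

(** Its value is never computed: scaling expresses the measure of every cube through it,
    [ae_trivial] disposes of the value 0, and otherwise it is a mere normalizing constant. *)
Definition unit_cube_vol : R := fine (@leb_outer R n.+1 (cube 0%R 1%R)).

Lemma leb_outer_unit_cube : @leb_outer R n.+1 (cube 0%R 1%R) = unit_cube_vol%:E.
Proof.
rewrite /unit_cube_vol fineK// ge0_fin_numE ?leb_outer_ge0//.
by apply: (le_lt_trans (leb_outer_box _ _)); rewrite ltry.
Qed.

Lemma unit_cube_vol_ge0 : (0 <= unit_cube_vol)%R.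
Proof. by rewrite -lee_fin -leb_outer_unit_cube leb_outer_ge0. Qed.

Lemma leb_cube a l : (0 < l)%R ->
  @leb R n (cube a l) = (unit_cube_vol * l ^+ n.+1)%:E.
Proof.
move=> l0; apply/eqP; rewrite eq_le; apply/andP; split.
  have := @leb_outer_affine R n.+1 l a (cube 0%R 1%R) l0.
  rewrite leb_outer_unit_cube -EFinM mulrC => H; apply: le_trans H.
  apply: le_leb_outer => x /cubeP xa.
  exists (l^-1 *: (x - a))%R; last by rewrite scalerA divff ?gt_eqF// scale1r subrK.
  apply/cubeP => i; rewrite !mxE; have /andP[h1 h2] := xa i.
  rewrite add0r mulr_ge0 ?invr_ge0 ?(ltW l0) ?subr_ge0//=.
  by rewrite mulrC ler_pdivrMr// mul1r lerBlDl.
have := @leb_outer_affine R n.+1 l^-1%R (- (l^-1 *: a))%R (cube a l).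
rewrite invr_gt0 => /(_ l0) H.
rewrite mulrC EFinM -leb_outer_unit_cube.
rewrite -[leRHS](@EFinK_mule _ (l ^- n.+1)%R) ?invr_eq0 ?gt_eqF ?exprn_gt0//.
rewrite invrK; apply: lee_wpmul2l; first by rewrite lee_fin exprn_ge0// ltW.
rewrite -exprVn; apply: le_trans H; apply: le_leb_outer => x /cubeP x01.
exists (l *: x + a)%R; last first.
  by rewrite scalerDr scalerA mulVf ?gt_eqF// scale1r addrK.
apply/cubeP => i; have /andP[h1 h2] := x01 i; move: h1 h2; rewrite !mxE add0r => h1 h2.
rewrite lerDr mulr_ge0 ?(ltW l0)//= addrC lerD2l.
by rewrite -[leRHS]mulr1 ler_pM2l.
Qed.

Definition coord (x : T) i : R := (x : 'rV[R]_n.+1) ord0 i.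

Lemma interval_length_split (p q c : R) : (Num.max 0 (q - p) =
  Num.max 0 (Num.min q c - p) + Num.max 0 (q - Num.max p c))%R.
Proof.
rewrite /Num.min /Num.max; case: (ltP q c) => ?; case: (ltP p c) => ?;
  by repeat (case: (ltP _ _) => ?); lra.
Qed.

(** Carathéodory's criterion on covers: the hyperplane cuts every box into two closed boxes whose
    volumes add up, because only the factor of the side [i] is split. If the box lies on one side,
    the other piece has an inverted side, hence volume 0. *)
Lemma measurable_halfspace i (c : R) : measurable [set x : T | (coord x i < c)%R].
Proof.
apply: (@le_caratheodory_measurable R _ (@leb_outer R n.+1)) => X.
apply: le_ereal_inf_tmp => _ [B BX <-].
pose B1 k : 'rV[R]_n.+1 * 'rV[R]_n.+1 := ((B k).1,
  \row_j (if j == i then Num.min ((B k).2 ord0 j) c else (B k).2 ord0 j))%R.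
pose B2 k : 'rV[R]_n.+1 * 'rV[R]_n.+1 := (
  \row_j (if j == i then Num.max ((B k).1 ord0 j) c else (B k).1 ord0 j), (B k).2)%R.
have volB k : box_vol (B k).1 (B k).2 =
    (box_vol (B1 k).1 (B1 k).2 + box_vol (B2 k).1 (B2 k).2)%R.
  have D1 (p q : 'rV[R]_n.+1) : box_vol p q = (Num.max 0 (q ord0 i - p ord0 i) *
      \prod_(j < n.+1 | j != i) Num.max 0 (q ord0 j - p ord0 j))%R.
    by rewrite /box_vol (bigD1 i).
  rewrite !D1 /= !mxE eqxx.
  rewrite [X in (_ = _ * X + _)%R](eq_bigr (fun j => Num.max 0 ((B k).2 ord0 j - (B k).1 ord0 j)))%R; last first.
    by move=> j ji; rewrite mxE (negbTE ji).
  rewrite [X in (_ = _ + _ * X)%R](eq_bigr (fun j => Num.max 0 ((B k).2 ord0 j - (B k).1 ord0 j)))%R; last first.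
    by move=> j ji; rewrite mxE (negbTE ji).
  rewrite -mulrDl; congr (_ * _)%R.
  exact: interval_length_split.
have -> : \sum_(k <oo) (box_vol (B k).1 (B k).2)%:E =
  \sum_(k <oo) (box_vol (B1 k).1 (B1 k).2)%:E +
  \sum_(k <oo) (box_vol (B2 k).1 (B2 k).2)%:E.
  rewrite -nneseriesD; [|by move=> *; rewrite lee_fin box_vol_ge0..].
  by apply: eq_eseriesr => k _; rewrite volB EFinD.
apply: leeD; apply: ereal_inf_lbound.
  exists B1 => // x [Xx /= xc]; have [k _ Bk] := BX x Xx; exists k => //= j.
  have /andP[h1 h2] := Bk j; rewrite mxE h1 /=.
  by case: eqP => // ->; rewrite le_min (ltW xc) andbT; have /andP[] := Bk i.
exists B2 => // x [Xx /= /negP]; rewrite -leNgt => xc.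
have [k _ Bk] := BX x Xx; exists k => //= j.
have /andP[h1 h2] := Bk j; rewrite mxE h2 andbT.
by case: eqP => // ->; rewrite ge_max xc andbT; have /andP[] := Bk i.
Qed.

Lemma measurable_coord i : measurable_fun [set: T] (coord ^~ i).
Proof.
apply: (measurability _ (RGenInftyO.measurableE R)) => _ [_ [c ->] <-].
by rewrite setTI; have := measurable_halfspace i c; congr measurable.
Qed.

Lemma measurable_box a b : measurable (box a b : set T).
Proof.
have -> : (box a b : set T) =
    \bigcap_(i in [set: 'I_n.+1]) (coord ^~ i) @^-1` `[a ord0 i, b ord0 i].
  by apply/seteqP; split => x H i; have := H i; rewrite /= in_itv/=; [|apply].
apply: fin_bigcap_measurable => // i _.
by rewrite -[X in measurable X]setTI; exact: measurable_coord.
Qed.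

End boxes_measure.

Section shifted_dyadic_grids.
Context {R : realType} {n : nat}.
Local Notation T := (Rn R n.+1).
Local Notation Theta := {ffun 'I_n.+1 -> bool}.
Local Notation I := {ffun 'I_n.+1 -> int}.
Implicit Types (t : Theta) (k : int) (x y : T).

(* At level [k] the grid has side [2^-k] and is shifted by [(-1)^k / 3] of a side
   in the coordinates [i] such that [t i]; the sign makes the levels nested. *)
Definition shift t k i : R := ((-1) ^ k * (if t i then 3^-1 else 0))%R.

Definition grid t k x : I :=
  [ffun i => Num.floor (2 ^ k * coord x i + shift t k i)%R].

Definition side k : R := (2 ^ (- k))%R.

Lemma side_gt0 k : (0 < side k)%R.
Proof. exact: exprz_gt0. Qed.

Lemma side_inv k : (2 ^ k)%R = (side k)^-1%R :> R.
Proof. by rewrite /side -invr_expz invrK. Qed.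

Lemma side_succ k : side k = (2 * side (k + 1))%R.
Proof.
rewrite /side opprD exprzDr ?unitfE// (_ : 2 ^ (-1) = 2^-1)%R//.
by rewrite mulrCA divff ?mulr1.
Qed.

Lemma shift_succ t k i : shift t (k + 1) i = (- shift t k i)%R.
Proof. by rewrite /shift exprzDr ?unitrN1// expr1z mulrN1 mulNr. Qed.

Lemma sign_exprz k : {m : int | ((-1) ^ k = m%:~R :> R)%R}.
Proof.
case: k => k; first by exists ((-1) ^+ k)%R; rewrite rmorphXn/= rmorphN1.
by exists ((-1) ^+ k.+1)%R; rewrite NegzE -exprnN invr_sign rmorphXn/= rmorphN1.
Qed.

(** With [p = 2^k] and [e] the shift, [2 (p z + e) = (2 p z - e) + 3 e] and [3 e] is an integer.
    Hence the floor at the coarse level is a function of the floor at the fine level, whose shift is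
    [- e]. *)
Lemma grid_nested t k x y : grid t (k + 1) x = grid t (k + 1) y -> grid t k x = grid t k y.
Proof.
move=> /ffunP H; apply/ffunP => i; have := H i; rewrite !ffunE.
rewrite !shift_succ exprzDr ?unitfE// expr1z.
have [m mE] : exists m : int, (3 * shift t k i = m%:~R :> R)%R.
  have [m mE] := sign_exprz k; rewrite /shift mE; case: (t i); last first.
    by exists 0%R; rewrite mulr0 mulr0.
  by exists m; rewrite mulrCA divff ?mulr1.
set e := shift t k i in mE *; set p := (2 ^ k)%R : R.
have half (z : R) : Num.floor (p * z + e)%R =
    Num.floor (2^-1 * ((Num.floor (p * 2 * z - e))%:~R + m%:~R) : R)%R.
  set N := Num.floor (p * 2 * z - e)%R.
  apply/esym/floor_def; set Q := Num.floor _.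
  have /andP[h1 h2] := floor_itv (p * 2 * z - e)%R.
  have /andP[q1 q2] := floor_itv (p * z + e)%R.
  rewrite -/N in h1 h2; rewrite -/Q in q1 q2.
  rewrite !intrD in h2 q2 *.
  have a1 : (2 * Q < N + m + 1)%R by rewrite -(ltr_int R) !intrD intrM; lra.
  have a2 : (N + m < 2 * (Q + 1))%R by rewrite -(ltr_int R) !(intrD, intrM); lra.
  have b1 : (2 * Q <= N + m)%R by lia.
  move: b1 a2; rewrite -(ler_int R) -(ltr_int R) !(intrD, intrM) => b1 a2.
  by apply/andP; split; lra.
by move=> H'; rewrite (half (coord x i)) H' -half.
Qed.

Lemma gridP t k x y : grid t k y = grid t k x <->
  forall i, ((grid t k x i)%:~R <= 2 ^ k * coord y i + shift t k i < (grid t k x i)%:~R + 1)%R.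
Proof.
split=> [<- i|H].
  by rewrite ffunE; have := floor_itv (2 ^ k * coord y i + shift t k i)%R; rewrite intrD.
apply/ffunP => i; rewrite ffunE; apply: floor_def.
by rewrite intrD; exact: H.
Qed.

Definition corner t k x : 'rV[R]_n.+1 :=
  \row_i (side k * ((grid t k x i)%:~R - shift t k i))%R.

Lemma level_le k (g e z : R) : (g <= 2 ^ k * z + e)%R = (side k * (g - e) <= z)%R.
Proof. by rewrite -lerBlDr side_inv ler_pdivlMl ?side_gt0. Qed.

Lemma level_lt k (g e z : R) : (2 ^ k * z + e < g)%R = (z < side k * (g - e))%R.
Proof. by rewrite -ltrBrDr side_inv ltr_pdivrMl ?side_gt0. Qed.

Lemma cellP t k x y : fiber (grid t k) x y <->
  forall i, (corner t k x ord0 i <= coord y i < corner t k x ord0 i + side k)%R.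
Proof.
rewrite /fiber /=; rewrite gridP; split => H i; have := H i; rewrite mxE.
  by rewrite level_le level_lt (addrAC _ 1%R) [(side k * (_ + 1))%R]mulrDr mulr1.
by rewrite level_le level_lt (addrAC _ 1%R) [(side k * (_ + 1))%R]mulrDr mulr1.
Qed.

Lemma cell_sub_cube t k x : fiber (grid t k) x `<=` cube (corner t k x) (side k).
Proof.
move=> y /cellP H; apply/cubeP => i; have /andP[h1 h2] := H i.
by apply/andP; split => //; exact: ltW.
Qed.

(** Cells are half-open, so their volume is only compared with that of closed cubes inside and
    outside. Half the side is a convenient choice; it costs the factor [2^(n+1)] in [cell_volE]. *)
Lemma cube_sub_cell t k x : cube (corner t k x) (side k / 2) `<=` fiber (grid t k) x.
Proof.
move=> y /cubeP H; apply/cellP => i; have /andP[h1 h2] := H i.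
apply/andP; split => //; apply: le_lt_trans h2 _; rewrite ltrD2l.
by have := side_gt0 k; lra.
Qed.

Lemma measurable_grid t k : partition_measurable (T := T) (grid t k).
Proof.
move=> j.
have -> : [set y | grid t k y = j] =
    \bigcap_(i in [set: 'I_n.+1]) (coord ^~ i) @^-1`
       [set r | ((j i)%:~R <= 2 ^ k * r + shift t k i < (j i)%:~R + 1)%R].
  apply/seteqP; split => y /=.
    by move=> <- i _; exact: (gridP t k y y).1.
  by move=> H; apply/ffunP => i; rewrite ffunE; apply: floor_def; rewrite intrD; exact: H.
apply: fin_bigcap_measurable => // i _.
rewrite -[X in measurable X]setTI; apply: measurable_coord => //.
set g := (_ %:~R)%R; set e := shift _ _ _.
have -> : [set r : R | (g <= 2 ^ k * r + e < g + 1)%R] =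
    `[(side k * (g - e))%R, (side k * (g + 1 - e))%R[%classic.
  by apply/seteqP; split => r /=; rewrite in_itv/= level_le level_lt.
exact: measurable_itv.
Qed.

(** The one-third trick: in units of the side, jump points of the two grids are at distance at least
    [1/3], and a shorter interval cannot meet both. *)
Lemma interval_in_grid k (a l : R) : (0 < l)%R -> (3 * l < side k)%R ->
  exists b : bool, Num.floor (2 ^ k * a + (-1) ^ k * (if b then 3^-1 else 0))%R =
                   Num.floor (2 ^ k * (a + l) + (-1) ^ k * (if b then 3^-1 else 0))%R.
Proof.
move=> l0 l3; set p := (2 ^ k)%R : R.
have p0 : (0 < p)%R by exact: exprz_gt0.
have pl : (3 * (p * l) < 1)%R.
  by rewrite mulrCA /p side_inv ltr_pdivrMl ?side_gt0// mulr1.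
have pl0 : (0 < p * l)%R by exact: mulr_gt0.
have jump z : Num.floor z != Num.floor (z + p * l)%R ->
    exists N : int, (z < N%:~R <= z + p * l)%R.
  move=> zN; exists (Num.floor (z + p * l)%R).
  have /andP[h1 h2] := floor_itv (z + p * l)%R; rewrite h1 andbT ltNge.
  apply/negP => h3; move/eqP: zN; apply.
  by apply: floor_def; rewrite h3/=; apply: lt_trans h2; rewrite ltrDl.
have [H0|/eqP/jump[N /andP[N1 N2]]] := pselect (Num.floor (p * a)%R = Num.floor (p * a + p * l)%R).
  by exists false; rewrite mulr0 !addr0 mulrDr.
exists true; apply: contrapT; rewrite mulrDr addrAC => /eqP/jump[N'].
have [e eE] : exists e : bool, ((-1) ^ k * 3^-1 = (if e then 3^-1 else - 3^-1) :> R)%R.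
  case: (k) => m; rewrite ?NegzE -?exprnN ?invr_sign -?exprnP -signr_odd.
    by case: odd; [exists false|exists true]; rewrite ?expr0 ?expr1; ring.
  by case: odd; [exists false|exists true]; rewrite ?expr0 ?expr1; ring.
rewrite eE => /andP[N'1 N'2].
case: e eE N'1 N'2 => _ N'1 N'2.
  have : (N < N')%R by rewrite -(ltr_int R); lra.
  have : (N' < N + 1)%R by rewrite -(ltr_int R) intrD; lra.
  by lia.
have : (N' < N)%R by rewrite -(ltr_int R); lra.
have : (N - 1 < N')%R by rewrite -(ltr_int R) intrD; lra.
by lia.
Qed.

Lemma exists_side (y : R) : (0 < y)%R -> exists k, (y < side k <= 2 * y)%R.
Proof.
move=> y0; have ln2 : (0 < ln 2 :> R)%R by rewrite ln_gt0// ltr1n.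
pose j := Num.floor (ln y / ln 2)%R.
have yE : y = (2 `^ (ln y / ln 2))%R.
  by rewrite /powR gt_eqF// divfK ?gt_eqF// lnK.
have /andP[h1 h2] := floor_itv (ln y / ln 2)%R; rewrite -/j in h1 h2.
have l1 : (2 ^ j <= y)%R by rewrite [leRHS]yE -powR_intmul// ler_powR// ler1n.
have l2 : (y < 2 ^ (j + 1))%R.
  rewrite [ltLHS]yE -powR_intmul//.
  by rewrite /powR !gt_eqF// ltr_expR ltr_pM2r.
exists (- (j + 1))%R; rewrite /side opprK l2/= exprzDr ?unitfE// expr1z mulrC.
by rewrite ler_pM2l.
Qed.

Lemma cube_in_cell (a : 'rV[R]_n.+1) l : (0 < l)%R -> exists t k,
  (side k <= 6 * l)%R /\ forall x, cube a l x -> cube a l `<=` fiber (grid t k) x.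
Proof.
move=> l0; have [k /andP[k1 k2]] := exists_side (mulr_gt0 (ltr0n R 3) l0).
have /choice[b bP] : forall i : 'I_n.+1, exists b : bool, _ :=
  fun i => interval_in_grid (a ord0 i) l0 k1.
exists [ffun i => b i], k; split; first by lra.
suff H y : cube a l y -> grid [ffun i => b i] k y =
    [ffun i => Num.floor (2 ^ k * (a ord0 i) + (-1) ^ k * (if b i then 3^-1 else 0))%R].
  by move=> x xa y ya; rewrite /fiber /= !H.
move=> /cubeP ya; apply/ffunP => i; rewrite !ffunE /shift ffunE.
have /andP[y1 y2] := ya i; apply/eqP; rewrite eq_le.
have p0 : (0 < 2 ^ k :> R)%R by exact: exprz_gt0.
by apply/andP; split; [rewrite bP|]; apply: le_floor; rewrite lerD2r ler_pM2l.
Qed.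

End shifted_dyadic_grids.

(** * The reverse Hölder inequality *)

Section reverse_holder_inequality.
Context d (T : measurableType d) (R : realType) (I : countType).
Variable mu : {measure set T -> \bar R}.

Lemma poweR_sup_le (p : R) (F : nat -> \bar R) z : (0 < p)%R ->
  (forall n, 0 <= F n) -> (forall n, F n `^ p <= z) -> ereal_sup (range F) `^ p <= z.
Proof.
move=> p0 F0 Fz; have z0 : 0 <= z by apply: le_trans (Fz 0%N); exact: poweR_ge0.
have S0 : 0 <= ereal_sup (range F) by apply: le_ereal_sup_tmp; exists (F 0%N); first by exists 0%N.
rewrite -[leRHS](@poweRVK _ p) ?gt_eqF//; apply: le_poweR2r => //; first exact: ltW.
apply: ge_ereal_sup => _ [n _ <-]; rewrite -[leLHS](@poweRK _ p) ?gt_eqF//.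
by apply: le_poweR2r; rewrite ?poweR_ge0// invr_ge0 ltW.
Qed.

(* A discrete form of [d(x X^eps) <= X^eps dx + eps D d(X^(1+eps))] for the running
   maximum [X], in which the jumps of [X] at most multiply it by [D]. *)
Lemma reverse_holder_step (a b eps D : R) : (0 < eps < 1)%R -> (0 <= a)%R ->
  (0 <= b)%R -> (0 <= D)%R -> (b <= D * a)%R ->
  (b * Num.max a b `^ eps + D * eps * (a * a `^ eps) <=
   b * a `^ eps + D * eps * (Num.max a b * Num.max a b `^ eps))%R.
Proof.
move=> eps01 a0 b0 D0 bDa; have /andP[e0 e1] := eps01.
case: (leP b a) => [ba|ab]; first by rewrite lerD2l.
have a_gt0 : (0 < a)%R.
  rewrite lt_neqAle a0 andbT; apply/eqP => aE; move: bDa ab.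
  by rewrite -aE mulr0; lra.
have := young_powR eps01 b0 a0.
have A0 : (0 < a `^ eps)%R by exact: powR_gt0.
have AB : (a `^ eps <= b `^ eps)%R.
  by apply: ge0_ler_powR; rewrite ?nnegrE// ltW.
move=> /(ler_wpM2l (ltW A0)).
rewrite mulrCA -powRD; last by apply/implyP => _; rewrite gt_eqF.
rewrite addrCA subrr addr0 powRr1//.
set A := (a `^ eps)%R in A0 AB *; set B := (b `^ eps)%R in AB *.
move=> H.
(* Concavity of the power [eps]. The bounded jump [b <= D a] then trades the factor [b] for
   [D a]. *)
have h1 : (a * (B - A) <= eps * A * (b - a))%R by lra.
have h2 : (b * (B - A) <= D * (a * (B - A)))%R.
  by rewrite mulrA ler_wpM2r ?subr_ge0.
have h3 : (D * (a * (B - A)) <= D * (eps * A * (b - a)))%R by rewrite ler_wpM2l.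
have h4 : (D * eps * (A * (b - a)) <= D * eps * (b * B - a * A))%R.
  apply: ler_wpM2l; first by rewrite mulr_ge0// ltW.
  have : (b * A <= b * B)%R by rewrite ler_wpM2l.
  lra.
lra.
Qed.

Variable idx : nat -> T -> I.
Hypothesis midx : forall k, partition_measurable (idx k).
Hypothesis nested : forall k x y, idx k.+1 x = idx k.+1 y -> idx k x = idx k y.
Let one : T -> R := fun=> 1%R.
Hypothesis fone : forall k, fiberwise_finite mu one (idx k).
Variable u : T -> R.
Hypothesis pu : positive_weight u.
Hypothesis fu : forall k, fiberwise_finite mu u (idx k).
Local Notation U := (fun x => (u x)%:E).
Local Notation avg k := (wavg mu one (idx k) U).
Local Notation X := (runmax mu idx one U).
Hypothesis density : {ae mu, forall x, (u x)%:E <= ereal_sup (range (X ^~ x))}.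
Variables (C D : R).
Hypothesis C1 : (1 <= C)%R.
Hypothesis D1 : (1 <= D)%R.
Hypothesis avgA1 : forall j k x, (j <= k)%N -> avg j x <= C%:E * avg k x.
Hypothesis avg_doubling : forall k x, avg k.+1 x <= D%:E * avg k x.

(** Chosen so that [D * eps * C = 1/2], which is absorbed in [a_le]. *)
Let eps : R := ((2 * D * C)^-1)%R.

Let C0 : (0 < C)%R. Proof. exact: lt_le_trans ltr01 C1. Qed.
Let D0 : (0 < D)%R. Proof. exact: lt_le_trans ltr01 D1. Qed.

Let eps01 : (0 < eps < 1)%R.
Proof.
rewrite /eps invr_gt0 !mulr_gt0//= invf_lt1 ?mulr_gt0//.
apply: (@lt_le_trans _ _ 2%R); first by rewrite ltr1n.
by rewrite -mulrA -[leLHS]mulr1 ler_pM2l// mulr_ege1.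
Qed.

Let nU : nnm U. Proof. exact: positive_weight_nnm. Qed.
Let none : nnm (EFin \o one). Proof. exact: positive_weight_nnm (@positive_weight1 _ T R). Qed.

Let navg k : nnm (avg k).
Proof. by apply: wavg_nnm => // x; exact: (nnm_ge0 x nU). Qed.

Let nX k : nnm (X k).
Proof. by apply: nnm_runmax => // x; exact: weight_gt0 (@positive_weight1 _ T R). Qed.

Let avg_fin k x : avg k x < +oo.
Proof.
rewrite /wavg; have /andP[a0 aoo] := fu k x; have /andP[m0 moo] := fone k x.
have [a _ ->] := ltey_EFin (ltW a0) aoo; have [m mge0 mE] := ltey_EFin (ltW m0) moo.
by rewrite mE inver gt_eqF -?EFinM ?ltry// -lte_fin -mE.
Qed.

Let X_fin k x : X k x < +oo.
Proof. by elim: k => [|k IH] /=; [exact: avg_fin|rewrite gt_max IH avg_fin]. Qed.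

Let idx0 k x y : idx k x = idx k y -> idx 0 x = idx 0 y.
Proof. by elim: k => // k IH /nested. Qed.

Variable x0 : T.
Let Q := fiber (idx 0) x0.
Let mQ : measurable Q. Proof. exact: measurable_fiber. Qed.
Let ind x : \bar R := (\1_Q x)%:E.

Let nind : nnm ind. Proof. exact: nnm_indic. Qed.

Let ind_fiber k x y : idx k x = idx k y -> ind x = ind y.
Proof.
move=> /idx0 xy; rewrite /ind !indicE.
have -> // : (x \in Q) = (y \in Q).
by apply/idP/idP; rewrite !inE /Q /fiber /= xy.
Qed.

Let tower k j : (j <= k)%N ->
  \int[mu]_x (ind x * X j x `^ eps * avg k x) = \int[mu]_x (ind x * X j x `^ eps * U x).
Proof.
move=> jk; rewrite -(wavg_int (midx k) (fone k) none nU).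
- by apply: eq_integral => x _; rewrite mule1.
- by move=> x; rewrite mule_ge0 ?poweR_ge0// nnm_ge0.
move=> x y xy; rewrite (ind_fiber xy); congr (_ * _ `^ _).
apply: runmax_fiber => //; elim: k jk xy => [|k IH]; first by rewrite leqn0 => /eqP ->.
by rewrite leq_eqVlt => /predU1P[->//|jk] /nested; exact: IH.
Qed.

(** By [tower] this is the integral of [X k^eps u] over [Q], whereas [b k] is that of
    [X k^(1 + eps)]. *)
Let a k := \int[mu]_x (ind x * X k x `^ eps * avg k x).
Let b k := \int[mu]_x (ind x * (X k x * X k x `^ eps)).

Let nb k : nnm (fun x => ind x * (X k x * X k x `^ eps)).
Proof. by apply: nnmM => //; apply: nnmM => //; exact: nnm_pow. Qed.

Let na j k : nnm (fun x => ind x * X j x `^ eps * avg k x).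
Proof. by apply: nnmM => //; apply: nnmM => //; exact: nnm_pow. Qed.

Let X_le k x : X k x <= (D ^+ k)%:E * avg 0 x.
Proof.
have h i : avg i x <= (D ^+ i)%:E * avg 0 x.
  elim: i => [|i IH]; first by rewrite expr0 mul1e.
  apply: (le_trans (avg_doubling i x)); rewrite exprS EFinM -muleA.
  by apply: lee_wpmul2l => //; rewrite lee_fin ltW.
apply: runmax_le => i ik; apply: (le_trans (h i)); apply: lee_wpmul2r; first exact: nnm_ge0.
by rewrite lee_fin ler_weXn2l.
Qed.

Let b_fin k : b k < +oo.
Proof.
have [c c0 cE] := ltey_EFin (nnm_ge0 x0 (navg 0)) (avg_fin 0 x0).
pose c' := (D ^+ k * c)%R.
have c'0 : (0 <= c')%R by rewrite mulr_ge0// exprn_ge0// ltW.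
apply: (@le_lt_trans _ _ (\int[mu]_x ((c' * c' `^ eps)%:E * ind x))).
  apply: nnm_le_int => //; first by apply: nnmMl => //; rewrite lee_fin mulr_ge0// powR_ge0.
  move=> x _; rewrite muleC /ind indicE.
  have [/set_mem xQ|] := boolP (x \in Q); last by rewrite mule0 mule0.
  rewrite !mule1 EFinM -poweR_EFin.
  have Xc : X k x <= c'%:E.
    by apply: (le_trans (X_le k x)); rewrite (wavg_fiber _ _ _ xQ) cE.
  apply: lee_pmul; rewrite ?poweR_ge0// ?(nnm_ge0 _ (nX k))//.
  by apply: le_poweR2r => //; [have /andP[/ltW]:= eps01|exact: nnm_ge0].
have cc0 : 0 <= (c' * c' `^ eps)%:E :> \bar R by rewrite lee_fin mulr_ge0// powR_ge0.
rewrite nnm_intZ//.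
have -> : \int[mu]_x ind x = \int[mu]_(x in Q) (one x)%:E.
  by rewrite [RHS]nnm_int_indic//; apply: eq_integral => x _; rewrite mul1e.
have /andP[m0 moo] := fone 0 x0; have [m _ mE] := ltey_EFin (ltW m0) moo.
by rewrite mE -EFinM ltry.
Qed.

(** [reverse_holder_step] for [X k] and the average of level [k+1], integrated. The terms telescope
    because [X k^eps] is constant on cells of level [k], so its integrals against the averages of
    levels [k] and [k+1] agree. *)
Let a_step k : a k <= a 0 + (D * eps)%:E * b k.
Proof.
have /andP[e0 e1] := eps01.
have De0 : (0 <= D * eps)%R by rewrite mulr_ge0// ltW.
elim: k => [|k IH].
  by rewrite leeDl// mule_ge0 ?lee_fin//; exact: nnm_int_ge0.
have key : a k.+1 + (D * eps)%:E * b k <= a k + (D * eps)%:E * b k.+1.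
  have -> : a k = \int[mu]_x (ind x * X k x `^ eps * avg k.+1 x).
    by rewrite /a !tower.
  rewrite /a /b -!nnm_intZ// -!nnm_intD//; try exact: nnmMl.
  apply: nnm_le_int => //; try by apply: nnmD => //; exact: nnmMl.
  move=> x _.
  have [p p0 pE] := ltey_EFin (nnm_ge0 x (nX k)) (X_fin k x).
  have [q q0 qE] := ltey_EFin (nnm_ge0 x (navg k.+1)) (avg_fin k.+1 x).
  have qDp : (q <= D * p)%R.
    rewrite -lee_fin EFinM -pE -qE; apply: (le_trans (avg_doubling k x)).
    by apply: lee_wpmul2l; [rewrite lee_fin ltW|exact: le_runmax].
  have XE : X k.+1 x = (Num.max p q)%:E by rewrite /= pE qE EFin_max.
  rewrite XE pE qE /ind !poweR_EFin -!EFinM -!EFinD lee_fin.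
  have := reverse_holder_step eps01 p0 q0 (ltW D0) qDp.
  rewrite indicE; case: (x \in Q); rewrite ?mul1r ?mul0r ?mulr0 ?addr0//.
  by rewrite (mulrC _ q) (mulrC _ q).
apply: (@lee_addl_cancel _ _ _ ((D * eps)%:E * b k)).
- by rewrite mule_ge0 ?lee_fin//; exact: nnm_int_ge0.
- by have [r r0 ->] := ltey_EFin (nnm_int_ge0 mu setT (nb k) : 0 <= b k) (b_fin k); rewrite -EFinM ltry.
by apply: (le_trans key); rewrite [leRHS]addeAC; exact: leeD2r.
Qed.

Let b_le k : b k <= C%:E * a k.
Proof.
rewrite /a /b -nnm_intZ ?lee_fin ?(ltW C0)//.
apply: nnm_le_int => //; first by apply: nnmMl => //; rewrite lee_fin ltW.
move=> x _; rewrite (muleCA C%:E) -muleA.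
apply: lee_wpmul2l; first exact: nnm_ge0.
rewrite muleC; apply: lee_wpmul2l; first exact: poweR_ge0.
by apply: runmax_le => i ik; exact: avgA1.
Qed.

(** The A_1 bound [b_le] turns the previous estimate into [a k <= a 0 + D eps C a k]; half of the
    finite number [a k] is absorbed, uniformly in [k]. *)
Let a_le k : a k <= 2%:E * a 0.
Proof.
apply: le_half_absorb; first exact: nnm_int_ge0.
  apply: le_lt_trans (b_fin k); apply: nnm_le_int => // x _; rewrite -muleA.
  apply: lee_wpmul2l; first exact: nnm_ge0.
  by rewrite muleC; apply: lee_wpmul2r; [exact: poweR_ge0|exact: le_runmax].
apply: (le_trans (a_step k)); rewrite addeC; apply: leeD2r.
have De0 : (0 <= D * eps)%R by rewrite mulr_ge0// ltW//; have /andP[] := eps01.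
apply: (le_trans (lee_wpmul2l (De0 : 0 <= (D * eps)%:E) (b_le k))).
rewrite muleA -EFinM; apply: lee_wpmul2r; first exact: nnm_int_ge0.
by rewrite lee_fin le_eqVlt; apply/orP; left; apply/eqP; rewrite /eps; field;
  rewrite !gt_eqF.
Qed.

Lemma reverse_holder : \int[mu]_(x in Q) (u x `^ (1 + eps))%:E <=
  2%:E * ((\int[mu]_(x in Q) (one x)%:E) * avg 0 x0 `^ (1 + eps)).
Proof.
have /andP[e0 e1] := eps01.
have -> : (\int[mu]_(x in Q) (one x)%:E) * avg 0 x0 `^ (1 + eps) = a 0.
  rewrite muleC -nnm_intZ ?poweR_ge0// nnm_int_indic//; apply: eq_integral => x _.
  rewrite mule1 /= /ind indicE muleC -muleA.
  have [/set_mem xQ|] := boolP (x \in Q); last by rewrite !mul0e.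
  by rewrite (wavg_fiber _ _ _ xQ) poweRD_gt0// poweRe1 ?nnm_ge0// (muleC (avg 0 x0)).
(* [X k^eps u] increases with [k], and by the density hypothesis its supremum is at least
   [u^(1+eps)] almost everywhere on [Q]. *)
pose F k x := ind x * X k x `^ eps * U x.
have nF k : nnm (F k) by apply: nnmM => //; apply: nnmM => //; exact: nnm_pow.
have mF x : {homo F ^~ x : n m / (n <= m)%N >-> n <= m}.
  move=> n m nm; apply: lee_wpmul2r; first exact: (nnm_ge0 x nU).
  apply: lee_wpmul2l; first exact: nnm_ge0.
  apply: le_poweR2r; [exact: ltW|exact: nnm_ge0|].
  by apply: runmax_le => i ik; apply: le_runmax; exact: leq_trans nm.
apply: (@le_trans _ _ (\int[mu]_x ereal_sup (range (F ^~ x)))); last first.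
  rewrite nnm_int_sup//; apply: ge_ereal_sup => _ [k _ <-].
  by rewrite /F -(tower (leqnn k)); exact: a_le.
rewrite nnm_int_indic//; apply: nnm_le_ae_int => //.
- by apply: nnmM => //; apply: positive_weight_nnm; exact: positive_weight_pow.
- exact: nnm_sup.
apply: filterS density => x Hx _; rewrite -/(ind x).
have u0 : (0 < u x)%R by exact: weight_gt0.
have -> : (u x `^ (1 + eps))%:E = U x * U x `^ eps.
  by rewrite -poweR_EFin poweRD_gt0// poweRe1// lee_fin ltW.
apply: (@le_trans _ _ (U x * (ereal_sup (range (X ^~ x))) `^ eps * ind x)).
  apply: lee_wpmul2r; first exact: nnm_ge0.
  apply: lee_wpmul2l; first exact: (nnm_ge0 x nU).
  by apply: le_poweR2r => //; [exact: ltW|exact: (nnm_ge0 x nU)].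
rewrite muleC muleCA.
have [/set_mem xQ|xQ] := boolP (x \in Q); last first.
  rewrite {1}/ind indicE (negbTE xQ) mul0e mule0; apply: le_ereal_sup_tmp.
  by exists (F 0%N x); [exists 0%N|exact: nnm_ge0].
have indx : ind x = 1 by rewrite /ind indicE mem_set.
rewrite indx mul1e -[leRHS](@EFinK_mule _ (u x)^-1%R) ?invr_eq0 ?gt_eqF// invrK.
apply: lee_wpmul2l; first exact: (nnm_ge0 x nU).
apply: poweR_sup_le => // [k|k]; first exact: nnm_ge0.
rewrite -[leLHS](@EFinK_mule _ (u x)) ?gt_eqF//.
apply: lee_wpmul2l; first by rewrite lee_fin invr_ge0 ltW.
apply: le_ereal_sup_tmp; exists (F k x); first by exists k.
by rewrite /F indx mul1e muleC.
Qed.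

End reverse_holder_inequality.

(** * Almost everywhere domination of a weight by its dyadic averages *)

Section dyadic_density.
Context {R : realType} {n : nat}.
Local Notation T := (Rn R n.+1).
Local Notation leb := (@leb R n).
Local Notation Theta := {ffun 'I_n.+1 -> bool}.
Implicit Types (t : Theta) (k : int) (x y : T).
Let one : T -> R := fun=> 1%R.
Hypothesis c_gt0 : (0 < @unit_cube_vol R n)%R.

Lemma int_one (A : set T) : measurable A -> \int[leb]_(x in A) (one x)%:E = leb A.
Proof. by move=> mA; have := integral_cst leb mA 1; rewrite mul1e => <-. Qed.

Lemma measurable_cube (a : 'rV[R]_n.+1) l : measurable (cube a l : set T).
Proof. exact: measurable_box. Qed.

Lemma measurable_cell t k x : measurable (fiber (grid t k) x).
Proof. by apply: measurable_fiber; exact: measurable_grid. Qed.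

Lemma leb_cell_le t k x :
  leb (fiber (grid t k) x) <= (@unit_cube_vol R n * side k ^+ n.+1)%:E.
Proof. by rewrite -(leb_cube (corner t k x)) ?side_gt0//; exact/le_leb_outer/cell_sub_cube. Qed.

Lemma leb_cell_ge t k x :
  (@unit_cube_vol R n * (side k / 2) ^+ n.+1)%:E <= leb (fiber (grid t k) x).
Proof.
rewrite -(leb_cube (corner t k x)) ?divr_gt0 ?side_gt0//.
by apply: le_leb_outer; exact: cube_sub_cell.
Qed.

Lemma fiberwise_finite_one t k : fiberwise_finite leb one (grid t k).
Proof.
move=> x; rewrite int_one; last exact: measurable_cell.
rewrite (le_lt_trans (leb_cell_le t k x)) ?ltry// andbT.
apply: lt_le_trans (leb_cell_ge t k x).
by rewrite lte_fin mulr_gt0// exprn_gt0// divr_gt0 ?side_gt0.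
Qed.

Lemma measurable_saturation (S : countType) (j : T -> S) (A : set T) :
  partition_measurable j -> measurable [set y | exists2 x, A x & j x = j y].
Proof.
move=> mj.
have -> : [set y | exists2 x, A x & j x = j y] = \bigcup_(i in j @` A) [set y | j y = i].
  apply/seteqP; split => [y [x Ax jxy]|y [_ [x Ax <-] /= jyx]].
    by exists (j x) => //; exists x.
  by exists x.
rewrite bigcup_mkcond; apply: countable_bigcupT_measurable => [|i].
  exact: countableP.
by case: ifPn.
Qed.

(** An explicit modulus of continuity for the volume of a box whose sides are all enlarged by
    [e]. *)
Lemma prod_shift_le (I : Type) (r : seq I) (dd : I -> R) (e : R) :
  (forall i, 0 <= dd i)%R -> (0 <= e <= 1)%R ->
  (\prod_(i <- r) (dd i + e) <= \prod_(i <- r) dd i + e * \prod_(i <- r) (dd i + 2))%R.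
Proof.
move=> d0 /andP[e0 e1]; elim: r => [|i r IH]; first by rewrite !big_nil; lra.
rewrite !big_cons.
set P := (\prod_(j <- r) dd j)%R in IH *; set Q := (\prod_(j <- r) (dd j + 2))%R in IH *.
have P0 : (0 <= P)%R by apply: prodr_ge0.
have PQ : (P <= Q)%R by apply: ler_prod => j _; rewrite d0 lerDl ler0n.
have Q0 : (0 <= Q)%R by exact: le_trans PQ.
apply: (@le_trans _ _ ((dd i + e) * (P + e * Q))%R).
  by rewrite ler_wpM2l// addr_ge0.
have h1 : (e * P <= e * Q)%R by rewrite ler_wpM2l.
have h2 : (e * (e * Q) <= e * Q)%R by rewrite ler_piMl// mulr_ge0.
lra.
Qed.

Variables (u : T -> R) (t : Theta) (k0 : int).
Hypothesis pu : positive_weight u.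
Local Notation U := (fun x => (u x)%:E).
Local Notation lev := (fun i : nat => grid t (k0 + i%:Z)).
Local Notation S := (fun x => ereal_sup (range ((runmax leb lev one U) ^~ x))).

Let nU : nnm U. Proof. exact: positive_weight_nnm. Qed.

Let nS : nnm S.
Proof.
by apply: nnm_sup => N; apply: nnm_runmax => // k; exact: measurable_grid.
Qed.

Let avg_le_S i x : wavg leb one (lev i) U x <= S x.
Proof.
apply: le_ereal_sup_tmp; exists (runmax leb lev one U i x); first by exists i.
exact: le_runmax.
Qed.

(** Every cell of a fine level that meets [E] has average at most [p], and the cells meeting [E]
    within the box fill at most a slightly larger box; then the mesh tends to 0. Boxes are the right
    test sets because covers by boxes define the outer measure. *)
Lemma int_box_le (E : set T) (p : R) (a b : 'rV[R]_n.+1) : measurable E -> (0 <= p)%R ->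
  (forall x, E x -> S x <= p%:E) ->
  \int[leb]_(x in E `&` box a b) U x <= (p * box_vol a b)%:E.
Proof.
move=> mE p0 ES.
have [[x0 [Ex0 bx0]]|empt] := pselect (exists x, (E `&` box a b) x); last first.
  rewrite (_ : _ `&` _ = set0) ?integral_set0 ?lee_fin ?mulr_ge0 ?box_vol_ge0//.
  by apply/seteqP; split => // x xE; apply: empt; exists x.
pose dd (i : 'I_n.+1) : R := (Num.max 0 (b ord0 i - a ord0 i))%R.
have ddE i : dd i = (b ord0 i - a ord0 i)%R.
  by rewrite /dd max_r// subr_ge0; have /andP[h1 h2] := bx0 i; exact: le_trans h2.
pose C := (\prod_(i < n.+1) (dd i + 2))%R.
have dd0 i : (0 <= dd i)%R by rewrite /dd le_max lexx.
have C0 : (0 <= C)%R by apply: prodr_ge0 => i _; rewrite addr_ge0.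
have level i : (2 * side (k0 + i%:Z) <= 1 :> R)%R -> \int[leb]_(x in E `&` box a b) U x <=
    (p * (box_vol a b + (2 * side (k0 + i%:Z)) * C))%:E.
  move=> s1; have s0 := @side_gt0 R (k0 + i%:Z).
  set s : R := side (k0 + i%:Z) in s0 s1 *.
  (* The union of the cells that meet the set: over it the integral of [u] equals that of its cell
     averages, each at most [p]. *)
  pose V := [set y : T | exists2 x : T, (E `&` box a b) x & lev i x = lev i y].
  have mV : measurable V by apply: measurable_saturation; exact: measurable_grid.
  apply: (@le_trans _ _ (\int[leb]_(x in V) U x)).
    apply: nnm_subset_int => //; first by apply: measurableI => //; exact: measurable_box.
    by move=> x xE; exists x.
  have -> : \int[leb]_(x in V) U x = \int[leb]_x ((\1_V x)%:E * wavg leb one (lev i) U x * (one x)%:E).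
    rewrite wavg_int//.
    - by rewrite [LHS]nnm_int_indic//; apply: eq_integral => x _; rewrite muleC.
    - exact: measurable_grid.
    - exact: fiberwise_finite_one.
    - exact: positive_weight_nnm (@positive_weight1 _ T R).
    move=> x y xy; rewrite !indicE; have -> // : (x \in V) = (y \in V).
    by apply/idP/idP; rewrite !inE => -[z zE zx]; exists z => //; rewrite zx.
  have nind : nnm (fun x => (\1_V x)%:E : \bar R) by exact: nnm_indic.
  apply: (@le_trans _ _ (\int[leb]_x (p%:E * (\1_V x)%:E))).
    apply: nnm_le_int => //; last first.
    - move=> x _; rewrite mule1 muleC indicE.
      have [/set_mem [y [yE _] yx]|] := boolP (x \in V); last by rewrite !mule0.
      rewrite !mule1 -(wavg_fiber _ _ _ yx); apply: le_trans (ES _ yE); exact: avg_le_S.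
    - by apply: nnmMl.
    apply: nnmM; last by apply: positive_weight_nnm; exact: positive_weight1.
    apply: nnmM => //; apply: wavg_nnm => // [|x]; first exact: measurable_grid.
    exact: (nnm_ge0 x nU).
  rewrite nnm_intZ// EFinM; apply: lee_wpmul2l => //.
  have -> : \int[leb]_x ((\1_V x)%:E : \bar R) = leb V.
    by rewrite integral_indic// setIT.
  apply: (@le_trans _ _ (box_vol (\row_i (a ord0 i - s)) (\row_i (b ord0 i + s)))%:E).
    apply: le_trans (leb_outer_box _ _); apply: le_leb_outer.
    move=> y [x [_ bx] xy] i'; rewrite !mxE.
    have /andP[h1 h2] := bx i'.
    have /cellP/(_ i')/andP[h3 h4] : fiber (lev i) y x by exact: xy.
    have /cellP/(_ i')/andP[h5 h6] : fiber (lev i) y y by [].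
    rewrite -/s in h4 h6; rewrite /coord in h3 h4 h5 h6.
    by apply/andP; split; lra.
  rewrite lee_fin.
  have -> : box_vol (\row_i0 (a ord0 i0 - s)%R) (\row_i0 (b ord0 i0 + s)%R) =
      (\prod_(i < n.+1) (dd i + 2 * s))%R.
    apply: eq_bigr => j _; rewrite !mxE max_r ?ddE; first by ring.
    by have := dd0 j; rewrite ddE; lra.
  by apply: prod_shift_le => //; rewrite mulr_ge0 ?(ltW s0).
apply/lee_addgt0Pr => e e0.
pose K := (p * C * 2 + 1)%R.
have K0 : (0 < K)%R by rewrite ltr_wpDl// !mulr_ge0.
(* The bound [1/2] puts twice the side below 1, as [level] requires, and [e / K] makes the error
   [2 p C] times the side at most [e]. *)
pose e' : R := (Num.min 2^-1 (e / K))%R.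
have e'0 : (0 < e')%R by rewrite lt_min invr_gt0 ltr0n/= divr_gt0.
have [i iP] : exists i : nat, (side (k0 + i%:Z) <= e' :> R)%R.
  have s0 := @side_gt0 R k0.
  exists (Num.trunc (side k0 / e')).+1.
  rewrite /side opprD exprzDr ?unitfE// -/(side k0) -[(2 ^ (- _))%R]invr_expz.
  rewrite ler_pdivrMr ?exprz_gt0// -ler_pdivrMl// mulrC.
  apply: (@le_trans _ _ ((Num.trunc (side k0 / e')).+1)%:R).
    by rewrite ltW// truncnS_gt.
  by rewrite -exprnP -natrX ler_nat; apply: ltnW; exact: ltn_expl.
have i1 : (2 * side (k0 + i%:Z) <= 1 :> R)%R.
  have : (side (k0 + i%:Z) <= 2^-1 :> R)%R by apply: (le_trans iP); rewrite ge_min lexx.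
  lra.
apply: (le_trans (level i i1)); rewrite -EFinD lee_fin mulrDr lerD2l.
have iK : (side (k0 + i%:Z) <= e / K)%R by apply: (le_trans iP); rewrite ge_min lexx orbT.
have := @side_gt0 R (k0 + i%:Z); move: iK; rewrite ler_pdivlMr// /K => iK sg.
have : (0 <= p * C)%R by rewrite mulr_ge0.
lra.
Qed.

(** A cover of [E] by boxes of total volume close to [leb E], with [int_box_le] on each, gives
    [int_E u <= p leb E], against [q leb E <= int_E u]. *)
Lemma density_null (E : set T) (p q : R) : measurable E -> (0 <= p < q)%R ->
  leb E < +oo -> (forall x, E x -> S x <= p%:E) -> (forall x, E x -> (q <= u x)%R) ->
  leb E = 0.
Proof.
move=> mE /andP[p0 pq] Eoo ES Eu.
have q0 : (0 < q)%R by exact: le_lt_trans pq.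
have [m m0 mE'] := ltey_EFin (measure_ge0 leb E) Eoo.
have h1 : q%:E * leb E <= \int[leb]_(x in E) U x.
  rewrite -(integral_cst leb mE); apply: nnm_le_int => //; first by apply: nnm_cst; rewrite lee_fin ltW.
suff h2 : \int[leb]_(x in E) U x <= p%:E * leb E.
  have := le_trans h1 h2; rewrite mE' -!EFinM lee_fin => H.
  congr EFin; apply/eqP; rewrite eq_le m0 andbT.
  rewrite -(pmulr_rle0 _ (_ : 0 < q - p)%R) ?subr_gt0//; lra.
rewrite mE' -EFinM; apply/lee_addgt0Pr => e e0.
pose e' := (e / (p + 1))%R.
have p10 : (0 < p + 1)%R by lra.
have e'0 : (0 < e')%R by rewrite divr_gt0.
have lfin : leb E \is a fin_num by rewrite mE'.
have [_ [B BE <-] Blt] := lb_ereal_inf_adherent e'0 (lfin : @leb_outer R n.+1 E \is a fin_num).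
have {}Blt : \sum_(k <oo) (box_vol (B k).1 (B k).2)%:E <= (m + e')%:E.
  by apply/ltW; apply: (lt_le_trans Blt); rewrite EFinD leeD2r// -mE'.
pose G j x := ((\1_(E `&` box (B j).1 (B j).2) x)%:E * U x).
have mEB j : measurable (E `&` box (B j).1 (B j).2) by apply: measurableI => //; exact: measurable_box.
have nG j : nnm (G j) by apply: nnmM => //; exact: nnm_indic.
apply: (@le_trans _ _ (\int[leb]_x \sum_(j <oo) G j x)).
  rewrite nnm_int_indic//; apply: nnm_le_int => //.
  - by apply: nnmM => //; exact: nnm_indic.
  - exact: nnm_series.
  move=> x _; have s0 : 0 <= \sum_(j <oo) G j x by apply: nneseries_ge0 => j _ _; exact: nnm_ge0.
  rewrite indicE; have [/set_mem Ex|] := boolP (x \in E); last by rewrite mule0.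
  have [j _ Bj] := BE x Ex.
  apply: (@le_trans _ _ (G j x)).
    by rewrite /G indicE mem_set// mul1e mule1.
  have := @nneseries_lim_ge R (G ^~ x) xpredT 0 j.+1 (fun i _ _ => nnm_ge0 x (nG i)).
  apply: le_trans; rewrite big_mkord (bigD1 ord_max)//= leeDl// sume_ge0// => i _.
  exact: nnm_ge0.
rewrite nnm_int_series//.
apply: (@le_trans _ _ (\sum_(j <oo) (p%:E * (box_vol (B j).1 (B j).2)%:E))).
  apply: lee_nneseries => [j _ _|j _]; first exact: nnm_int_ge0.
  have -> : \int[leb]_x G j x = \int[leb]_(x in E `&` box (B j).1 (B j).2) U x.
    by rewrite [RHS]nnm_int_indic//; apply: eq_integral => x _; rewrite muleC.
  by rewrite -EFinM; exact: int_box_le.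
rewrite nneseriesZl; last by move=> *; rewrite lee_fin box_vol_ge0.
apply: (le_trans (lee_wpmul2l (p0 : 0 <= p%:E) Blt)).
rewrite -EFinM -EFinD lee_fin mulrDr lerD2l /e'.
by rewrite mulrCA ler_piMr ?(ltW e0)// ler_pdivrMr// mul1r lerDl.
Qed.

(** At a point of failure there are rationals [p < q] with [S x <= p] and [q <= u x]. Together with
    the cell of level [k0], which has finite measure, they index countably many sets, null by
    [density_null]. *)
Lemma density_grid : {ae leb, forall x, (u x)%:E <= S x}.
Proof.
pose E (z : rat * rat * {ffun 'I_n.+1 -> int}) : set T :=
  [set x : T | [/\ grid t k0 x = z.2, S x <= (ratr z.1.1 : R)%:E & ((ratr z.1.2 : R) <= u x)%R]]
  `&` [set x : T | ((0 : R) <= (ratr z.1.1 : R) < (ratr z.1.2 : R))%R].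
have mE z : measurable (E z).
  have [zz|zz] := pselect ((0 : R) <= (ratr z.1.1 : R) < (ratr z.1.2 : R))%R; last first.
    rewrite (_ : E z = set0)//; apply/seteqP; split => // x [_ /=].
    by move=> H; exact: zz.
  have -> : E z = [set x | grid t k0 x = z.2] `&` ([set: T] `&` [set x | S x <= (ratr z.1.1)%:E])
      `&` ([set: T] `&` [set x | (ratr z.1.2)%:E <= (u x)%:E]).
    apply/seteqP; split => x /=.
      by move=> [[h0 h1 h2] _]; split; [split|]; rewrite ?lee_fin.
    by move=> [[h0 [_ h1]] [_ h2]]; split => //; split => //; rewrite -lee_fin.
  apply: measurableI; first apply: measurableI; first exact: measurable_grid.
    exact: (emeasurable_fun_infty_c measurableT (nnm_measurable nS)).
  exact: (emeasurable_fun_c_infty measurableT (nnm_measurable nU)).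
have E0 z : leb (E z) = 0.
  have [[x0 Ex0]|empt] := pselect (exists x, E z x); last first.
    by rewrite (_ : E z = set0) ?measure0//; apply/seteqP; split => // x xE; apply: empt; exists x.
  have [[gx0 _ _] zz] := Ex0.
  apply: (density_null (mE z) zz).
  - apply: (@le_lt_trans _ _ (leb (fiber (grid t k0) x0))).
      by apply: le_leb_outer => x [[gx _ _] _]; rewrite /fiber /= gx gx0.
    by apply: (le_lt_trans (leb_cell_le _ _ _)); rewrite ltry.
  - by move=> x [[_ h _] _].
  - by move=> x [[_ _ h] _].
pose F j : set T := if unpickle j is Some z then E z else set0.
have : leb.-negligible (\bigcup_j F j).
  apply: negligible_bigcup => j; rewrite /F.
  case: unpickle => [z|]; last exact: negligible_set0.
  by apply/negligibleP; [exact: mE|exact: E0].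
apply: negligibleS => x /= /negP; rewrite -ltNge => xS.
have Sfin : S x < +oo by apply: (lt_trans xS); rewrite ltry.
have [s s0 sE] := ltey_EFin (nnm_ge0 x nS) Sfin.
move: xS; rewrite sE lte_fin => xS.
have [p /[!in_itv]/= /andP[p1 p2]] := rat_in_itvoo xS.
have [q /[!in_itv]/= /andP[q1 q2]] := rat_in_itvoo p2.
exists (pickle (p, q, grid t k0 x)); first exact: I.
rewrite /F pickleK; split.
  by split; [reflexivity|rewrite sE lee_fin; exact: ltW|exact: ltW].
by apply/andP; split; [exact: le_trans s0 (ltW p1)|exact: q1].
Qed.

End dyadic_density.

(** * Weight classes *)

Section weights_on_cubes.
Context {R : realType} {n : nat}.
Local Notation T := (Rn R n.+1).
Local Notation leb := (@leb R n).
Local Notation Theta := {ffun 'I_n.+1 -> bool}.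
Local Notation c := (@unit_cube_vol R n).
Implicit Types (t : Theta) (k : int) (x y : T) (a : 'rV[R]_n.+1) (l p q : R) (u v w : T -> R).
Local Notation one := (fun=> 1%R : R).
Hypothesis c_gt0 : (0 < c)%R.

Definition vol l : R := (c * l ^+ n.+1)%R.

Lemma vol_gt0 l : (0 < l)%R -> (0 < vol l)%R.
Proof. by move=> l0; rewrite mulr_gt0// exprn_gt0. Qed.

Lemma vol_scale (r l : R) : vol (r * l) = (r ^+ n.+1 * vol l)%R.
Proof. by rewrite /vol exprMn mulrCA. Qed.

Lemma le_vol l l' : (0 <= l)%R -> (l <= l')%R -> (vol l <= vol l')%R.
Proof.
move=> l0 ll'; rewrite ler_pM2l//; apply: lerXn2r => //; rewrite nnegrE//.
exact: le_trans ll'.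
Qed.

Lemma leb_cubeE a l : (0 < l)%R -> leb (cube a l) = (vol l)%:E.
Proof. exact: leb_cube. Qed.

(* The weight conditions below bound averages through this predicate, which avoids
   division in the extended reals. *)
Definition avgle a l w (A : R) : Prop :=
  \int[leb]_(x in (cube a l : set T)) (w x)%:E <= (A * vol l)%:E.

Definition ApR p w : Prop := positive_weight w /\ exists2 K : R, (0 < K)%R &
  forall a l, (0 < l)%R -> exists A B : R, [/\ (0 < A)%R, (0 < B)%R,
    avgle a l w A, avgle a l (fun x => w x `^ (- (p - 1)^-1))%R B &
    (A * B `^ (p - 1) <= K)%R].

Definition A1R K u : Prop := [/\ positive_weight u, (0 < K)%R &
  forall a l, (0 < l)%R -> exists A : R, [/\ (0 < A)%R, avgle a l u A &
    {ae leb, forall x, cube a l x -> (A <= K * u x)%R}]].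

Lemma int_weight_gt0 w (A : set T) : positive_weight w -> measurable A ->
  0 < leb A -> 0 < \int[leb]_(x in A) (w x)%:E.
Proof.
move=> pw mA A0; have nw := positive_weight_nnm pw.
rewrite lt_neqAle eq_sym nnm_int_ge0// andbT; apply/eqP => w0.
have := nnm_int_eq0_ae mA nw w0.
move=> [N [mN N0 NA]]; suff : leb A <= 0 by rewrite leNgt A0.
rewrite -N0; apply: le_measure; rewrite ?inE// => x Ax; apply: NA => /= H.
have := weight_gt0 x pw; by rewrite -lte_fin (H Ax) ltxx.
Qed.

Lemma avgle_gt0 a l w A : (0 < l)%R -> positive_weight w -> avgle a l w A -> (0 < A)%R.
Proof.
move=> l0 pw wA; rewrite -(pmulr_lgt0 _ (vol_gt0 l0)) -lte_fin.
apply: lt_le_trans wA; apply: int_weight_gt0 => //; first exact: measurable_cube.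
by rewrite leb_cubeE// lte_fin vol_gt0.
Qed.

Lemma avgle_holder a l u w (A B r : R) : (0 < l)%R -> positive_weight u ->
  positive_weight w -> (0 < r < 1)%R -> avgle a l u A -> avgle a l w B ->
  avgle a l (fun x => u x `^ r * w x `^ (1 - r))%R (A `^ r * B `^ (1 - r))%R.
Proof.
move=> l0 pu pw r01 uA wB; have V0 := vol_gt0 l0.
have A0 := avgle_gt0 l0 pu uA; have B0 := avgle_gt0 l0 pw wB.
have := holder_le (@measurable_cube R n a l) (positive_weight_nnm pu)
  (positive_weight_nnm pw) r01 (mulr_gt0 A0 V0) (mulr_gt0 B0 V0) uA wB.
rewrite /avgle (powRM r (ltW A0) (ltW V0)) (powRM (1 - r) (ltW B0) (ltW V0)) mulrACA -powRD; last first.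
  by apply/implyP => _; rewrite gt_eqF.
have -> : (r + (1 - r) = 1)%R by ring.
by rewrite (powRr1 (ltW V0)).
Qed.

Lemma avgle_ae a l w (A : R) : (0 < l)%R -> positive_weight w -> (0 <= A)%R ->
  {ae leb, forall x, cube a l x -> (w x <= A)%R} -> avgle a l w A.
Proof.
move=> l0 pw A0 H; rewrite /avgle EFinM -(leb_cubeE a)//.
rewrite -(integral_cst leb (@measurable_cube R n a l)).
apply: nnm_le_ae_int; [exact: measurable_cube|exact: positive_weight_nnm| |].
  by apply: nnm_cst; rewrite lee_fin.
by apply: filterS H => x H /H; rewrite lee_fin.
Qed.

Lemma avgle_le_ae a l w w' (A : R) : positive_weight w -> positive_weight w' ->
  {ae leb, forall x, cube a l x -> (w x <= w' x)%R} -> avgle a l w' A -> avgle a l w A.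
Proof.
move=> pw pw' H; apply: le_trans; apply: nnm_le_ae_int.
- exact: measurable_cube.
- exact: positive_weight_nnm.
- exact: positive_weight_nnm.
- by apply: filterS H => x H /H; rewrite lee_fin.
Qed.

Lemma avgleZ a l w (A r : R) : positive_weight w -> (0 <= r)%R -> avgle a l w A ->
  avgle a l (fun x => r * w x)%R (r * A).
Proof.
move=> pw r0 wA; rewrite /avgle -mulrA EFinM.
under eq_integral do rewrite EFinM.
rewrite nnm_intZ; [|exact: measurable_cube|by rewrite lee_fin|exact: positive_weight_nnm].
by apply: lee_wpmul2l; rewrite ?lee_fin.
Qed.

Lemma avgle1 a l : (0 < l)%R -> avgle a l one 1.
Proof. by move=> l0; rewrite /avgle int_one ?mul1r ?leb_cubeE//; exact: measurable_cube. Qed.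

Lemma avgle_pow a l w (A r : R) : (0 < l)%R -> positive_weight w ->
  (0 < r < 1)%R -> avgle a l w A -> avgle a l (fun x => w x `^ r)%R (A `^ r).
Proof.
move=> l0 pw r01 wA.
have := avgle_holder l0 pw (@positive_weight1 _ T R) r01 wA (avgle1 a l0).
by rewrite powR1 mulr1 /avgle; under eq_integral do rewrite mulr1.
Qed.

Lemma cell_int_le w t k x (A : R) : positive_weight w ->
  avgle (corner t k x) (side k) w A ->
  \int[leb]_(y in fiber (grid t k) x) (w y)%:E <= (A * vol (side k))%:E.
Proof.
move=> pw; apply: le_trans; apply: nnm_subset_int.
- exact: measurable_cell.
- exact: measurable_cube.
- exact: positive_weight_nnm.
- exact: cell_sub_cube.
Qed.

Lemma cell_volE t k x : exists2 m : R, leb (fiber (grid t k) x) = m%:E &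
  [/\ (0 < m)%R, (m <= vol (side k))%R & (vol (side k) <= 2 ^+ n.+1 * m)%R].
Proof.
have := leb_cell_ge t k x; have := leb_cell_le t k x.
have : 0 <= leb (fiber (grid t k) x) by [].
case: (leb _) => [m| |]//; rewrite !lee_fin => m0 m1 m2.
exists m => //; have s0 := @side_gt0 R k; split => //.
  by apply: lt_le_trans m2; apply: vol_gt0; exact: divr_gt0.
apply: (@le_trans _ _ (2 ^+ n.+1 * vol (side k / 2))%R).
  by rewrite -vol_scale mulrC divfK.
by rewrite ler_pM2l ?exprn_gt0.
Qed.

Lemma fiberwise_finite_avgle w t k : positive_weight w ->
  (forall a l, (0 < l)%R -> exists A : R, avgle a l w A) ->
  fiberwise_finite leb w (grid t k).
Proof.
move=> pw H x; apply/andP; split.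
  apply: int_weight_gt0 => //; first exact: measurable_cell.
  by have [m -> [m0 _ _]] := cell_volE t k x; rewrite lte_fin.
have [A wA] := H (corner t k x) (side k) (side_gt0 k).
by apply: (le_lt_trans (cell_int_le pw wA)); rewrite ltry.
Qed.

Definition M t (f : T -> \bar R) : T -> \bar R := dmax leb (grid t) one f.

Lemma muckenhoupt p w : (1 < p)%R -> ApR p w -> exists2 B : R, (0 < B)%R &
  forall t f, nnm f -> \int[leb]_x (M t f x `^ p * (w x)%:E) <=
              B%:E * \int[leb]_x (f x `^ p * (w x)%:E).
Proof.
move=> p1 [pw [K K0 Kw]]; have p0 : (0 < p)%R by lra.
have p10 : (0 < p - 1)%R by lra.
have psig := positive_weight_pow (- (p - 1)^-1)%R pw.
suff /choice[B BP] : forall t, exists B : R, (0 < B)%R /\ forall f, nnm f ->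
    \int[leb]_x (M t f x `^ p * (w x)%:E) <= B%:E * \int[leb]_x (f x `^ p * (w x)%:E).
  exists (1 + \sum_t B t)%R.
    by rewrite ltr_pwDl// sumr_ge0// => t _; have [/ltW] := BP t.
  move=> t f nf; have [B0 Bf] := BP t; apply: (le_trans (Bf f nf)).
  apply: lee_wpmul2r.
    apply: nnm_int_ge0; apply: nnmM; first exact: nnm_pow.
    exact: positive_weight_nnm.
  rewrite lee_fin (bigD1 t)//= addrCA lerDl addr_ge0// sumr_ge0// => t' _.
  by have [/ltW] := BP t'.
(* The weights are averaged over the cube around a cell, whose volume is at most [2^(n+1)] times
   that of the cell; the A_p bound scales with the power [p] of the volume. *)
move=> t; pose K' := ((2 ^+ n.+1) `^ p * K)%R.
have d0 : (0 < 2 ^+ n.+1 :> R)%R by exact: exprn_gt0.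
have K'0 : (0 < K')%R by rewrite mulr_gt0// powR_gt0.
have [B B0 BP] : exists2 B : R, (0 < B)%R & forall f, nnm f ->
    \int[leb]_x (dmax leb (grid t) one f x `^ p * (w x)%:E) <=
    B%:E * \int[leb]_x (f x `^ p * (w x)%:E).
  apply: (@muckenhoupt_dyadic _ _ _ _ leb (grid t) _ _ _ p K' w) => //.
  - by move=> k; exact: measurable_grid.
  - by move=> k x y; exact: grid_nested.
  - by move=> k; exact: fiberwise_finite_one.
  - move=> k; apply: fiberwise_finite_avgle => // a l l0.
    by have [A [B [_ _ wA _ _]]] := Kw a l l0; exists A.
  - move=> k; apply: fiberwise_finite_avgle => // a l l0.
    by have [A [B [_ _ _ wB _]]] := Kw a l l0; exists B.
  move=> k x; have [A [B [A0 B0 wA wB AB]]] := Kw (corner t k x) (side k) (side_gt0 k).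
  rewrite int_one; last exact: measurable_cell.
  have [m -> [m0 m1 m2]] := cell_volE t k x.
  have nsig := positive_weight_nnm psig.
  have v0 := vol_gt0 (@side_gt0 R k).
  apply: (@le_trans _ _ ((A * vol (side k))%:E * (B * vol (side k))%:E `^ (p - 1))).
    apply: lee_pmul; [|exact: poweR_ge0|exact: cell_int_le|].
      by apply: nnm_int_ge0; exact: positive_weight_nnm.
    apply: le_poweR2r; [exact: ltW| |exact: cell_int_le].
    exact: nnm_int_ge0.
  rewrite !poweR_EFin -!EFinM lee_fin (powRM _ (ltW B0) (ltW v0)) mulrACA.
  rewrite (mulr_powRB1 (ltW v0) p0).
  apply: (@le_trans _ _ (K * ((2 ^+ n.+1) `^ p * m `^ p))%R); last by rewrite /K' mulrA (mulrC K).
  apply: ler_pM => //; rewrite ?mulr_ge0 ?powR_ge0 ?(ltW A0)//.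
  rewrite -(powRM _ (ltW d0) (ltW m0)).
  by apply: (ge0_ler_powR (ltW p0)); rewrite ?nnegrE; [exact: ltW|apply: mulr_ge0; exact: ltW|].
by exists B.
Qed.

(* [L] allows for several exponents at once: the weak-type estimate needs one on
   either side of 2, for the same majorant [H]. *)
Lemma rubio_de_francia_cubes (L : R * (T -> R) -> Prop) (B : R) : (0 < B)%R ->
  (forall s om, L (s, om) -> [/\ (1 < s)%R, positive_weight om &
     forall t f, nnm f -> \int[leb]_x (M t f x `^ s * (om x)%:E) <=
                   B%:E * \int[leb]_x (f x `^ s * (om x)%:E)]) ->
  exists2 K : R, (0 < K)%R & forall h, nnm h -> exists H : T -> \bar R,
    [/\ nnm H, forall x, h x <= H x,
        forall a l x, (0 < l)%R -> cube a l x ->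
          \int[leb]_(y in (cube a l : set T)) H y <= K%:E * H x * (vol l)%:E &
        forall s om, L (s, om) -> \int[leb]_x (H x `^ s * (om x)%:E) <=
                        2%:E * \int[leb]_x (h x `^ s * (om x)%:E)].
Proof.
move=> B0 LP.
have nM t f : nnm f -> nnm (M t f).
  move=> nf; apply: nnm_dmax nf; first by move=> k; exact: measurable_grid.
  exact: positive_weight1.
have leM t (f g : T -> \bar R) : nnm f -> nnm g -> (forall x, f x <= g x) ->
    forall x, M t f x <= M t g x.
  move=> nf ng fg x; apply: dmax_le => k; apply: le_trans (wavg_le_dmax _ _ _ _ k x).
  apply: lee_wpmul2l.
    by rewrite inve_ge0; apply: nnm_int_ge0; exact: positive_weight_nnm (@positive_weight1 _ T R).
  by apply: nnm_le_int => //; exact: measurable_cell.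
have Msup t (F : nat -> T -> \bar R) x z : (forall n, nnm (F n)) ->
    (forall x, {homo F ^~ x : n m / (n <= m)%N >-> n <= m}) ->
    (forall n, M t (F n) x <= z) -> M t (fun x => ereal_sup (range (F ^~ x))) x <= z.
  move=> nF hF Fz; apply: dmax_sup => //; first by move=> k; exact: measurable_grid.
  by move=> k; exact: fiberwise_finite_one.
have [e e0 eP] := rubio_de_francia nM leM Msup B0 LP.
(* A cube of side [l] lies in a cell of side at most [6 l] of one of the grids, and there
   [e M H <= H] bounds the average. *)
exists (e^-1 * 6 ^+ n.+1)%R; first by rewrite mulr_gt0 ?invr_gt0// exprn_gt0.
move=> h nh; have [H [nH hH MH HL]] := eP h nh; exists H; split => //.
move=> a l x l0 xQ; have [t [k [kl Qcell]]] := cube_in_cell a l0.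
have [m mE [m0 m1 m2]] := cell_volE t k x.
have Hx0 := nnm_ge0 x nH.
apply: (@le_trans _ _ (\int[leb]_(y in fiber (grid t k) x) H y)).
  apply: nnm_subset_int => //; [exact: measurable_cube|exact: measurable_cell|].
  exact: Qcell.
have avgH : wavg leb one (grid t k) H x <= (e^-1)%:E * H x.
  apply: (le_trans (wavg_le_dmax leb (grid t) one H k x)).
  rewrite -[leLHS](@EFinK_mule _ e) ?gt_eqF//.
  by apply: lee_wpmul2l; [rewrite lee_fin invr_ge0 ltW|exact: (MH t x)].
rewrite -(@wavg_mul _ _ _ _ leb one (grid t k) H x (@fiberwise_finite_one R n c_gt0 t k)) int_one; last exact: measurable_cell.
rewrite mE; apply: (@le_trans _ _ ((e^-1)%:E * H x * (vol (6 * l))%:E)).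
  apply: lee_pmul => //; last by rewrite lee_fin (le_trans m1)// le_vol// ltW// side_gt0.
  - by apply: nnm_ge0; apply: wavg_nnm => //; [exact: measurable_grid|move=> y; exact: nnm_ge0].
  - by rewrite lee_fin ltW.
rewrite vol_scale (EFinM (6 ^+ n.+1) (vol l)) (EFinM e^-1 (6 ^+ n.+1)) muleA.
by rewrite (muleAC (e^-1)%:E).
Qed.

End weights_on_cubes.

Section weight_classes.
Context {R : realType} {n : nat}.
Local Notation T := (Rn R n.+1).
Local Notation leb := (@leb R n).
Local Notation Theta := {ffun 'I_n.+1 -> bool}.
Local Notation c := (@unit_cube_vol R n).
Implicit Types (t : Theta) (k : int) (x y : T) (a : 'rV[R]_n.+1) (l p q : R) (u v w : T -> R).
Local Notation one := (fun=> 1%R : R).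
Hypothesis c_gt0 : (0 < c)%R.

(** A_1 and the reverse Hölder inequality of exponent [1 + e], sharing on each cube a number [A]
    that equals the average of [u] up to a constant factor. *)
Definition RHA1 (e K : R) u : Prop := [/\ positive_weight u, (0 < K)%R &
  forall a l, (0 < l)%R -> exists A : R, [/\ (0 < A)%R, avgle a l u A,
    {ae leb, forall x, cube a l x -> (A <= K * u x)%R} &
    avgle a l (fun x => u x `^ (1 + e))%R (K * A `^ (1 + e))]].

(** This says that [v^e] is an A_2 weight. A_2 is convenient because its condition is symmetric in
    [v] and [v^-1], and products stay in the class at the price of a smaller [e]. *)
Definition balanced (e : R) v : Prop := [/\ positive_weight v, (0 < e)%R &
  exists2 K : R, (0 < K)%R & forall a l, (0 < l)%R -> exists A B : R,
    [/\ (0 < A)%R, (0 < B)%R, avgle a l (fun x => v x `^ e)%R A,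
        avgle a l (fun x => v x `^ (- e))%R B & (A * B <= K)%R]].

Lemma eq_avgle a l w w' A : w =1 w' -> avgle a l w A -> avgle a l w' A.
Proof. by move=> /funext ->. Qed.

Lemma A1R_ApR2 K u : A1R K u -> ApR 2 u.
Proof.
move=> [pu K0 H]; split => //; exists K => // a l l0.
have [A [A0 uA Au]] := H a l l0; exists A, (K / A)%R.
have u0 x : (0 < u x)%R by exact: weight_gt0.
split=> //; first exact: divr_gt0.
  apply: avgle_ae => //; [exact: positive_weight_pow|by rewrite ltW// divr_gt0|].
  apply: filterS Au => x Au xQ; rewrite (_ : - (2 - 1)^-1 = -1)%R; last first.
    by rewrite (_ : 2 - 1 = 1)%R ?invr1//; ring.
  by rewrite powR_inv1 ?(ltW (u0 x))// ler_pdivlMr// mulrC ler_pdivrMr// Au.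
rewrite (_ : 2 - 1 = 1)%R; last by ring.
by rewrite powRr1 ?(ltW (divr_gt0 K0 A0))// mulrCA divff ?mulr1// gt_eqF.
Qed.

Lemma ApR_mono p q w : (1 < p)%R -> (p < q)%R -> ApR p w -> ApR q w.
Proof.
move=> p1 pq [pw [K K0 H]]; split => //; exists K => // a l l0.
have [A [B [A0 B0 wA wB AB]]] := H a l l0.
have p10 : (0 < p - 1)%R by lra. have q10 : (0 < q - 1)%R by lra.
pose r := ((p - 1) / (q - 1))%R.
have r01 : (0 < r < 1)%R by rewrite divr_gt0//= ltr_pdivrMr//; lra.
exists A, (B `^ r)%R; split => //; first exact: powR_gt0.
  have := avgle_pow c_gt0 l0 (positive_weight_pow _ pw) r01 wB.
  apply: eq_avgle => x; rewrite -powRrM; congr (_ `^ _)%R.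
  by rewrite /r; field; rewrite !gt_eqF.
rewrite -powRrM (_ : r * (q - 1) = p - 1)%R//.
by rewrite /r divfK// gt_eqF.
Qed.

Lemma ApR_dual p w : (1 < p)%R -> ApR p w ->
  ApR (p / (p - 1)) (fun x => w x `^ (- (p - 1)^-1))%R.
Proof.
move=> p1 [pw [K K0 H]]; have p10 : (0 < p - 1)%R by lra.
split; first exact: positive_weight_pow.
exists (K `^ (p - 1)^-1)%R; first exact: powR_gt0.
move=> a l l0; have [A [B [A0 B0 wA wB AB]]] := H a l l0.
have pE : (p / (p - 1) - 1 = (p - 1)^-1)%R by field; rewrite gt_eqF.
exists B, A; split => //.
  apply: eq_avgle wA => x; rewrite -powRrM pE invrK mulrNN mulVf ?gt_eqF//.
  by rewrite powRr1// ltW// weight_gt0.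
rewrite pE; have /(ge0_ler_powR (ltW (_ : 0 < (p - 1)^-1)%R)) := AB.
rewrite invr_gt0 => /(_ p10); rewrite !nnegrE ?mulr_ge0 ?powR_ge0 ?(ltW A0) ?(ltW K0)//.
move=> /(_ isT isT); rewrite powRM ?powR_ge0 ?(ltW A0)// -powRrM divff ?gt_eqF//.
by rewrite powRr1 ?(ltW B0)// mulrC.
Qed.

(** The A_1 condition gives [V^-b <= (K / A)^b] on the cube. The dual weight is [V^r] times the
    power [1 - r] of the dual weight of [w], with [r = b / (q + b - 1)], to which Hölder's
    inequality applies; the powers of [A] cancel. *)
Lemma ApR_A1R_mul q b K V w : (1 < q)%R -> (0 < b)%R -> A1R K V -> ApR q w ->
  ApR (q + b) (fun x => w x * V x `^ (- b))%R.
Proof.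
move=> q1 b0 [pV K0 HV] [pw [Kw Kw0 Hw]].
have V0 x : (0 < V x)%R by exact: weight_gt0.
have w0 x : (0 < w x)%R by exact: weight_gt0.
split; first by apply: positive_weightM => //; exact: positive_weight_pow.
exists (K `^ b * Kw)%R; first by rewrite mulr_gt0// powR_gt0.
move=> a l l0; have [A [A0 VA AV]] := HV a l l0.
have [B [C [B0 C0 wB wC BC]]] := Hw a l l0.
have q10 : (0 < q - 1)%R by lra. have qb0 : (0 < q + b - 1)%R by lra.
pose r := (b / (q + b - 1))%R.
have r01 : (0 < r < 1)%R by rewrite divr_gt0//= ltr_pdivrMr//; lra.
have rE : (1 - r = (q - 1) / (q + b - 1))%R by rewrite /r; field; rewrite gt_eqF.
exists ((K / A) `^ b * B)%R, (A `^ r * C `^ (1 - r))%R; split.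
- by rewrite mulr_gt0// powR_gt0// divr_gt0.
- by rewrite mulr_gt0// powR_gt0.
- apply: (@avgle_le_ae _ _ _ _ _ (fun x => (K / A) `^ b * w x)%R); last first.
  + by apply: avgleZ => //; exact: powR_ge0.
  + apply: filterS AV => x AV xQ; rewrite mulrC ler_pM2r//.
    rewrite powRN -powR_inv1 ?powR_ge0// -powRAC (powR_inv1 (ltW (V0 x))).
    apply: (ge0_ler_powR (ltW b0)); rewrite ?nnegrE ?invr_ge0 ?(ltW (V0 x))//.
      by rewrite ltW// divr_gt0.
    by rewrite ler_pdivlMr// mulrC ler_pdivrMr// AV.
  + by apply: positive_weightZ => //; rewrite powR_gt0// divr_gt0.
  + by apply: positive_weightM => //; exact: positive_weight_pow.
- have := avgle_holder c_gt0 l0 pV (positive_weight_pow _ pw) r01 VA wC.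
  apply: eq_avgle => x.
  rewrite (powRM _ (ltW (w0 x)) (powR_ge0 _ _)) -(powRrM (V x)) -(powRrM (w x)) [RHS]mulrC.
  have -> : (- b * - (q + b - 1)^-1 = r)%R by rewrite mulrNN.
  have -> : (- (q - 1)^-1 * (1 - r) = - (q + b - 1)^-1)%R.
    by rewrite rE; field; rewrite !gt_eqF.
  by [].
rewrite powRM ?powR_ge0// -!powRrM rE !divfK ?gt_eqF//.
rewrite mulrACA -powRM ?(ltW A0) ?(ltW (divr_gt0 K0 A0))// divfK ?gt_eqF//.
by rewrite ler_pM2l ?powR_gt0.
Qed.

Lemma balanced_mono e e' v : (0 < e' < e)%R -> balanced e v -> balanced e' v.
Proof.
move=> /andP[e'0 e'e] [pv e0 [K K0 H]]; split => //.
pose r := (e' / e)%R.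
have r01 : (0 < r < 1)%R by rewrite divr_gt0//= ltr_pdivrMr// mul1r.
have rE : (e * r = e')%R by rewrite mulrC divfK// gt_eqF.
exists (K `^ r)%R; first exact: powR_gt0.
move=> a l l0; have [A [B [A0 B0 wA wB AB]]] := H a l l0.
exists (A `^ r)%R, (B `^ r)%R; split; rewrite ?powR_gt0//.
- have := avgle_pow c_gt0 l0 (positive_weight_pow _ pv) r01 wA.
  by apply: eq_avgle => x; rewrite -powRrM rE.
- have := avgle_pow c_gt0 l0 (positive_weight_pow _ pv) r01 wB.
  by apply: eq_avgle => x; rewrite -powRrM mulNr rE.
rewrite -powRM ?(ltW A0) ?(ltW B0)//; have /andP[r0 _] := r01.
by apply: (ge0_ler_powR (ltW r0)); rewrite ?nnegrE ?mulr_ge0 ?(ltW A0) ?(ltW B0) ?(ltW K0).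
Qed.

Lemma balancedV e v : balanced e v -> balanced e (fun x => v x `^ (-1))%R.
Proof.
move=> [pv e0 [K K0 H]]; split; [exact: positive_weight_pow|exact: e0|].
exists K; first exact: K0.
move=> a l l0; have [A [B [A0 B0 wA wB AB]]] := H a l l0.
exists B, A; split; [exact: B0|exact: A0| | |by rewrite mulrC].
- by apply: eq_avgle wB => x; rewrite -powRrM mulN1r.
- by apply: eq_avgle wA => x; rewrite -powRrM mulrNN mul1r.
Qed.

Lemma balanced_one : balanced 1 (one : T -> R).
Proof.
split; [exact: positive_weight1|by []|exists 1%R => // a l l0].
exists 1%R, 1%R; split; rewrite ?mulr1//.
- by apply: eq_avgle (avgle1 a l0) => x; rewrite powR1.
- by apply: eq_avgle (avgle1 a l0) => x; rewrite powR1.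
Qed.

(** After lowering both exponents to a common [d], strictly smaller as [balanced_mono] asks, the
    Cauchy-Schwarz inequality yields the product at exponent [d / 2]. *)
Lemma balancedM e e' v v' : balanced e v -> balanced e' v' ->
  exists e'', balanced e'' (fun x => v x * v' x)%R.
Proof.
move=> bv bv'; have [_ e0 _] := bv; have [_ e'0 _] := bv'.
pose d := (Num.min e e' / 2)%R.
have m0 : (0 < Num.min e e')%R by rewrite lt_min e0.
have d0 : (0 < d)%R by rewrite divr_gt0.
have dm : (d < Num.min e e')%R by rewrite /d ltr_pdivrMr// mulr_natr mulr2n ltrDl.
have {}bv : balanced d v.
  by apply: balanced_mono bv; rewrite d0 (lt_le_trans dm)// ge_min lexx.
have {}bv' : balanced d v'.
  by apply: balanced_mono bv'; rewrite d0 (lt_le_trans dm)// ge_min lexx orbT.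
have [pv _ [K K0 H]] := bv; have [pv' _ [K' K'0 H']] := bv'.
have h01 : (0 < (2^-1 : R) < 1)%R by rewrite invr_gt0 ltr0n/= invf_lt1// ltr1n.
exists (d / 2)%R; split; [exact: positive_weightM|exact: divr_gt0|].
have hh : (1 - 2^-1 = 2^-1 :> R)%R by field.
have v0 x : (0 <= v x)%R by apply: ltW; exact: weight_gt0.
have v'0 x : (0 <= v' x)%R by apply: ltW; exact: weight_gt0.
exists ((K * K') `^ 2^-1)%R; first by rewrite powR_gt0// mulr_gt0.
move=> a l l0; have [A [B [A0 B0 wA wB AB]]] := H a l l0.
have [A' [B' [A'0 B'0 wA' wB' AB']]] := H' a l l0.
exists (A `^ 2^-1 * A' `^ 2^-1)%R, (B `^ 2^-1 * B' `^ 2^-1)%R.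
split; rewrite ?mulr_gt0 ?powR_gt0//.
- have := avgle_holder c_gt0 l0 (positive_weight_pow d pv) (positive_weight_pow d pv') h01 wA wA'.
  by rewrite hh; apply: eq_avgle => x; rewrite powRM// -!powRrM.
- have := avgle_holder c_gt0 l0 (positive_weight_pow (- d) pv) (positive_weight_pow (- d) pv') h01 wB wB'.
  by rewrite hh; apply: eq_avgle => x; rewrite powRM// -!powRrM mulNr.
rewrite mulrACA -!powRM ?mulr_ge0 ?(ltW A0) ?(ltW B0) ?(ltW A'0) ?(ltW B'0)//.
apply: ge0_ler_powR; rewrite ?nnegrE ?invr_ge0 ?mulr_ge0 ?(ltW A0) ?(ltW B0) ?(ltW A'0) ?(ltW B'0) ?(ltW K0) ?(ltW K'0)//.
by apply: ler_pM; rewrite ?mulr_ge0 ?(ltW A0) ?(ltW B0) ?(ltW A'0) ?(ltW B'0).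
Qed.

Lemma balanced_prod (I : Type) (r : seq I) (v_ : I -> T -> R) :
  (forall i, exists e, balanced e (v_ i)) ->
  exists e, balanced e (fun x => \prod_(i <- r) v_ i x)%R.
Proof.
move=> H; elim: r => [|i r [e IH]].
  by exists 1%R; under eq_fun do rewrite big_nil; exact: balanced_one.
have [e' bi] := H i.
have [e'' be] := balancedM bi IH; exists e''.
by under eq_fun do rewrite big_cons.
Qed.

(** Jensen's inequality with powers [r] and [r'], chosen so that the averages become those of [v] to
    the powers [e / (2 p)] and [- e / (2 p)], and [A^r B^r' = (A B^(p-1))^r]. *)
Lemma ApR_balanced p (e : R) v : (1 < p)%R -> (0 < e)%R -> positive_weight v ->
  ApR p (fun x => v x `^ e)%R -> balanced (e / (2 * p)) v.
Proof.
move=> p1 e0 pv [pw [K K0 H]]; have p10 : (0 < p - 1)%R by lra.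
have p20 : (0 < 2 * p)%R by lra.
split => //; first exact: divr_gt0.
pose r := ((2 * p)^-1)%R; pose r' := ((p - 1) / (2 * p))%R.
have r01 : (0 < r < 1)%R by rewrite invr_gt0 p20/= invf_lt1//; lra.
have r'01 : (0 < r' < 1)%R by rewrite divr_gt0//= ltr_pdivrMr//; lra.
exists (K `^ r)%R; first exact: powR_gt0.
move=> a l l0; have [A [B [A0 B0 wA wB AB]]] := H a l l0.
exists (A `^ r)%R, (B `^ r')%R; split; rewrite ?powR_gt0//.
- have := avgle_pow c_gt0 l0 pw r01 wA.
  by apply: eq_avgle => x; rewrite -powRrM.
- have := avgle_pow c_gt0 l0 (positive_weight_pow _ pw) r'01 wB.
  apply: eq_avgle => x; rewrite -!powRrM; congr (_ `^ _)%R.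
  by rewrite /r'; field; rewrite !gt_eqF//; lra.
rewrite (_ : r' = (p - 1) * r)%R// powRrM -powRM ?powR_ge0 ?(ltW A0)//.
have /andP[r0 _] := r01.
by apply: (ge0_ler_powR (ltW r0)); rewrite ?nnegrE ?mulr_ge0 ?powR_ge0 ?(ltW A0) ?(ltW K0).
Qed.

(** By the A_1 condition the average of the weight is at most [(K / A)^(s-1)] times that of [y^r].
    The dual weight is [u y^(-r/(s-1))]: Hölder's inequality with [1 + e] and its conjugate leads to
    the reverse Hölder bound for [u] and to a power [y^-b], and the last hypothesis says [b < d]. *)
Lemma RHA1_balanced_ApR (e K d s r : R) u (y : T -> R) : RHA1 e K u -> balanced d y ->
  (0 < e)%R -> (1 < s)%R -> (0 < r)%R -> (r < d)%R ->
  (r * (1 + e) < d * ((s - 1) * e))%R ->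
  ApR s (fun x => u x `^ (1 - s) * y x `^ r)%R.
Proof.
move=> [pu K0 Hu] [py d0 [Ky Ky0 Hy]] e0 s1 r0 rd rd'.
have s10 : (0 < s - 1)%R by lra. have e10 : (0 < 1 + e)%R by lra.
have u0 x : (0 < u x)%R by exact: weight_gt0.
have y0 x : (0 < y x)%R by exact: weight_gt0.
split; first by apply: positive_weightM; exact: positive_weight_pow.
pose h := ((1 + e)^-1)%R.
have h01 : (0 < h < 1)%R by rewrite invr_gt0 e10/= invf_lt1//; lra.
have hE : (1 - h = e / (1 + e))%R by rewrite /h; field; rewrite gt_eqF.
pose b := (r * (1 + e) / ((s - 1) * e))%R.
have se0 : (0 < (s - 1) * e)%R by exact: mulr_gt0.
have b0 : (0 < b)%R by rewrite divr_gt0// mulr_gt0.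
have bd : (b < d)%R by rewrite ltr_pdivrMr.
exists (K `^ (s - 1) * (K `^ h) `^ (s - 1) * Ky `^ (r / d))%R.
  by rewrite !mulr_gt0// !powR_gt0.
move=> a l l0; have [A [A0 uA Au uA']] := Hu a l l0.
have [B [C [B0 C0 yB yC BC]]] := Hy a l l0.
exists ((K / A) `^ (s - 1) * B `^ (r / d))%R,
  ((K * A `^ (1 + e)) `^ h * (C `^ (b / d)) `^ (1 - h))%R.
have rd01 : (0 < r / d < 1)%R by rewrite divr_gt0//= ltr_pdivrMr// mul1r.
have bd01 : (0 < b / d < 1)%R by rewrite divr_gt0//= ltr_pdivrMr// mul1r.
have KA0 : (0 < K / A)%R by exact: divr_gt0.
have yr : avgle a l (fun x => y x `^ r)%R (B `^ (r / d)).
  have := avgle_pow c_gt0 l0 (positive_weight_pow _ py) rd01 yB.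
  by apply: eq_avgle => x; rewrite -powRrM mulrC divfK ?gt_eqF.
have yb : avgle a l (fun x => y x `^ (- b))%R (C `^ (b / d)).
  have := avgle_pow c_gt0 l0 (positive_weight_pow _ py) bd01 yC.
  by apply: eq_avgle => x; rewrite -powRrM mulrC mulrN divfK ?gt_eqF.
split.
- by rewrite mulr_gt0// powR_gt0.
- by rewrite mulr_gt0// powR_gt0// ?mulr_gt0// powR_gt0.
- apply: (@avgle_le_ae _ _ _ _ _ (fun x => (K / A) `^ (s - 1) * y x `^ r)%R); last first.
  + by apply: avgleZ; [exact: positive_weight_pow|exact: powR_ge0|].
  + apply: filterS Au => x Au xQ; rewrite ler_pM2r ?powR_gt0//.
    rewrite (_ : 1 - s = - (s - 1))%R; last by ring.
    rewrite powRN -powR_inv1 ?powR_ge0// -powRAC (powR_inv1 (ltW (u0 x))).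
    apply: (ge0_ler_powR (ltW s10)); rewrite ?nnegrE ?invr_ge0 ?(ltW (u0 x)) ?(ltW KA0)//.
    by rewrite ler_pdivlMr// mulrC ler_pdivrMr// Au.
  + by apply: positive_weightZ; [rewrite powR_gt0|exact: positive_weight_pow].
  + by apply: positive_weightM; exact: positive_weight_pow.
- have := avgle_holder c_gt0 l0 (positive_weight_pow (1 + e) pu) (positive_weight_pow (- b) py) h01 uA' yb.
  apply: eq_avgle => x.
  rewrite (powRM _ (powR_ge0 _ _) (powR_ge0 _ _)) -!(powRrM (u x)) -!(powRrM (y x)).
  have -> : ((1 - s) * - (s - 1)^-1 = (1 + e) * h)%R by rewrite /h; field; rewrite !gt_eqF.
  have -> : (r * - (s - 1)^-1 = - b * (1 - h))%R by rewrite hE /b; field; rewrite !gt_eqF.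
  by [].
have -> : ((K * A `^ (1 + e)) `^ h = K `^ h * A)%R.
  rewrite powRM ?powR_ge0 ?(ltW K0)// -powRrM /h divff ?gt_eqF// powRr1//.
  exact: ltW.
rewrite (powRM _ (mulr_ge0 (powR_ge0 _ _) (ltW A0)) (powR_ge0 _ _)).
rewrite (powRM _ (powR_ge0 _ _) (ltW A0)).
have -> : (((C `^ (b / d)) `^ (1 - h)) `^ (s - 1) = C `^ (r / d))%R.
  rewrite -!powRrM; congr (_ `^ _)%R; rewrite hE /b; field.
  by rewrite !gt_eqF.
have -> : ((K / A) `^ (s - 1) * B `^ (r / d) *
   ((K `^ h) `^ (s - 1) * A `^ (s - 1) * C `^ (r / d)) =
   ((K / A) `^ (s - 1) * A `^ (s - 1)) * (K `^ h) `^ (s - 1) * (B `^ (r / d) * C `^ (r / d)))%R by ring.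
rewrite -(powRM _ (ltW KA0) (ltW A0)) -(powRM _ (ltW B0) (ltW C0)) divfK ?gt_eqF//.
rewrite ler_pM2l ?mulr_gt0 ?powR_gt0 ?powR_gt0//.
by apply: ge0_ler_powR; rewrite ?nnegrE ?mulr_ge0 ?invr_ge0 ?(ltW r0) ?(ltW d0) ?(ltW B0) ?(ltW C0) ?(ltW Ky0).
Qed.

End weight_classes.

(** * The reverse Hölder inequality for A_1 weights on cubes *)

Section reverse_holder_A1.
Context {R : realType} {n : nat}.
Local Notation T := (Rn R n.+1).
Local Notation leb := (@leb R n).
Local Notation c := (@unit_cube_vol R n).
Implicit Types (x y : T) (a : 'rV[R]_n.+1) (l : R) (u : T -> R).
Local Notation one := (fun=> 1%R : R).
Hypothesis c_gt0 : (0 < c)%R.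

Lemma le_wavg_one t k (f : T -> \bar R) x (m A : R) : leb (fiber (grid t k) x) = m%:E ->
  (0 < m)%R -> (wavg leb one (grid t k) f x <= A%:E) =
  (\int[leb]_(y in fiber (grid t k) x) f y <= (A * m)%:E).
Proof.
move=> mE m0; rewrite /wavg int_one; last exact: measurable_cell.
by rewrite mE inver gt_eqF// EFinM [X in _ = (_ <= X)]muleC lee_pdivrMl.
Qed.

Lemma ge_wavg_one t k (f : T -> \bar R) x (m A : R) : leb (fiber (grid t k) x) = m%:E ->
  (0 < m)%R -> (A%:E <= wavg leb one (grid t k) f x) =
  ((A * m)%:E <= \int[leb]_(y in fiber (grid t k) x) f y).
Proof.
move=> mE m0; rewrite /wavg int_one; last exact: measurable_cell.
by rewrite mE inver gt_eqF// EFinM [X in _ = (X <= _)]muleC lee_pdivlMl.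
Qed.

(** The inequality for nested partitions, applied in a cell containing the cube. The A_1 condition
    on the cube around a cell bounds its average by those over its descendants, and the ratio of
    volumes limits the growth of averages from one level to the next. *)
Lemma A1R_RHA1 K u : A1R K u -> exists e K' : R, (0 < e)%R /\ RHA1 e K' u.
Proof.
move=> [pu K0 H].
have K1 : (1 <= K)%R. (* the essential infimum is at most the average *)
  have [A [A0 uA Au]] := H 0%R 1%R ltr01.
  have v0 := @vol_gt0 R n c_gt0 _ (@ltr01 R).
  rewrite leNgt; apply/negP => K1.
  have h : (A * @vol R n 1)%:E <= (K%:E * \int[leb]_(x in (cube 0%R 1%R : set T)) (u x)%:E).
    rewrite -nnm_intZ; [|exact: measurable_cube|by rewrite lee_fin ltW|exact: positive_weight_nnm].
    rewrite EFinM -(@leb_cubeE R n 0%R 1%R ltr01) -(integral_cst leb (@measurable_cube R n _ _)).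
    apply: nnm_le_ae_int; [exact: measurable_cube| | |].
    - by apply: nnm_cst; rewrite lee_fin ltW.
    - by apply: nnmMl; [rewrite lee_fin ltW|exact: positive_weight_nnm].
    - by apply: filterS Au => x H' /H'; rewrite -EFinM lee_fin.
  have := le_trans h (lee_wpmul2l (ltW K0 : 0 <= K%:E) uA).
  by rewrite -EFinM lee_fin ler_pMl ?mulr_gt0// leNgt K1.
(* A cell and the cube around it differ in volume by at most [2^(n+1)], whence [C]. A cell and its
   child differ by at most [4^(n+1)]: once for halving the side, once for the crude lower bound on
   the volume of a cell. *)
pose D : R := (4 ^+ n.+1)%R; pose C : R := (2 ^+ n.+1 * K)%R.
have d2 : (1 <= 2 ^+ n.+1 :> R)%R by rewrite exprn_ege1// ler1n.
have d20 : (0 < 2 ^+ n.+1 :> R)%R by rewrite exprn_gt0.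
have D1 : (1 <= D)%R by rewrite exprn_ege1// ler1n.
have C1 : (1 <= C)%R by rewrite mulr_ege1.
have D0 : (0 < D)%R by exact: lt_le_trans D1.
have C0 : (0 < C)%R by exact: lt_le_trans C1.
pose e := ((2 * D * C)^-1)%R.
have e0 : (0 < e)%R by rewrite invr_gt0 !mulr_gt0.
have avg_fin a l : (0 < l)%R -> exists A : R, avgle a l u A.
  by move=> l0; have [A [_ uA _]] := H a l l0; exists A.
have nu := positive_weight_nnm pu.
have RH t k x0 : \int[leb]_(x in fiber (grid t k) x0) (u x `^ (1 + e))%:E <=
    2%:E * ((\int[leb]_(x in fiber (grid t k) x0) (one x)%:E) *
    wavg leb one (grid t k) (fun x => (u x)%:E) x0 `^ (1 + e)).
  have := @reverse_holder _ T R _ leb (fun i : nat => grid t (k + i%:Z)) _ _ _ u pu _ _ C D C1 D1 _ _ x0.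
  rewrite addr0; apply.
  - by move=> i; exact: measurable_grid.
  - move=> i x y; rewrite (_ : k + i.+1%:Z = (k + i%:Z) + 1)%R; first exact: grid_nested.
    by rewrite -addn1 PoszD addrA.
  - by move=> i; exact: fiberwise_finite_one.
  - by move=> i; exact: fiberwise_finite_avgle.
  - exact: density_grid.
  - move=> j i x ji.
    have [m mE [m0 m1 m2]] := @cell_volE R n c_gt0 t (k + j%:Z)%R x.
    have [m' mE' [m'0 m'1 m'2]] := @cell_volE R n c_gt0 t (k + i%:Z)%R x.
    have [A [A0 uA Au]] := H (corner t (k + j%:Z) x) (side (k + j%:Z)) (@side_gt0 R _).
    apply: (@le_trans _ _ (2 ^+ n.+1 * A)%:E).
      rewrite (le_wavg_one _ _ mE m0); apply: (le_trans (cell_int_le pu uA)).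
      by rewrite lee_fin (mulrC (2 ^+ n.+1)%R A) -(mulrA A) (ler_pM2l A0).
    rewrite /C -[leLHS](@EFinK_mule _ (2 ^+ n.+1 * K)^-1%R) ?invr_eq0 ?gt_eqF ?mulr_gt0//.
    rewrite invrK; apply: lee_wpmul2l; first by rewrite lee_fin mulr_ge0// ltW.
    rewrite -EFinM (ge_wavg_one _ _ mE' m'0) EFinM -mE'.
    rewrite -(integral_cst leb (@measurable_cell R n t _ x)).
    have -> : ((2 ^+ n.+1 * K)^-1 * (2 ^+ n.+1 * A) = K^-1 * A)%R.
      by field; rewrite !gt_eqF.
    apply: nnm_le_ae_int => //; first exact: measurable_cell.
      by apply: nnm_cst; rewrite lee_fin mulr_ge0 ?invr_ge0// ltW.
    apply: filterS Au => y Au yi; rewrite lee_fin mulrC ler_pdivrMr// mulrC.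
    apply: Au; apply: cell_sub_cube.
    suff : grid t (k + j%:Z) y = grid t (k + j%:Z) x by [].
    elim: i ji yi {mE' m'0 m'1 m'2} => [|i IH]; first by rewrite leqn0 => /eqP ->.
    rewrite leq_eqVlt => /predU1P[->//|ji] yi; apply: IH => //.
    apply: grid_nested; move: yi.
    by rewrite (_ : k + i.+1%:Z = (k + i%:Z) + 1)%R// -addn1 PoszD addrA.
  move=> i x.
  have [m mE [m0 m1 m2]] := @cell_volE R n c_gt0 t (k + i%:Z)%R x.
  have [m' mE' [m'0 m'1 m'2]] := @cell_volE R n c_gt0 t (k + i.+1%:Z)%R x.
  have kE : (k + i.+1%:Z = (k + i%:Z) + 1)%R by rewrite -addn1 PoszD addrA.
  have mm : (m <= D * m')%R.
    apply: (le_trans m1); rewrite (side_succ (k + i%:Z)) -kE vol_scale.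
    rewrite /D (_ : 4 ^+ n.+1 = 2 ^+ n.+1 * 2 ^+ n.+1 :> R)%R; last first.
      by rewrite -exprMn -natrM.
    by rewrite -mulrA ler_pM2l.
  have /andP[_ foo] := fiberwise_finite_avgle c_gt0 t (k + i%:Z)%R pu avg_fin x.
  have [r r0 rE] := ltey_EFin (nnm_int_ge0 leb _ nu) foo.
  have -> : wavg leb one (grid t (k + i%:Z)) (fun x => (u x)%:E) x = (r / m)%:E.
    by rewrite /wavg int_one; [rewrite mE rE inver gt_eqF// -EFinM mulrC|exact: measurable_cell].
  rewrite -EFinM (le_wavg_one _ _ mE' m'0).
  apply: (@le_trans _ _ r%:E).
    rewrite -rE; apply: nnm_subset_int => //; [exact: measurable_cell|exact: measurable_cell|].
    by move=> y; rewrite /fiber /= kE; exact: grid_nested.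
  rewrite lee_fin (_ : D * (r / m) * m' = r * (D * m') / m)%R; last by ring.
  by rewrite ler_pdivlMr// ler_wpM2l.
(* [S] compares the volume of the cell with that of the cube. The number taken for the cube is [L]
   times the [A] of the cell, large enough to bound the average over the cube, and [K' = 2 L K] pays
   for it. *)
pose S : R := (6 ^+ n.+1)%R.
have S0 : (0 < S)%R by rewrite exprn_gt0.
have S1 : (1 <= S)%R by rewrite exprn_ege1// ler1n.
pose K' := (2 * S * 2 ^+ n.+1 * K)%R.
pose L := (S * 2 ^+ n.+1)%R.
have L0 : (0 < L)%R by rewrite mulr_gt0.
have L1 : (1 <= L)%R by rewrite mulr_ege1.
have K'0 : (0 < K')%R by rewrite !mulr_gt0.
exists e, K'; split; first exact: e0.
split; [exact: pu|exact: K'0|].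
move=> a l l0; have [t [k [kl Qcell]]] := cube_in_cell a l0.
pose x0 : T := a.
have x0Q : cube a l x0 by apply/cubeP => i; rewrite lexx/= lerDl ltW.
have Qsub : cube a l `<=` fiber (grid t k) x0 by exact: Qcell.
have [m mE [m0 m1 m2]] := @cell_volE R n c_gt0 t k x0.
have [A [A0 uA Au]] := H (corner t k x0) (side k) (@side_gt0 R k).
have mS : (m <= S * @vol R n l)%R.
  by apply: (le_trans m1); rewrite -vol_scale le_vol// ltW// side_gt0.
have avgA : wavg leb one (grid t k) (fun x => (u x)%:E) x0 <= (2 ^+ n.+1 * A)%:E.
  rewrite (le_wavg_one _ _ mE m0); apply: (le_trans (cell_int_le pu uA)).
  by rewrite lee_fin (mulrC (2 ^+ n.+1)%R A) -(mulrA A) (ler_pM2l A0).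
have v0 := vol_gt0 c_gt0 l0.
exists (L * A)%R; split.
- exact: mulr_gt0.
- apply: (@le_trans _ _ (\int[leb]_(x in fiber (grid t k) x0) (u x)%:E)).
    by apply: nnm_subset_int; [exact: measurable_cube|exact: measurable_cell|exact: nu|].
  move: avgA; rewrite (le_wavg_one _ _ mE m0) => /le_trans; apply.
  rewrite lee_fin /L (mulrC S) -!mulrA ler_pM2l// [leRHS]mulrCA ler_pM2l//.
- apply: filterS Au => x Au xQ; rewrite /K' /L.
  have : (A <= K * u x)%R by apply: Au; apply: cell_sub_cube; exact: Qsub.
  move=> h; apply: (@le_trans _ _ (L * (K * u x))%R); first by rewrite ler_pM2l.
  rewrite /L -!mulrA mulrCA -mulrCA ler_peMl ?ler1n//.
  by rewrite !mulr_ge0 ?(ltW S0) ?(ltW d20) ?(ltW K0)// ltW// weight_gt0.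
apply: (@le_trans _ _ (\int[leb]_(x in fiber (grid t k) x0) (u x `^ (1 + e))%:E)).
  apply: nnm_subset_int; [exact: measurable_cube|exact: measurable_cell| |exact: Qsub].
  by apply: positive_weight_nnm; exact: positive_weight_pow.
apply: (le_trans (RH t k x0)).
rewrite int_one; last exact: measurable_cell.
have nw : 0 <= wavg leb one (grid t k) (fun x => (u x)%:E) x0.
  apply: nnm_ge0; apply: wavg_nnm; [exact: measurable_grid|by []|].
  by move=> x; exact: (nnm_ge0 x nu).
have e10 : (0 <= 1 + e)%R by rewrite addr_ge0// ltW.
apply: (@le_trans _ _ (2%:E * (m%:E * ((2 ^+ n.+1 * A)%:E `^ (1 + e))))).
  rewrite mE; apply: lee_wpmul2l; first by rewrite lee_fin.
  apply: lee_wpmul2l; first by rewrite lee_fin ltW.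
  exact: le_poweR2r.
rewrite poweR_EFin -!EFinM lee_fin.
apply: (@le_trans _ _ (2 * (S * @vol R n l * (2 ^+ n.+1 * A) `^ (1 + e)))%R).
  by rewrite ler_pM2l// ler_wpM2r// powR_ge0.
apply: (@le_trans _ _ (2 * (S * @vol R n l * (L * A) `^ (1 + e)))%R).
  rewrite ler_pM2l// (ler_pM2l (mulr_gt0 S0 v0)).
  apply: (ge0_ler_powR e10); rewrite ?nnegrE.
  - by rewrite mulr_ge0// ltW.
  - by apply: mulr_ge0; exact: ltW.
  - by rewrite (ler_pM2r A0) /L ler_peMl// ltW.
have P0 : (0 <= (L * A) `^ (1 + e) * @vol R n l)%R by rewrite mulr_ge0 ?powR_ge0// ltW.
rewrite (_ : 2 * (S * @vol R n l * (L * A) `^ (1 + e)) =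
  (2 * S) * ((L * A) `^ (1 + e) * @vol R n l))%R; last by ring.
by rewrite -[leRHS]mulrA ler_wpM2r// /K' -mulrA ler_peMr ?mulr_ge0 ?(ltW S0)// mulr_ege1.
Qed.

End reverse_holder_A1.

(** * Positive finite representatives of Muckenhoupt weights *)

Section representatives.
Context {R : realType} {n : nat}.
Local Notation T := (Rn R n.+1).
Local Notation leb := (@leb R n).
Local Notation c := (@unit_cube_vol R n).
Implicit Types (x y : T) (a : 'rV[R]_n.+1) (l p K : R) (u w : T -> R) (f g H : T -> \bar R).
Hypothesis c_gt0 : (0 < c)%R.

(** Where [H] is 0 or infinite, [fine] returns 0, so adding the indicator of that set gives the
    value 1 there. *)
Lemma positive_representative H : nnm H -> {ae leb, forall x, 0 < H x < +oo} ->
  exists h : T -> R, positive_weight h /\ {ae leb, forall x, H x = (h x)%:E}.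
Proof.
move=> nH H01; pose Z : set T := [set x | H x <= 0] `|` [set x | +oo <= H x].
have mH := nnm_measurable nH.
have mZ : measurable Z.
  apply: measurableU.
    by have := emeasurable_fun_infty_c measurableT mH 0; rewrite setTI.
  by have := emeasurable_fun_c_infty measurableT mH +oo; rewrite setTI.
pose h x : R := (fine (H x) + \1_Z x)%R.
have hP x : 0 < H x < +oo -> ~ Z x.
  move=> /andP[h0 hoo] [/= Z0|/= Zoo]; first by rewrite leNgt h0 in Z0.
  by rewrite leNgt hoo in Zoo.
exists h; split; last first.
  apply: filterS H01 => x Hx; have nZ := hP x Hx; have /andP[h0 hoo] := Hx.
  rewrite /h indicE memNset// addr0 fineK// ge0_fin_numE//.
  exact: ltW.
apply/positive_weightP; split.
  move=> x; rewrite /h indicE; have [xZ|/negP xZ] := boolP (x \in Z).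
    by rewrite ltr_wpDl// fine_ge0//; exact: nnm_ge0.
  rewrite addr0; apply: fine_gt0; rewrite !ltNge; apply/andP; split; apply/negP => h'.
    by apply: xZ; rewrite inE; left.
  by apply: xZ; rewrite inE; right.
apply: measurable_funD.
  exact: (measurableT_comp (fine_measurable measurableT) mH).
exact: measurable_indic.
Qed.

Lemma big_cubeP (r : R) x : (forall i, (`|coord x i| <= r)%R) -> (0 < r)%R ->
  cube (\row_i (- r))%R (2 * r) x.
Proof.
move=> xr r0; apply/cubeP => i; rewrite !mxE; have := xr i; rewrite /coord ler_norml.
by move=> /andP[h1 h2]; apply/andP; split; lra.
Qed.

Lemma ae_on_cubes (P : T -> Prop) :
  (forall a l, (0 < l)%R -> {ae leb, forall x, cube a l x -> P x}) ->
  {ae leb, forall x, P x}.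
Proof.
move=> H; have : {ae leb, forall x, forall N : nat,
    cube (\row_i (- N.+1%:R))%R (2 * N.+1%:R) x -> P x}.
  by apply: ae_foralln => N; apply: H; exact: mulr_gt0.
apply: filterS => x Hx.
pose r : R := (\sum_i `|coord x i|)%R.
apply: (Hx (Num.trunc r)); apply: big_cubeP => // i.
apply: (@le_trans _ _ r); last by rewrite ltW// truncnS_gt.
by rewrite /r (bigD1 i)//= lerDl sumr_ge0.
Qed.

Lemma cube_join a l a0 l0 : (0 < l)%R -> (0 < l0)%R -> exists a' l',
  [/\ (0 < l')%R, cube a l `<=` cube a' l' & cube a0 l0 `<=` cube a' l'].
Proof.
move=> l_gt0 l0_gt0; pose r := (\sum_i (`|a ord0 i| + `|a0 ord0 i|) + l + l0)%R.
have s0 : (0 <= \sum_i (`|a ord0 i| + `|a0 ord0 i|))%R.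
  by apply: sumr_ge0 => i _; rewrite addr_ge0.
have r0 : (0 < r)%R by rewrite ltr_wpDl// addr_ge0// ltW.
have rP i : (`|a ord0 i| + `|a0 ord0 i| + l + l0 <= r)%R.
  by rewrite !lerD2r (bigD1 i)//= lerDl sumr_ge0// => j _; rewrite addr_ge0.
exists (\row_i (- r))%R, (2 * r)%R; split; first exact: mulr_gt0.
  move=> x /cubeP xQ; apply: big_cubeP => // i; have /andP[h1 h2] := xQ i.
  apply: le_trans (rP i); rewrite /coord ler_norml.
  have := normr_ge0 (a0 ord0 i); have /ler_normlP[g1 g2] := lexx `|a ord0 i|%R.
  by move=> g3; apply/andP; split; lra.
move=> x /cubeP xQ; apply: big_cubeP => // i; have /andP[h1 h2] := xQ i.
apply: le_trans (rP i); rewrite /coord ler_norml.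
have := normr_ge0 (a ord0 i); have /ler_normlP[g1 g2] := lexx `|a0 ord0 i|%R.
by move=> g3; apply/andP; split; lra.
Qed.

Lemma cube_enlarge a l x0 : (0 < l)%R -> exists a' l',
  [/\ (0 < l')%R, cube a l `<=` cube a' l' & cube a' l' x0].
Proof.
move=> l0; have [a' [l' [l'0 s1 s2]]] := cube_join a x0 l0 (@ltr01 R).
by exists a', l'; split => //; apply: s2; apply/cubeP => i; rewrite lexx/= lerDl.
Qed.

(** The inverse of 0 is [+oo], hence the decomposition into a real part and [+oo] times the
    indicator of the zero set. The real part takes the default value 0 both at 0 and at [+oo]. *)
Lemma nnm_inv f : nnm f -> nnm (fun x => (f x)^-1).
Proof.
move=> nf; have mf := nnm_measurable nf.
pose Z : set T := [set x | f x <= 0].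
have mZ : measurable Z.
  by have := emeasurable_fun_infty_c measurableT mf 0; rewrite setTI.
have -> : (fun x => (f x)^-1) = (fun x => (fine (f x) `^ (-1))%:E +
    +oo * (\1_Z x)%:E).
  apply/funext => x; rewrite indicE; have := nnm_ge0 x nf.
  have [/set_mem /= fx0|/negP] := boolP (x \in Z).
    move=> fx0'; have -> : f x = 0 by apply/eqP; rewrite eq_le fx0.
    by rewrite inve0 mule1 addey.
  rewrite inE /= => /negP; rewrite -ltNge mule0 adde0.
  case: (f x) => [r| |]//; last by rewrite invey powR0// oppr_eq0.
  by rewrite lte_fin => r0 _; rewrite inver gt_eqF//= powR_inv1// ltW.
apply: nnmD; last by apply: nnmMl => //; exact: nnm_indic.
apply: nnm_EFin; first by move=> x; exact: powR_ge0.
apply: (measurableT_comp (measurable_powR (-1)%R)).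
exact: (measurableT_comp (fine_measurable measurableT) mf).
Qed.

(* [H] is positive everywhere because vanishing at one point would force it to
   vanish almost everywhere. *)
Lemma everywhere_A1R K H : nnm H -> (0 < K)%R ->
  (forall a l x, (0 < l)%R -> cube a l x ->
     \int[leb]_(y in (cube a l : set T)) H y <= K%:E * H x * (@vol R n l)%:E) ->
  (exists x, H x < +oo) -> ~ {ae leb, forall x, H x = 0} ->
  exists h : T -> R, [/\ A1R K h, {ae leb, forall x, H x = (h x)%:E} &
    forall x, 0 < H x].
Proof.
move=> nH K0 HA [x0 Hx0] Hn0.
have Hgt0 x : 0 < H x.
  rewrite lt_neqAle (nnm_ge0 x nH) andbT; apply/eqP => H0; apply: Hn0.
  apply: ae_on_cubes => a l l0; have [a' [l' [l'0 sub xQ]]] := cube_enlarge a x l0.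
  have /(nnm_int_eq0_ae (@measurable_cube R n a' l') nH) :
      \int[leb]_(y in (cube a' l' : set T)) H y = 0.
    apply/eqP; rewrite eq_le nnm_int_ge0// andbT.
    by apply: (le_trans (HA a' l' x l'0 xQ)); rewrite -H0 mule0 mul0e.
  by apply: filterS => y Hy yQ; apply: Hy; exact: sub.
(* One point where [H] is finite makes all integrals over cubes finite, through a larger cube
   containing the point. *)
have Hfin a l : (0 < l)%R -> \int[leb]_(y in (cube a l : set T)) H y < +oo.
  move=> l0; have [a' [l' [l'0 sub xQ]]] := cube_enlarge a x0 l0.
  apply: (@le_lt_trans _ _ (\int[leb]_(y in (cube a' l' : set T)) H y)).
    by apply: nnm_subset_int => //; exact: measurable_cube.
  apply: (le_lt_trans (HA a' l' x0 l'0 xQ)).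
  by have [r r0 ->] := ltey_EFin (ltW (Hgt0 x0)) Hx0; rewrite -!EFinM ltry.
have Hae : {ae leb, forall x, 0 < H x < +oo}.
  apply: ae_on_cubes => a l l0.
  have := nnm_int_fin_ae (@measurable_cube R n a l) nH (Hfin a l l0).
  by apply: filterS => x Hx /Hx ->; rewrite Hgt0.
have [h [ph Hh]] := positive_representative nH Hae.
exists h; split => //; split => // a l l0.
have nh := positive_weight_nnm ph.
have IE : \int[leb]_(y in (cube a l : set T)) (h y)%:E =
          \int[leb]_(y in (cube a l : set T)) H y.
  apply: nnm_eq_ae_int => //; first exact: measurable_cube.
  by apply: filterS Hh => x ->.
have [I I0 IH] := ltey_EFin (nnm_int_ge0 leb _ nH) (Hfin a l l0).
have v0 := vol_gt0 c_gt0 l0.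
have Igt0 : (0 < I)%R.
  rewrite -lte_fin -IH -IE; apply: int_weight_gt0 => //; first exact: measurable_cube.
  by rewrite leb_cubeE// lte_fin.
exists (I / @vol R n l)%R; split; first exact: divr_gt0.
  by rewrite /avgle IE IH divfK// gt_eqF.
apply: filterS Hh => x Hx xQ; have := HA a l x l0 xQ.
by rewrite IH Hx -!EFinM lee_fin ler_pdivrMr.
Qed.

Lemma average_cube f a l : (forall x, 0 <= f x) -> (0 < l)%R ->
  average f (cube a l) =
  ((@vol R n l)^-1)%:E * \int[leb]_(x in (cube a l : set T)) f x.
Proof.
move=> f0 l0; rewrite /average leb_cubeE// inver gt_eqF ?vol_gt0//.
by congr (_ * _); apply: eq_integral => x _; rewrite gee0_abs.
Qed.

Lemma is_cube_cube a l : (0 < l)%R -> is_cube (cube a l : set T).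
Proof. by move=> l0; exists a, l. Qed.

Lemma ApR_Ainfty p w : (1 < p)%R -> ApR p w -> Ainfty (fun x : T => (w x)%:E).
Proof.
move=> p1 [pw [K K0 H]]; exists p; split => //.
have p10 : (0 < p - 1)%R by lra.
have w0 x : (0 < w x)%R by exact: weight_gt0.
have nw := positive_weight_nnm pw.
split.
  split; first by split; [move=> x; exact: (nnm_ge0 x nw)|exact: nnm_measurable nw].
  move=> Q [a [l [l0 ->]]]; have [A [B [_ _ wA _ _]]] := H a l l0.
  by apply: (le_lt_trans wA); rewrite ltry.
apply: (@le_lt_trans _ _ K%:E); last by rewrite ltry.
apply: ge_ereal_sup => _ [Q [a [l [l0 ->]]] <-].
have [A [B [A0 B0 wA wB AB]]] := H a l l0; have v0 := vol_gt0 c_gt0 l0.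
have E x : ((w x)%:E `^ (p - 1)^-1)^-1 = (w x `^ (- (p - 1)^-1))%:E.
  by rewrite poweR_EFin inver gt_eqF ?powR_gt0// powRN.
suff : average (fun x : T => (w x)%:E) (cube a l) *
    average (fun x : T => (w x `^ (- (p - 1)^-1))%:E) (cube a l) `^ (p - 1) <= K%:E.
  by move: E => /funext <-.
rewrite !average_cube//; last 2 first.
- by move=> x; rewrite lee_fin powR_ge0.
- by move=> x; rewrite lee_fin ltW.
apply: (@le_trans _ _ (A%:E * B%:E `^ (p - 1))); last first.
  by rewrite poweR_EFin -EFinM lee_fin.
have vi : 0 <= ((@vol R n l)^-1)%:E :> \bar R by rewrite lee_fin invr_ge0 ltW.
have div (g : T -> \bar R) (C : R) : \int[leb]_(x in (cube a l : set T)) g x <= (C * @vol R n l)%:E ->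
    ((@vol R n l)^-1)%:E * \int[leb]_(x in (cube a l : set T)) g x <= C%:E.
  by move=> gC; rewrite lee_pdivrMl// -EFinM mulrC.
apply: lee_pmul.
- by apply: mule_ge0 => //; exact: nnm_int_ge0.
- exact: poweR_ge0.
- exact: div.
apply: le_poweR2r; [exact: ltW| |exact: div].
apply: mule_ge0 => //; apply: nnm_int_ge0; apply: positive_weight_nnm.
exact: positive_weight_pow.
Qed.

Lemma ae_zero_or_pos f : nnm f ->
  (forall a l, (0 < l)%R -> \int[leb]_(x in (cube a l : set T)) f x < +oo) ->
  leb [set x | f x <= 0] = 0 -> {ae leb, forall x, 0 < f x < +oo}.
Proof.
move=> nf ffin f0.
have mZ : measurable [set x : T | f x <= 0].
  by have := emeasurable_fun_infty_c measurableT (nnm_measurable nf) 0; rewrite setTI.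
have fpos : {ae leb, forall x, 0 < f x}.
  by exists [set x | f x <= 0]; split => // x /= /negP; rewrite -leNgt.
apply: ae_on_cubes => a l l0.
have := nnm_int_fin_ae (@measurable_cube R n a l) nf (ffin a l l0).
by apply: filterS2 fpos => x fx Hx /Hx ->; rewrite fx.
Qed.

(** The zero weight satisfies the definition because [0 * +oo = 0]. If [w0] vanishes on a set of
    positive measure, its negative power has infinite integral over every cube meeting that set in
    positive measure; the finite constant then forces [w0] to have integral 0 over these cubes,
    which exhaust the space. *)
Lemma Ainfty_ApR (w0 : T -> \bar R) : Ainfty w0 -> {ae leb, forall x : T, w0 x = 0} \/
  exists p w, [/\ (1 < p)%R, ApR p w & {ae leb, forall x, w0 x = (w x)%:E}].
Proof.
move=> [p [p1 [[[w_ge0 mw] wfin] ApC]]].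
have p10 : (0 < p - 1)%R by lra.
have nw0 : nnm w0 by apply/nnmP; split.
have fin a l : (0 < l)%R -> \int[leb]_(x in (cube a l : set T)) w0 x < +oo.
  by move=> l0; apply: wfin; exact: is_cube_cube.
pose s (x : T) := ((w0 x) `^ (p - 1)^-1)^-1.
have ns : nnm s by apply: nnm_inv; exact: nnm_pow.
have s_ge0 x : 0 <= s x by rewrite inve_ge0 poweR_ge0.
pose Z : set T := [set x | w0 x <= 0].
have mZ : measurable Z.
  by have := emeasurable_fun_infty_c measurableT (nnm_measurable nw0) 0; rewrite setTI.
have Ap_le a l : (0 < l)%R ->
    average w0 (cube a l) * average s (cube a l) `^ (p - 1) <= Ap_const p w0.
  by move=> l0; apply: ereal_sup_ubound; exists (cube a l) => //; exact: is_cube_cube.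
have [Z0|Z0] := eqVneq (leb Z) 0; last first.
  left.
  have [a0 [l0 [l0_gt0 ZQ0]]] : exists a0 l0, (0 < l0)%R /\
      leb (Z `&` (cube a0 l0 : set T)) != 0.
    apply: contrapT => H; move/negP: Z0; apply; apply/eqP.
    have : {ae leb, forall x, ~ Z x}.
      apply: ae_on_cubes => a l l_gt0; exists (Z `&` cube a l); split.
      - by apply: measurableI; [exact: mZ|exact: measurable_cube].
      - by apply: contrapT => /eqP H'; apply: H; exists a, l.
      - by move=> x /= /not_implyP[xQ /contrapT xZ].
    move=> [N [mN N0 ZN]]; apply/eqP; rewrite eq_le measure_ge0 andbT -N0.
    by apply: le_measure; rewrite ?inE// => x xZ; apply: ZN => /=; apply.
  apply: ae_on_cubes => a l l_gt0.
  have [a' [l' [l'0 s1 s2]]] := cube_join a a0 l_gt0 l0_gt0.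
  have mQ := @measurable_cube R n a' l'; have v0 := vol_gt0 c_gt0 l'0.
  have mZQ : measurable (Z `&` (cube a' l' : set T)) by exact: measurableI.
  have soo : \int[leb]_(x in (cube a' l' : set T)) s x = +oo.
    apply/eqP; rewrite -leye_eq.
    apply: (@le_trans _ _ (\int[leb]_(x in Z `&` (cube a' l' : set T)) s x)).
      rewrite (eq_integral (cst +oo)); last first.
        move=> x /set_mem [/= Zx _]; rewrite /s.
        have -> : w0 x = 0 by apply/eqP; rewrite eq_le Zx w_ge0.
        by rewrite poweR0r ?inve0// gt_eqF// invr_gt0.
      rewrite (integral_cst leb mZQ) gt0_mulye//.
      apply: lt_le_trans (_ : leb (Z `&` (cube a0 l0 : set T)) <= _).
        by rewrite lt_neqAle eq_sym ZQ0 measure_ge0.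
      apply: le_measure; rewrite ?inE//.
        by apply: measurableI; [exact: mZ|exact: measurable_cube].
      by move=> x [xZ xQ]; split => //; exact: s2.
    by apply: nnm_subset_int => // x [].
  have := Ap_le a' l' l'0; rewrite !average_cube// soo.
  rewrite gt0_muley ?lte_fin ?invr_gt0// poweRyr ?gt_eqF//.
  set I := \int[leb]_(x in _) _ => H.
  have I0 : 0 <= I by exact: nnm_int_ge0.
  have IE : I = 0.
    apply/eqP; rewrite eq_le I0 andbT leNgt; apply/negP => Igt0.
    move: H; rewrite gt0_muley ?leye_eq; last first.
      by rewrite mule_gt0// lte_fin invr_gt0.
    by move=> /eqP H; rewrite H ltxx in ApC.
  have := nnm_int_eq0_ae mQ nw0 IE.
  by apply: filterS => x Hx xQ; apply: Hx; exact: s1.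
right.
have [w [pw wE]] := positive_representative nw0 (ae_zero_or_pos nw0 fin Z0).
exists p, w; split => //; split => //.
have [K K0 KE] : exists2 K : R, (0 <= K)%R & Ap_const p w0 = K%:E.
  apply: ltey_EFin => //; apply: le_trans (Ap_le 0%R 1%R ltr01).
  apply: mule_ge0; last exact: poweR_ge0.
  by rewrite average_cube// mule_ge0 ?lee_fin ?invr_ge0 ?(ltW (vol_gt0 _ _))//; exact: nnm_int_ge0.
exists (K + 1)%R; first by rewrite ltr_wpDl.
move=> a l l0; have v0 := vol_gt0 c_gt0 l0.
have nw := positive_weight_nnm pw.
have psig := positive_weight_pow (- (p - 1)^-1)%R pw.
have nsig := positive_weight_nnm psig.
have wI : \int[leb]_(x in (cube a l : set T)) w0 x = \int[leb]_(x in (cube a l : set T)) (w x)%:E.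
  by apply: nnm_eq_ae_int => //; exact: measurable_cube.
have mQ := @measurable_cube R n a l.
have Qpos : 0 < leb (cube a l : set T) by rewrite leb_cubeE// lte_fin.
have sI : \int[leb]_(x in (cube a l : set T)) s x =
    \int[leb]_(x in (cube a l : set T)) (w x `^ (- (p - 1)^-1))%:E.
  apply: nnm_eq_ae_int => //; apply: filterS wE => x wx.
  rewrite /s wx poweR_EFin inver gt_eqF ?powR_gt0 ?weight_gt0//.
  by rewrite powRN.
have [I I0 IE] := ltey_EFin (nnm_int_ge0 leb (cube a l : set T) nw0) (fin a l l0).
have Igt0 : (0 < I)%R by rewrite -lte_fin -IE wI; exact: int_weight_gt0.
have := Ap_le a l l0; rewrite !average_cube// KE IE sI.
have := int_weight_gt0 psig mQ Qpos.
case JE: (\int[leb]_(x in _) _) => [J| |]// J0; last first.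
  rewrite gt0_muley ?lte_fin ?invr_gt0// poweRyr ?gt_eqF//.
  by rewrite gt0_muley ?lte_fin ?mulr_gt0 ?invr_gt0// leye_eq.
move: J0; rewrite lte_fin => J0.
rewrite -!EFinM lee_fin => H.
exists (I / @vol R n l)%R, (J / @vol R n l)%R; split.
- exact: divr_gt0.
- exact: divr_gt0.
- by rewrite /avgle -wI IE divfK// gt_eqF.
- by rewrite /avgle JE divfK// gt_eqF.
by rewrite (mulrC I) (mulrC J); apply: (le_trans H); rewrite lerDl.
Qed.

(** If [u0] vanishes on a set of positive measure, one point of it outside the exceptional null set
    is enough: averages over the cubes through that point are at most [C * 0]. *)
Lemma A1_A1R (u0 : T -> \bar R) : A1 u0 -> {ae leb, forall x : T, u0 x = 0} \/
  exists K u, A1R K u /\ {ae leb, forall x, u0 x = (u x)%:E}.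
Proof.
move=> [[[u_ge0 mu] ufin] [C MC]].
have nu0 : nnm u0 by apply/nnmP; split.
have fin a l : (0 < l)%R -> \int[leb]_(x in (cube a l : set T)) u0 x < +oo.
  by move=> l0; apply: ufin; exact: is_cube_cube.
have avgM a l x : (0 < l)%R -> cube a l x -> average u0 (cube a l) <= maximal u0 x.
  move=> l0 xQ; apply: ereal_sup_ubound; exists (cube a l) => //.
  by split => //; exact: is_cube_cube.
have MC' : {ae leb, forall x a l, (0 < l)%R -> cube a l x ->
    ((@vol R n l)^-1)%:E * \int[leb]_(x in (cube a l : set T)) u0 x <= C%:E * u0 x}.
  apply: filterS MC => x Mx a l l0 xQ; rewrite -average_cube//.
  by apply: le_trans Mx; exact: avgM.
pose Z : set T := [set x | u0 x <= 0].
have mZ : measurable Z.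
  by have := emeasurable_fun_infty_c measurableT (nnm_measurable nu0) 0; rewrite setTI.
have [Z0|Z0] := eqVneq (leb Z) 0; last first.
  left; move: MC' => [N [mN N0 HN]].
  have [y [yZ yN]] : exists y, Z y /\ ~ N y.
    apply: contrapT => H; move/negP: Z0; apply.
    rewrite eq_le measure_ge0 andbT -N0; apply: le_measure; rewrite ?inE// => y yZ.
    by apply: contrapT => yN; apply: H; exists y.
  have u0y : u0 y = 0 by apply/eqP; rewrite eq_le yZ u_ge0.
  apply: ae_on_cubes => a l l0; have [a' [l' [l'0 sub yQ]]] := cube_enlarge a y l0.
  have IE : \int[leb]_(x in (cube a' l' : set T)) u0 x = 0.
    have : ((@vol R n l')^-1)%:E * \int[leb]_(x in (cube a' l' : set T)) u0 x <= C%:E * u0 y.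
      by apply: contrapT => H; apply: yN; apply: HN => /= H'; apply: H; exact: H'.
    rewrite u0y mule0 lee_pdivrMl ?vol_gt0// mule0 => H.
    by apply/eqP; rewrite eq_le H nnm_int_ge0.
  have := nnm_int_eq0_ae (@measurable_cube R n a' l') nu0 IE.
  by apply: filterS => x Hx xQ; apply: Hx; exact: sub.
right; have [u [pu uE]] := positive_representative nu0 (ae_zero_or_pos nu0 fin Z0).
(* [C] is an arbitrary real in the definition; the maximum with 1 makes the constant positive. *)
pose K := Num.max 1%R C; exists K, u; split => //.
have K1 : (1 <= K)%R by rewrite le_max lexx.
split; [exact: pu|exact: lt_le_trans K1|move=> a l l0].
have v0 := vol_gt0 c_gt0 l0.
have uI : \int[leb]_(x in (cube a l : set T)) u0 x = \int[leb]_(x in (cube a l : set T)) (u x)%:E.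
  by apply: nnm_eq_ae_int => //; [exact: measurable_cube|exact: positive_weight_nnm].
have [I I0 IE] := ltey_EFin (nnm_int_ge0 leb (cube a l : set T) nu0) (fin a l l0).
have Igt0 : (0 < I)%R.
  rewrite -lte_fin -IE uI; apply: int_weight_gt0 => //; first exact: measurable_cube.
  by rewrite leb_cubeE// lte_fin.
exists (I / @vol R n l)%R; split; first exact: divr_gt0.
  by rewrite /avgle -uI IE divfK// gt_eqF.
apply: filterS2 uE MC' => x ux Hx xQ; have := Hx a l l0 xQ.
rewrite ux IE -!EFinM lee_fin mulrC => /le_trans; apply.
by rewrite ler_pM2r ?weight_gt0// le_max lexx orbT.
Qed.

End representatives.

(** * Extrapolation *)

Section extrapolation.
Context {R : realType} {n : nat}.
Local Notation T := (Rn R n.+1).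
Local Notation leb := (@leb R n).
Local Notation c := (@unit_cube_vol R n).
Implicit Types (x y : T) (p q : R) (w : T -> R) (f g : T -> \bar R)
  (F : set ((T -> \bar R) * (T -> \bar R))).
Hypothesis c_gt0 : (0 < c)%R.

Lemma geometric_sum_le (q : R) N : (0 <= q < 1)%R -> (\sum_(k < N) q ^+ k <= (1 - q)^-1)%R.
Proof.
move=> /andP[q0 q1]; have q1' : (0 < 1 - q)%R by rewrite subr_gt0.
rewrite -[leRHS]mul1r ler_pdivlMr// mulrC -opprB mulNr -subrX1 opprB.
by rewrite gerBl exprn_ge0.
Qed.

Lemma geometric_nneseries_le (q : R) (a : nat -> \bar R) (m : \bar R) :
  (0 <= q < 1)%R -> (forall k, 0 <= a k <= m) ->
  \sum_(k <oo) ((q ^+ k)%:E * a k) <= ((1 - q)^-1)%:E * m.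
Proof.
move=> q01 am; have m0 : 0 <= m by have /andP[h1 h2] := am 0%N; exact: le_trans h2.
have /andP[q0 _] := q01.
have h0 k : 0 <= (q ^+ k)%:E :> \bar R by rewrite lee_fin exprn_ge0.
apply: lime_le.
  by apply: is_cvg_nneseries => k _ _; apply: mule_ge0 => //; have /andP[] := am k.
apply: nearW => N; rewrite big_mkord.
apply: (@le_trans _ _ (\sum_(k < N) ((q ^+ k)%:E * m))).
  by apply: lee_sum => k _; apply: lee_wpmul2l => //; have /andP[] := am k.
rewrite -ge0_sume_distrl; last by move=> k _; exact: h0.
by apply: lee_wpmul2r => //; rewrite sumEFin lee_fin geometric_sum_le.
Qed.

Lemma half_nneseries_le (a : nat -> \bar R) (m : \bar R) :
  (forall k, 0 <= a k <= m) -> \sum_(k <oo) ((2^-1 ^+ k)%:E * a k) <= 2%:E * m.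
Proof.
have -> : (2 = (1 - 2^-1)^-1 :> R)%R by field.
have -> : ((1 - 2^-1)^-1^-1 = 2^-1 :> R)%R by field.
by apply: geometric_nneseries_le; lra.
Qed.

Lemma nneseries_term_le (a : nat -> \bar R) k : (forall k, 0 <= a k) ->
  a k <= \sum_(i <oo) a i.
Proof.
move=> a0; apply: le_trans (@nneseries_lim_ge R a xpredT 0 k.+1 (fun i _ _ => a0 i)).
by rewrite big_mkord (bigD1 ord_max)//= leeDl// sume_ge0.
Qed.

(** The power [s >= 1] of the supremum is at most [sum_k 2^(-ks) psi_k^s], hence at most
    [sum_k 2^-k psi_k^s]. As the supremum dominates every [2^-k psi_k], one function serves all
    pairs. *)
Lemma sup_geometric_int (psi : nat -> T -> \bar R) (s : R) (m : \bar R) (om : T -> R) :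
  (1 <= s)%R -> positive_weight om -> (forall k, nnm (psi k)) ->
  (forall k, \int[leb]_x (psi k x `^ s * (om x)%:E) <= m) ->
  \int[leb]_x (ereal_sup (range (fun k => (2^-1 ^+ k)%:E * psi k x)) `^ s * (om x)%:E)
    <= 2%:E * m.
Proof.
move=> s1 pom npsi psim; have s0 : (0 < s)%R by lra.
have nom := positive_weight_nnm pom.
have h0 k : (0 <= 2^-1 ^+ k :> R)%R by rewrite exprn_ge0.
have h1 k : (2^-1 ^+ k <= 1 :> R)%R by rewrite exprn_ile1// invf_le1// ler1n.
have nterm k : nnm (fun x => (2^-1 ^+ k)%:E * (psi k x `^ s * (om x)%:E)).
  by apply: nnmMl; [rewrite lee_fin|apply: nnmM => //; exact: nnm_pow].
have nsup : nnm (fun x => ereal_sup (range (fun k => (2^-1 ^+ k)%:E * psi k x))).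
  apply: (@nnm_sup _ _ _ (fun k x => (2^-1 ^+ k)%:E * psi k x)) => k.
  by apply: nnmMl => //; rewrite lee_fin.
apply: (@le_trans _ _ (\int[leb]_x (\sum_(k <oo) ((2^-1 ^+ k)%:E * (psi k x `^ s * (om x)%:E))))).
  apply: nnm_le_int => //; [|exact: nnm_series|move=> x _].
    by apply: nnmM => //; exact: nnm_pow.
  have om0 : (0 < om x)%R by exact: weight_gt0.
  set z := \sum_(k <oo) _.
  suff H : ereal_sup (range (fun k => (2^-1 ^+ k)%:E * psi k x)) `^ s <= z * ((om x)^-1)%:E.
    apply: (le_trans (lee_wpmul2r (nnm_ge0 x nom) H)).
    by rewrite -muleA -EFinM mulVf ?mule1// gt_eqF.
  apply: poweR_sup_le => // k; first by rewrite mule_ge0 ?lee_fin// nnm_ge0.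
  rewrite lee_pdivlMr// poweRM ?lee_fin ?nnm_ge0//.
  apply: le_trans (@nneseries_term_le _ k (fun k => nnm_ge0 x (nterm k))).
  rewrite -muleA; apply: lee_wpmul2r.
    by apply: mule_ge0; [exact: poweR_ge0|rewrite lee_fin ltW].
  by rewrite poweR_EFin lee_fin; apply: ge1r_powR => //; rewrite h1 exprn_gt0.
rewrite nnm_int_series//.
apply: le_trans (half_nneseries_le (a := fun k => \int[leb]_x (psi k x `^ s * (om x)%:E)) _).
  apply: lee_nneseries => [k _ _|k _]; first exact: nnm_int_ge0.
  by rewrite nnm_intZ ?lee_fin//; apply: nnmM => //; exact: nnm_pow.
by move=> k; rewrite psim andbT; apply: nnm_int_ge0; apply: nnmM => //; exact: nnm_pow.
Qed.

Definition pairs_nnm F := forall f g, F (f, g) -> nnm f /\ nnm g.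

Definition extrap F p := forall q w, (1 < q)%R -> ApR q w ->
  exists2 C : R, (0 < C)%R & forall f g, F (f, g) ->
    \int[leb]_x (f x `^ p * (w x)%:E) < +oo ->
    \int[leb]_x (f x `^ p * (w x)%:E) <= C%:E * \int[leb]_x (g x `^ p * (w x)%:E).

(** A common factor preserves the inequality and its constant, so a counterexample can be normalized
    to have left-hand side 1. *)
Definition scaled F : set ((T -> \bar R) * (T -> \bar R)) :=
  [set fg | exists (r : R) f g, [/\ (0 < r)%R, F (f, g) &
    fg = ((fun x => r%:E * f x), (fun x => r%:E * g x))]].

Lemma pairs_nnm_scaled F : pairs_nnm F -> pairs_nnm (scaled F).
Proof.
move=> nF f g [r [f' [g' [r0 /nF[nf ng] [-> ->]]]]].
by split; apply: nnmMl => //; rewrite lee_fin ltW.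
Qed.

Lemma int_scale (r p : R) f w : (0 < r)%R -> positive_weight w -> nnm f ->
  \int[leb]_x ((r%:E * f x) `^ p * (w x)%:E) =
  (r `^ p)%:E * \int[leb]_x (f x `^ p * (w x)%:E).
Proof.
move=> r0 pw nf; rewrite -nnm_intZ//; last 2 first.
- by rewrite lee_fin powR_ge0.
- by apply: nnmM; [exact: nnm_pow|exact: positive_weight_nnm].
apply: eq_integral => x _; rewrite poweRM ?lee_fin ?(ltW r0)//; last exact: nnm_ge0.
by rewrite muleA.
Qed.

Lemma extrap_scaled F p : pairs_nnm F -> extrap F p -> extrap (scaled F) p.
Proof.
move=> nF H q w q1 Aw; have [C C0 HC] := H q w q1 Aw; have [pw _] := Aw.
exists C => // f g [r [f' [g' [r0 Ffg [-> ->]]]]]; have [nf ng] := nF _ _ Ffg.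
have rp0 : (0 < r `^ p)%R by exact: powR_gt0.
rewrite !int_scale// => fin.
rewrite muleCA; apply: lee_wpmul2l; first by rewrite lee_fin ltW.
have nfw : nnm (fun x => f' x `^ p * (w x)%:E).
  by apply: nnmM; [exact: nnm_pow|exact: positive_weight_nnm].
apply: HC => //; have := nnm_int_ge0 leb setT nfw.
move: fin; move: (\int[leb]_x _) => I; case: I => [s _ _| |//]; first exact: ltry.
by rewrite gt0_muley ?lte_fin.
Qed.

(* Nothing is known about how the constant in [extrap] depends on the weight, so a
   whole sequence of failing pairs has to be refuted by a single weight. *)
Lemma extrap_by_contradiction F p w (rho : nat -> R) : (0 < p)%R -> pairs_nnm F ->
  positive_weight w -> (forall k, 0 < rho k)%R ->
  (forall f_ g_ : nat -> T -> \bar R, (forall k, scaled F (f_ k, g_ k)) ->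
    (forall k, \int[leb]_x (f_ k x `^ p * (w x)%:E) = 1) ->
    (forall k, \int[leb]_x (g_ k x `^ p * (w x)%:E) <= ((rho k)^-1)%:E) -> False) ->
  exists2 C : R, (0 < C)%R & forall f g, F (f, g) ->
    \int[leb]_x (f x `^ p * (w x)%:E) < +oo ->
    \int[leb]_x (f x `^ p * (w x)%:E) <= C%:E * \int[leb]_x (g x `^ p * (w x)%:E).
Proof.
move=> p0 nF pw rho0 H; apply: contrapT => Hn.
have nw := positive_weight_nnm pw.
have P k : exists fg : (T -> \bar R) * (T -> \bar R), [/\ scaled F fg,
    \int[leb]_x (fg.1 x `^ p * (w x)%:E) = 1 &
    \int[leb]_x (fg.2 x `^ p * (w x)%:E) <= ((rho k)^-1)%:E].
  apply: contrapT => Hk; apply: Hn; exists (rho k) => // f g Ffg fin.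
  rewrite leNgt; apply/negP => lt; apply: Hk.
  have [nf ng] := nF _ _ Ffg.
  have nfw : nnm (fun x => f x `^ p * (w x)%:E) by apply: nnmM => //; exact: nnm_pow.
  have ngw : nnm (fun x => g x `^ p * (w x)%:E) by apply: nnmM => //; exact: nnm_pow.
  have [I I0 IE] := ltey_EFin (nnm_int_ge0 leb setT nfw) fin.
  have Igt0 : (0 < I)%R.
    rewrite -lte_fin -IE; apply: le_lt_trans lt.
    by rewrite mule_ge0 ?lee_fin ?(ltW (rho0 k))//; exact: nnm_int_ge0.
  pose r := (I `^ (- p^-1))%R.
  have r0 : (0 < r)%R by exact: powR_gt0.
  have rp : (r `^ p = I^-1)%R.
    by rewrite /r -powRrM mulNr mulVf ?gt_eqF// powR_inv1// ltW.
  exists ((fun x => r%:E * f x), (fun x => r%:E * g x)); split.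
  - by exists r, f, g.
  - by rewrite /= int_scale// IE rp -EFinM mulVf// gt_eqF.
  rewrite /= int_scale// rp lee_pdivrMl//.
  rewrite -[leLHS](@EFinK_mule _ (rho k)) ?gt_eqF//.
  rewrite -EFinM mulrC EFinM; apply: lee_wpmul2l; first by rewrite lee_fin invr_ge0 ltW.
  by rewrite -IE ltW.
have {P}[fg fgP] := choice P.
apply: (H (fun k => (fg k).1) (fun k => (fg k).2)) => k.
- by rewrite -surjective_pairing; have [] := fgP k.
- by have [] := fgP k.
- by have [] := fgP k.
Qed.

Lemma not_all_pow2_le (C : R) : ~ forall k, (2 ^+ k <= C)%R.
Proof.
move=> H; have C0 : (0 <= C)%R by apply: le_trans (H 0%N); rewrite expr0.
have := H (Num.trunc C).+1; apply/negP; rewrite -ltNge.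
apply: (lt_le_trans (truncnS_gt C)); rewrite -natrX ler_nat.
by apply: ltnW; exact: ltn_expl.
Qed.

Lemma leb_setT_gt0 : 0 < leb setT.
Proof.
apply: (@lt_le_trans _ _ (leb (cube 0%R 1%R : set T))); last exact: le_leb_outer.
by rewrite leb_cubeE ?ltr01// lte_fin vol_gt0.
Qed.

Lemma ae_exists (P : T -> Prop) : {ae leb, forall x, P x} -> exists x, P x.
Proof.
move=> [N [mN N0 NP]]; apply: contrapT => H.
suff : leb setT <= 0 by rewrite leNgt leb_setT_gt0.
rewrite -N0; apply: le_leb_outer.
by move=> x _; apply: NP => /= Px; apply: H; exists x.
Qed.

(** The integral bound makes the majorant finite somewhere, and it does not vanish almost everywhere
    because [h] does not; [everywhere_A1R] then turns it into an A_1 weight. *)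
Lemma rdf_A1R (s : R) (om : T -> R) h (m : R) : (1 < s)%R -> ApR s om -> nnm h ->
  \int[leb]_x (h x `^ s * (om x)%:E) <= m%:E -> ~ {ae leb, forall x, h x = 0} ->
  exists K V, [/\ A1R K V, {ae leb, forall x, h x <= (V x)%:E} &
    \int[leb]_x (((V x) `^ s)%:E * (om x)%:E) <= (2 * m)%:E].
Proof.
move=> s1 Aom nh hm hn0; have [pom _] := Aom; have nom := positive_weight_nnm pom.
have s0 : (0 < s)%R by lra.
have [B B0 BP] := muckenhoupt c_gt0 s1 Aom.
pose L : R * (T -> R) -> Prop := fun z => z = (s, om).
have LP s' om' : L (s', om') -> [/\ (1 < s')%R, positive_weight om' &
     forall t f, nnm f -> \int[leb]_x (M t f x `^ s' * (om' x)%:E) <=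
                   B%:E * \int[leb]_x (f x `^ s' * (om' x)%:E)].
  by move=> [-> ->]; split.
have [K K0 KP] := rubio_de_francia_cubes c_gt0 B0 LP.
have [H [nH hH HA HL]] := KP h nh.
have nHs : nnm (fun x => H x `^ s * (om x)%:E) by apply: nnmM => //; exact: nnm_pow.
have Hm : \int[leb]_x (H x `^ s * (om x)%:E) <= (2 * m)%:E.
  apply: (le_trans (HL s om erefl)); rewrite EFinM.
  by apply: lee_wpmul2l; rewrite ?lee_fin.
have Hfin : exists x, H x < +oo.
  have := nnm_int_fin_ae measurableT nHs (le_lt_trans Hm (ltry _)).
  move=> /ae_exists[x /(_ I)]; have om0 : (0 < om x)%R by exact: weight_gt0.
  move=> Hx; exists x; rewrite ltey; apply/eqP => Hoo; move: Hx.
  by rewrite Hoo poweRyr ?gt_eqF// gt0_mulye.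
have Hn0 : ~ {ae leb, forall x, H x = 0}.
  move=> H0; apply: hn0; apply: filterS H0 => x Hx.
  by apply/eqP; rewrite eq_le (nnm_ge0 x nh) andbT -Hx.
have [V [AV HV Hpos]] := everywhere_A1R c_gt0 nH K0 HA Hfin Hn0.
exists K, V; split => //.
  by apply: filterS HV => x <-.
rewrite (_ : \int[leb]_x _ = \int[leb]_x (H x `^ s * (om x)%:E))//.
have [pV _ _] := AV.
apply: nnm_eq_ae_int => //.
  by apply: nnmM => //; apply: positive_weight_nnm; exact: positive_weight_pow.
by apply: filterS HV => x ->.
Qed.

Lemma int_eq1_not_ae0 (s : R) f w (g : T -> \bar R) :
  \int[leb]_x (f x `^ s * (w x)%:E) = 1 -> nnm f -> positive_weight w -> (s != 0)%R ->
  (forall x, g x = 0 -> f x = 0) -> ~ {ae leb, forall x, g x = 0}.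
Proof.
move=> f1 nf pw s0 gf g0.
suff : \int[leb]_x (f x `^ s * (w x)%:E) = 0 by rewrite f1 => /eqP; rewrite onee_eq0.
rewrite -(integral0 leb (@setT T)).
apply: (nnm_eq_ae_int (g := cst 0)); [exact: measurableT| |exact: nnm_cst|].
  by apply: nnmM; [exact: nnm_pow|exact: positive_weight_nnm].
by apply: filterS g0 => x /gf ->; rewrite poweR0r// mul0e.
Qed.

(** Duality: [int f^(pq) w] pairs [f^p] with [psi = f^(p(q-1)) w], which lies in [L^s] of the dual
    weight [om]. An A_1 majorant [W] of all [2^-k psi_k] takes the place of [psi], the hypothesis
    passes from [f] to [g], and Hölder's inequality leads back to [g^(pq) w]. *)
Lemma extrap_up F p q w : (0 < p)%R -> (1 < q)%R -> pairs_nnm F -> extrap F p ->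
  ApR q w -> exists2 C : R, (0 < C)%R & forall f g, F (f, g) ->
    \int[leb]_x (f x `^ (p * q) * (w x)%:E) < +oo ->
    \int[leb]_x (f x `^ (p * q) * (w x)%:E) <=
      C%:E * \int[leb]_x (g x `^ (p * q) * (w x)%:E).
Proof.
move=> p0 q1 nF /(extrap_scaled nF) EF Aw; have [pw _] := Aw.
have q0 : (0 < q)%R by lra. have q10 : (0 < q - 1)%R by lra.
have pq0 : (0 < p * q)%R by exact: mulr_gt0.
(* The [q]-th root taken by Hölder's inequality leaves [4^-k] for [g_k], which beats the factor
   [2^-k] lost by [f_k] in the gluing. *)
apply: (@extrap_by_contradiction _ _ _ (fun k => (4 ^+ k) `^ q)%R) => //.
move=> f g Ffg fE gE; have nFs := pairs_nnm_scaled nF.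
have nf k : nnm (f k) by have [] := nFs _ _ (Ffg k).
have ng k : nnm (g k) by have [] := nFs _ _ (Ffg k).
have nw := positive_weight_nnm pw.
have w0 x : (0 < w x)%R by exact: weight_gt0.
pose s := (q / (q - 1))%R; pose om x := (w x `^ (- (q - 1)^-1))%R.
have s1 : (1 < s)%R by rewrite ltr_pdivlMr//; lra.
have s0 : (0 < s)%R by lra.
have Aom : ApR s om by exact: ApR_dual.
have [pom _] := Aom; have nom := positive_weight_nnm pom.
pose psi k x := f k x `^ (p * (q - 1)) * (w x)%:E.
have npsi k : nnm (psi k) by apply: nnmM => //; exact: nnm_pow.
have psiE k x : psi k x `^ s * (om x)%:E = f k x `^ (p * q) * (w x)%:E.
  rewrite /psi poweRM ?poweR_ge0 ?lee_fin ?(ltW (w0 x))// -poweRrM -muleA.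
  rewrite (_ : p * (q - 1) * s = p * q)%R; last by rewrite /s; field; rewrite gt_eqF.
  congr (_ * _); rewrite poweR_EFin -EFinM -powRD; last by apply/implyP => _; rewrite gt_eqF.
  by rewrite (_ : s + - (q - 1)^-1 = 1)%R ?powRr1 ?(ltW (w0 x))// /s; field; rewrite gt_eqF.
pose h x := ereal_sup (range (fun k => (2^-1 ^+ k)%:E * psi k x)).
have nh : nnm h.
  apply: (@nnm_sup _ _ _ (fun k x => (2^-1 ^+ k)%:E * psi k x)) => k.
  by apply: nnmMl => //; rewrite lee_fin exprn_ge0.
have hm : \int[leb]_x (h x `^ s * (om x)%:E) <= 2%:E.
  rewrite -[leRHS]mule1; apply: sup_geometric_int => //; first exact: ltW.
  by move=> k; under eq_integral do rewrite psiE; rewrite fE.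
have psih k x : (2^-1 ^+ k)%:E * psi k x <= h x.
  by apply: ereal_sup_ubound; exists k.
have hn0 : ~ {ae leb, forall x, h x = 0}.
  apply: (int_eq1_not_ae0 (fE 0%N)) => //; first by rewrite gt_eqF.
  move=> x hx; have := psih 0%N x; rewrite expr0 mul1e hx => psi0.
  have : psi 0%N x == 0 by rewrite eq_le psi0 nnm_ge0.
  rewrite /psi mule_eq0 => /orP[|]; last by rewrite eqe gt_eqF.
  by rewrite poweR_eq0 ?nnm_ge0// => /andP[/eqP].
have [K [W [AW hW Wm]]] := rdf_A1R s1 Aom nh hm hn0.
have [pW _ _] := AW; have nW := positive_weight_nnm pW.
have two1 : (1 < 2 :> R)%R by rewrite ltr1n.
have [C C0 HC] := EF 2%R W two1 (A1R_ApR2 AW).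
have ql01 : (0 < q^-1 < 1)%R by rewrite invr_gt0 q0/= invf_lt1.
have upper (k : nat) (a : R) (fk : T -> \bar R) : (0 < a)%R -> nnm fk ->
    \int[leb]_x (fk x `^ (p * q) * (w x)%:E) <= a%:E ->
    \int[leb]_x (fk x `^ p * (W x)%:E) <= (a `^ q^-1 * 4 `^ (1 - q^-1))%:E.
  move=> a0 nfk fka.
  have W4 : \int[leb]_x (((W x) `^ s)%:E * (om x)%:E) <= 4%:E.
    by apply: (le_trans Wm); rewrite lee_fin -natrM.
  have n1 : nnm (fun x => fk x `^ (p * q) * (w x)%:E) by apply: nnmM => //; exact: nnm_pow.
  have n2 : nnm (fun x => (W x `^ s)%:E * (om x)%:E).
    by apply: nnmM => //; apply: positive_weight_nnm; exact: positive_weight_pow.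
  have := holder_le measurableT n1 n2 ql01 a0 (ltr0n R 4) fka W4.
  congr (_ <= _); apply: eq_integral => x _.
  rewrite poweRM ?poweR_ge0 ?lee_fin ?(ltW (w0 x))// -poweRrM mulfK ?gt_eqF//.
  rewrite -muleA; congr (_ * _); rewrite -EFinM; congr EFin.
  have W0 : (0 < W x)%R by exact: weight_gt0.
  rewrite (powRM _ (powR_ge0 _ _) (powR_ge0 _ _)) /om -!(powRrM (W x)) -!(powRrM (w x)).
  rewrite (_ : s * (1 - q^-1) = 1)%R; last by rewrite /s; field; rewrite !gt_eqF.
  rewrite powRr1 ?(ltW W0)// mulrCA -powRD; last by apply/implyP => _; rewrite gt_eqF.
  by rewrite (_ : _ + _ = 0)%R ?powRr0 ?mulr1//; field; rewrite !gt_eqF.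
apply: (@not_all_pow2_le (C * 4 `^ (1 - q^-1))) => k.
have two_k : (0 < 2 ^+ k :> R)%R by exact: exprn_gt0.
have four_k : (0 < 4 ^+ k :> R)%R by exact: exprn_gt0.
have lower : ((2 ^+ k)^-1)%:E <= \int[leb]_x (f k x `^ p * (W x)%:E).
  rewrite -[leLHS]mule1 -(fE k) -exprVn -nnm_intZ ?lee_fin ?exprn_ge0//; last first.
    by apply: nnmM => //; exact: nnm_pow.
  apply: nnm_le_ae_int => //.
  - by apply: nnmMl; [rewrite lee_fin exprn_ge0|apply: nnmM => //; exact: nnm_pow].
  - by apply: nnmM => //; exact: nnm_pow.
  apply: filterS hW => x hW _.
  apply: (@le_trans _ _ (f k x `^ p * ((2^-1 ^+ k)%:E * psi k x))).
    rewrite /psi (muleCA (f k x `^ p)); apply: lee_wpmul2l; first by rewrite lee_fin exprn_ge0.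
    rewrite muleA -poweRD_gt0 ?mulr_gt0//.
    by rewrite (_ : p + p * (q - 1) = p * q)%R//; ring.
  by apply: lee_wpmul2l; [exact: poweR_ge0|exact: le_trans (psih k x) hW].
have fin : \int[leb]_x (f k x `^ p * (W x)%:E) < +oo.
  apply: le_lt_trans (upper k 1%R (f k) ltr01 (nf k) _) (ltry _).
  by rewrite fE.
have rho0 : (0 < ((4 ^+ k) `^ q)^-1 :> R)%R by rewrite invr_gt0 powR_gt0.
have := le_trans lower (le_trans (HC _ _ (Ffg k) fin)
  (lee_wpmul2l (ltW C0 : 0 <= C%:E) (upper k _ _ rho0 (ng k) (gE k)))).
rewrite -EFinM lee_fin -powRN -powRrM mulNr divff ?gt_eqF// powR_inv1 ?(ltW four_k)//.
rewrite mulrCA => H.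
have : ((4 ^+ k)^-1 = (2 ^+ k)^-1 * (2 ^+ k)^-1 :> R)%R.
  by rewrite -invfM -exprMn -natrM.
move=> E; move: H; rewrite E -mulrA -[leLHS]mulr1 ler_pM2l ?invr_gt0//.
by rewrite ler_pdivlMl// mulr1.
Qed.

(** Let [V] be an A_1 majorant of the functions [2^-k max(f_k, g_k)^(p/q)] and [W = w V^-b]. Then
    [f_k^p0 W <= 2^(kb) f_k^p w] almost everywhere, likewise for [g_k], and Hölder's inequality with
    [V^q w] recovers [int f_k^p w] from [int f_k^p0 W]. *)
Lemma extrap_down F p0 p : (0 < p < p0)%R -> pairs_nnm F -> extrap F p0 -> extrap F p.
Proof.
move=> /andP[p_gt0 pp0] nF /(extrap_scaled nF) EF q w q1 Aw; have [pw _] := Aw.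
have p00 : (0 < p0)%R by exact: lt_trans pp0.
have q0 : (0 < q)%R by lra.
pose tau := (p / q)%R; have tau0 : (0 < tau)%R by exact: divr_gt0.
pose b := ((p0 - p) / tau)%R; have b0 : (0 < b)%R by rewrite divr_gt0// subr_gt0.
pose lam := (p / p0)%R.
have lam01 : (0 < lam < 1)%R by rewrite divr_gt0//= ltr_pdivrMr// mul1r.
have /andP[lam0 lam1] := lam01.
(* The part [b] of the exponent compensates the loss [2^(kb)] in passing from [w] to [W]; the part
   [1/lam] leaves [2^-k] after the power [lam] in Hölder's inequality. *)
have rho0 k : (0 < (2 ^+ k) `^ (b + lam^-1) :> R)%R by rewrite powR_gt0// exprn_gt0.
apply: (@extrap_by_contradiction _ _ _ (fun k => (2 ^+ k) `^ (b + lam^-1))%R) => //.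
move=> f g Ffg fE gE; have nFs := pairs_nnm_scaled nF.
have nf k : nnm (f k) by have [] := nFs _ _ (Ffg k).
have ng k : nnm (g k) by have [] := nFs _ _ (Ffg k).
have nw := positive_weight_nnm pw.
have w0 x : (0 < w x)%R by exact: weight_gt0.
(* Having [f] under the maximum makes [int f^p0 W] finite, as the hypothesis demands; having [g]
   there bounds the right-hand side. *)
pose psi k x := (maxe (f k x) (g k x)) `^ tau.
have npsi k : nnm (psi k) by apply: nnm_pow; exact: nnm_max.
pose h x := ereal_sup (range (fun k => (2^-1 ^+ k)%:E * psi k x)).
have nh : nnm h.
  apply: (@nnm_sup _ _ _ (fun k x => (2^-1 ^+ k)%:E * psi k x)) => k.
  by apply: nnmMl => //; rewrite lee_fin exprn_ge0.
have tq : (tau * q = p)%R by rewrite /tau divfK// gt_eqF.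
have hm : \int[leb]_x (h x `^ q * (w x)%:E) <= 4%:E.
  rewrite (_ : 4%:E = 2%:E * 2%:E :> \bar R); last by rewrite -EFinM -natrM.
  apply: sup_geometric_int => //; first exact: ltW.
  move=> k; rewrite /psi; under eq_integral do rewrite -poweRrM tq.
  apply: (@le_trans _ _ (\int[leb]_x (f k x `^ p * (w x)%:E + g k x `^ p * (w x)%:E))).
    apply: nnm_le_int => //.
    - by apply: nnmM => //; apply: nnm_pow; exact: nnm_max.
    - by apply: nnmD; apply: nnmM => //; exact: nnm_pow.
    move=> x _; rewrite -ge0_muleDl ?poweR_ge0//; apply: lee_wpmul2r; first exact: (nnm_ge0 x nw).
    by apply: poweR_maxe; [exact: ltW|exact: nnm_ge0|exact: nnm_ge0].
  rewrite nnm_intD//; [|by apply: nnmM => //; exact: nnm_pow..].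
  rewrite fE (_ : 2%:E = 1 + 1 :> \bar R)%E; last by rewrite -EFinD.
  apply: leeD => //; apply: (le_trans (gE k)); rewrite lee_fin invf_le1//.
  rewrite -[leLHS](powRr0 (2 ^+ k)); apply: ler_powR; last by rewrite addr_ge0 ?invr_ge0 ?(ltW b0) ?(ltW lam0).
  by rewrite exprn_ege1// ler1n.
have psih k x : (2^-1 ^+ k)%:E * psi k x <= h x.
  by apply: ereal_sup_ubound; exists k.
have fpsi k x : f k x `^ tau <= psi k x.
  by apply: le_poweR2r; [exact: ltW|exact: nnm_ge0|rewrite le_max lexx].
have gpsi k x : g k x `^ tau <= psi k x.
  by apply: le_poweR2r; [exact: ltW|exact: nnm_ge0|rewrite le_max lexx orbT].
have hn0 : ~ {ae leb, forall x, h x = 0}.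
  apply: (int_eq1_not_ae0 (fE 0%N)) => //; first by rewrite gt_eqF.
  move=> x hx; have := psih 0%N x; rewrite expr0 mul1e hx => psi0.
  have := le_trans (fpsi 0%N x) psi0; move=> f0.
  have : f 0%N x `^ tau = 0 by apply/eqP; rewrite eq_le f0 poweR_ge0.
  by apply: poweR_eq0_eq0; exact: (nnm_ge0 x (nf 0%N)).
have [K [V [AV hV Vm]]] := rdf_A1R q1 Aw nh hm hn0.
have [pV _ _] := AV; have nV := positive_weight_nnm pV.
have V0 x : (0 < V x)%R by exact: weight_gt0.
pose W x := (w x * V x `^ (- b))%R.
have AW : ApR (q + b) W by exact (ApR_A1R_mul c_gt0 q1 b0 AV Aw).
have [pW _] := AW; have nW := positive_weight_nnm pW.
have qb1 : (1 < q + b)%R by lra.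
have [C C0 HC] := EF (q + b)%R W qb1 AW.
have upper k (fk : T -> \bar R) (a : \bar R) : nnm fk ->
    (forall x, fk x `^ tau <= psi k x) ->
    \int[leb]_x (fk x `^ p * (w x)%:E) <= a ->
    \int[leb]_x (fk x `^ p0 * (W x)%:E) <= ((2 ^+ k) `^ b)%:E * a.
  move=> nfk fkpsi fka.
  apply: (@le_trans _ _ (((2 ^+ k) `^ b)%:E * \int[leb]_x (fk x `^ p * (w x)%:E))); last first.
    by apply: lee_wpmul2l => //; rewrite lee_fin powR_ge0.
  have n1 : nnm (fun x => fk x `^ p * (w x)%:E) by apply: nnmM => //; exact: nnm_pow.
  rewrite -nnm_intZ ?lee_fin ?powR_ge0//; apply: nnm_le_ae_int => //.
  - by apply: nnmM => //; exact: nnm_pow.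
  - by apply: nnmMl => //; rewrite lee_fin powR_ge0.
  apply: filterS hV => x hV _.
  have k0 : (0 < 2 ^+ k :> R)%R by exact: exprn_gt0.
  have fkV : fk x `^ tau <= (2 ^+ k * V x)%:E.
    apply: (le_trans (fkpsi x)); rewrite EFinM -lee_pdivrMl//.
    by rewrite -exprVn; exact: le_trans (psih k x) hV.
  have fkV' : fk x `^ (p0 - p) <= ((2 ^+ k) `^ b * V x `^ b)%:E.
    have -> : (p0 - p = tau * b)%R by rewrite /b mulrC divfK// gt_eqF.
    rewrite poweRrM -powRM ?(ltW k0) ?(ltW (V0 x))// -poweR_EFin.
    by apply: le_poweR2r => //; [exact: ltW|exact: poweR_ge0].
  have -> : fk x `^ p0 = fk x `^ p * fk x `^ (p0 - p).
    by rewrite -poweRD_gt0 ?subr_gt0//; congr (_ `^ _); ring.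
  rewrite muleCA -muleA; apply: lee_wpmul2l; first exact: poweR_ge0.
  have WE : (W x)%:E = (V x `^ (- b))%:E * (w x)%:E by rewrite -EFinM mulrC.
  rewrite WE muleA; apply: lee_wpmul2r; first exact: (nnm_ge0 x nw).
  apply: (le_trans (lee_wpmul2r _ fkV')); first by rewrite lee_fin powR_ge0.
  rewrite -EFinM lee_fin -mulrA -powRD; last by apply/implyP => _; rewrite gt_eqF.
  by rewrite subrr powRr0 mulr1.
apply: (@not_all_pow2_le (C `^ lam * 8 `^ (1 - lam))) => k.
have k0 : (0 < 2 ^+ k :> R)%R by exact: exprn_gt0.
have fin : \int[leb]_x (f k x `^ p0 * (W x)%:E) < +oo.
  apply: le_lt_trans (upper k (f k) 1 (nf k) (fpsi k) _) _; first by rewrite fE.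
  by rewrite mule1 ltry.
pose a := (C * (2 ^+ k) `^ (- lam^-1))%R.
have a0 : (0 < a)%R by rewrite mulr_gt0// powR_gt0.
have fa : \int[leb]_x (f k x `^ p0 * (W x)%:E) <= a%:E.
  apply: (le_trans (HC _ _ (Ffg k) fin)).
  apply: (le_trans (lee_wpmul2l (ltW C0 : 0 <= C%:E) (upper k (g k) _ (ng k) (gpsi k) (gE k)))).
  rewrite -!EFinM lee_fin /a ler_pM2l// -powRN -powRD; last by apply/implyP => _; rewrite gt_eqF.
  by rewrite opprD addNKr.
have V8 : \int[leb]_x ((V x `^ q)%:E * (w x)%:E) <= 8%:E.
  by apply: (le_trans Vm); rewrite lee_fin -natrM.
have n1 : nnm (fun x => f k x `^ p0 * (W x)%:E) by apply: nnmM => //; exact: nnm_pow.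
have n2 : nnm (fun x => (V x `^ q)%:E * (w x)%:E).
  by apply: nnmM => //; apply: positive_weight_nnm; exact: positive_weight_pow.
have := holder_le measurableT n1 n2 lam01 a0 (ltr0n R 8) fa V8.
have -> : \int[leb]_x ((f k x `^ p0 * (W x)%:E) `^ lam * ((V x `^ q)%:E * (w x)%:E) `^ (1 - lam))
    = \int[leb]_x (f k x `^ p * (w x)%:E).
  apply: eq_integral => x _; have W0 : (0 < W x)%R by exact: weight_gt0.
  rewrite (poweRM _ (poweR_ge0 _ _)) ?lee_fin ?(ltW W0)// -poweRrM.
  rewrite (_ : p0 * lam = p)%R; last by rewrite /lam mulrC divfK// gt_eqF.
  rewrite -muleA; congr (_ * _); rewrite -EFinM; congr EFin.
  rewrite /W (powRM _ (ltW (w0 x)) (powR_ge0 _ _)) (powRM _ (powR_ge0 _ _) (ltW (w0 x))).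
  rewrite -!(powRrM (V x)) mulrA -(mulrA (w x `^ lam)%R) -powRD; last first.
    by apply/implyP => _; rewrite gt_eqF.
  rewrite (_ : - b * lam + q * (1 - lam) = 0)%R; last first.
    by rewrite /b /lam /tau; field; rewrite !gt_eqF.
  rewrite powRr0 mulr1 -powRD; last by apply/implyP => _; rewrite gt_eqF.
  by rewrite addrC subrK powRr1 ?(ltW (w0 x)).
rewrite fE lee_fin /a powRM ?powR_ge0 ?(ltW C0)// -powRrM mulNr mulVf ?gt_eqF//.
rewrite powR_inv1 ?(ltW k0)// mulrAC ler_pdivlMr// mul1r.
by [].
Qed.

(** Descend to [p / q' < p0], then climb by the factor [q'], which may be as large as desired
    because the classes A_q increase with [q]. *)
Theorem extrapolation F p0 p : (0 < p0)%R -> (0 < p)%R -> pairs_nnm F ->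
  extrap F p0 -> extrap F p.
Proof.
move=> p00 p_gt0 nF EF q w q1 Aw.
pose q' := (Num.max q (p / p0) + 1)%R.
have qq' : (q < q')%R by rewrite ltr_pwDr// le_max lexx.
have q'1 : (1 < q')%R by exact: lt_trans qq'.
have q'0 : (0 < q')%R by lra.
have pq' : (p / p0 < q')%R by rewrite ltr_pwDr// le_max lexx orbT.
have p1 : (0 < p / q' < p0)%R.
  by rewrite divr_gt0//= ltr_pdivrMr// mulrC -ltr_pdivrMr.
have /andP[p10 _] := p1.
have := extrap_up p10 q'1 nF (extrap_down p1 nF EF) (ApR_mono c_gt0 q1 qq' Aw).
by rewrite divfK// gt_eqF.
Qed.

End extrapolation.

(** * The weak-type inequality *)

Section weak_pairing.
Context {R : realType} {n : nat}.
Local Notation T := (Rn R n.+1).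
Local Notation leb := (@leb R n).
Implicit Types (x : T) (G H : T -> \bar R) (rho : T -> R).

Definition superlevel G (t : R) : set T := [set x | t%:E < G x].

Lemma measurable_superlevel G (t : R) : nnm G -> measurable (superlevel G t).
Proof.
by move=> nG; have := emeasurable_fun_o_infty measurableT (nnm_measurable nG) t%:E; rewrite setTI.
Qed.

Lemma young_conj (s : R) (a b : \bar R) : (1 < s)%R -> 0 <= a -> 0 <= b ->
  a * b <= a `^ s + b `^ (s / (s - 1)).
Proof.
move=> s1 a0 b0; have s0 : (0 < s)%R by lra. have s10 : (0 < s - 1)%R by lra.
have l01 : (0 < s^-1 < 1)%R by rewrite invr_gt0 s0/= invf_lt1.
have /andP[l0 l1] := l01.
have := young_poweR l01 (poweR_ge0 a s) (poweR_ge0 b (s / (s - 1))).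
rewrite -!poweRrM divff ?gt_eqF// poweRe1//.
rewrite (_ : s / (s - 1) * (1 - s^-1) = 1)%R; last by field; rewrite !gt_eqF.
rewrite poweRe1// => /le_trans; apply; apply: leeD; rewrite -[leRHS]mul1e;
  apply: lee_wpmul2r; rewrite ?poweR_ge0// lee_fin; lra.
Qed.

(** A discrete layer-cake sum. It bounds powers of [G] by indicators of superlevel sets, at heights
    [2^j] where [G > 1] and [2^-(j+1)] where [G <= 1]. *)
Definition level_sum (a t : nat -> R) G x : \bar R :=
  \sum_(j <oo) ((a j)%:E * (\1_(superlevel G (t j)) x)%:E).

Lemma nnm_level_sum a t G : (forall j, 0 <= a j)%R -> nnm G -> nnm (level_sum a t G).
Proof.
move=> a0 nG; apply: (@nnm_series _ _ _ (fun j x => (a j)%:E * (\1_(superlevel G (t j)) x)%:E)) => j.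
by apply: nnmMl; [rewrite lee_fin|apply: nnm_indic; exact: measurable_superlevel].
Qed.

Lemma level_sum_ge a t G x j : (forall j, 0 <= a j)%R -> (t j)%:E < G x ->
  (a j)%:E <= level_sum a t G x.
Proof.
move=> a0 tG; pose b j := (a j)%:E * (\1_(superlevel G (t j)) x)%:E.
have b0 i : 0 <= b i by rewrite /b mule_ge0 ?lee_fin.
apply: le_trans (@nneseries_term_le R b j b0).
by rewrite /b indicE mem_set//= mule1.
Qed.

Lemma int_level_sum a t G rho (q : R) (m : \bar R) : (forall j, 0 <= a j)%R ->
  nnm G -> positive_weight rho -> (0 <= q < 1)%R -> 0 <= m ->
  (forall j, (a j)%:E * \int[leb]_(x in superlevel G (t j)) (rho x)%:E <= (q ^+ j)%:E * m) ->
  \int[leb]_x (level_sum a t G x * (rho x)%:E) <= ((1 - q)^-1)%:E * m.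
Proof.
move=> a0 nG pr q01 m0 H; have nr := positive_weight_nnm pr; have /andP[q0 q1] := q01.
have nI j : nnm (fun x => (\1_(superlevel G (t j)) x : R)%:E).
  by apply: nnm_indic; exact: measurable_superlevel.
have nterm j : nnm (fun x => (a j)%:E * ((rho x)%:E * (\1_(superlevel G (t j)) x)%:E)).
  by apply: nnmMl; [rewrite lee_fin|apply: nnmM => //; exact: nI].
under eq_integral => x _.
  rewrite /level_sum muleC -nneseriesZl; last by move=> j _; rewrite mule_ge0 ?lee_fin.
  under eq_eseriesr do rewrite muleCA.
  over.
rewrite nnm_int_series//.
apply: (@le_trans _ _ (\sum_(j <oo) ((q ^+ j)%:E * m))).
  apply: lee_nneseries => [j _ _|j _]; first exact: nnm_int_ge0.
  rewrite nnm_intZ ?lee_fin//; last by apply: nnmM => //; exact: nI.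
  by rewrite -nnm_int_indic//; exact: measurable_superlevel.
by apply: geometric_nneseries_le => // j; rewrite m0 lexx.
Qed.

Lemma ex_pow2_ge (r : R) : exists k, (r <= 2 ^+ k)%R.
Proof.
apply: contrapT => H; apply: (@not_all_pow2_le R r) => k.
by apply: ltW; rewrite ltNge; apply/negP => rk; apply: H; exists k.
Qed.

Lemma powR_le_level_sum_large (r : R) G x : (0 < r)%R -> 1 < G x ->
  G x `^ r <= level_sum (fun j => (2 ^+ j.+1) `^ r)%R (fun j => 2 ^+ j)%R G x.
Proof.
move=> r0 G1; set z := level_sum _ _ _ _.
have a0 j : (0 <= (2 ^+ j.+1) `^ r :> R)%R by exact: powR_ge0.
have zge j : (2 ^+ j)%:E < G x -> ((2 ^+ j.+1) `^ r)%:E <= z.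
  exact: (@level_sum_ge _ (fun j => 2 ^+ j)%R).
(* An infinite value exceeds all heights, so the sum dominates arbitrarily large numbers and is
   infinite as well. *)
have [G0 |] := leP +oo (G x).
  have GE : G x = +oo by apply/eqP; rewrite eq_le G0 leey.
  suff -> : z = +oo by rewrite leey.
  apply/eqP; rewrite -leye_eq leNgt; apply/negP => zoo.
  have z0 : 0 <= z by apply: le_trans (zge 0%N _); rewrite ?lee_fin ?powR_ge0// GE ltry.
  have [s s0 zE] := ltey_EFin z0 zoo.
  apply: (@not_all_pow2_le R (s `^ r^-1)) => k.
  have : ((2 ^+ k.+1) `^ r)%:E <= z by apply: zge; rewrite GE ltry.
  rewrite zE lee_fin => kz.
  apply: (@le_trans _ _ (2 ^+ k.+1)%R); first by rewrite ler_eXn2l ?ltr1n.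
  have -> : (2 ^+ k.+1 = ((2 ^+ k.+1) `^ r) `^ r^-1 :> R)%R.
    by rewrite -powRrM divff ?gt_eqF// powRr1// exprn_ge0.
  by apply: ge0_ler_powR; rewrite ?nnegrE ?invr_ge0 ?powR_ge0// ltW.
have G0 : 0 <= G x by apply: le_trans (ltW G1).
move=> /(ltey_EFin G0)[g g0 GE]; rewrite GE.
have [k0 kP] := ex_pow2_ge g.
have [k kg kmin] := ex_minnP (ex_intro (fun k => g <= 2 ^+ k)%R k0 kP).
case: k kg kmin => [|k kg kmin]; first by rewrite expr0 leNgt -lte_fin -GE G1.
apply: le_trans (zge k _); last first.
  by rewrite GE lte_fin ltNge; apply/negP => /kmin; rewrite ltnn.
by rewrite poweR_EFin lee_fin ge0_ler_powR ?nnegrE ?exprn_ge0 ?(ltW r0).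
Qed.

Lemma powR_le_level_sum_small (r : R) G x : (0 < r)%R -> 0 <= G x <= 1 ->
  G x `^ r <= level_sum (fun j => (2^-1 ^+ j) `^ r)%R (fun j => 2^-1 ^+ j.+1)%R G x.
Proof.
move=> r0 /andP[G0 G1]; set z := level_sum _ _ _ _.
have a0 j : (0 <= (2^-1 ^+ j) `^ r :> R)%R by exact: powR_ge0.
have zge j : (2^-1 ^+ j.+1)%:E < G x -> ((2^-1 ^+ j) `^ r)%:E <= z.
  exact: (@level_sum_ge _ (fun j => 2^-1 ^+ j.+1)%R).
have [g g0 GE] := ltey_EFin G0 (le_lt_trans G1 (ltry _)).
have z0 : 0 <= z.
  by apply: nneseries_ge0 => j _ _; rewrite mule_ge0 ?lee_fin ?powR_ge0.
have [gz|gn0] := eqVneq g 0%R; first by rewrite GE gz poweR0r ?gt_eqF.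
have gp : (0 < g)%R by rewrite lt_neqAle eq_sym gn0.
have [k0 kP] := ex_pow2_ge (2 * g^-1).
have ex : exists k, (2^-1 ^+ k.+1 < g)%R.
  exists k0; rewrite exprVn invf_plt ?posrE ?exprn_gt0// exprS.
  by apply: (@lt_le_trans _ _ (2 * g^-1)%R); [|apply: (le_trans kP)]; rewrite ?ler_pMl ?exprn_gt0 ?ltr_pMl ?invr_gt0 ?ltr1n ?ler1n.
have [k kg kmin] := ex_minnP ex.
apply: le_trans (zge k _); last by rewrite GE lte_fin.
rewrite GE poweR_EFin lee_fin ge0_ler_powR ?nnegrE ?exprn_ge0 ?(ltW r0)//.
case: k kg kmin => [|k kg kmin]; first by rewrite expr0 -lee_fin -GE.
by rewrite leNgt; apply/negP => /kmin; rewrite ltnn.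
Qed.

(** Young's inequality is used with [s1 < 2] where [G <= 1] and with [s2 > 2] where [G > 1]. This
    leaves powers [r1 > 2] and [r2 < 2] of [G], whose level sums are geometric with ratios
    [2^(2-r1)] and [2^(r2-2)], both below 1. *)
Lemma weak_pairing_normalized (s1 s2 : R) : (1 < s1)%R -> (s1 < 2)%R -> (2 < s2)%R ->
  exists2 C : R, (0 < C)%R & forall G H rho (m : \bar R), nnm G -> nnm H ->
    positive_weight rho -> 0 <= m ->
    (forall t : R, (0 < t)%R ->
      \int[leb]_(x in superlevel G t) (rho x)%:E <= ((t ^+ 2)^-1)%:E * m) ->
    \int[leb]_x (H x `^ s1 * (rho x)%:E) <= m ->
    \int[leb]_x (H x `^ s2 * (rho x)%:E) <= m ->
    \int[leb]_x (G x * H x * (rho x)%:E) <= C%:E * m.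
Proof.
move=> s1gt1 s1lt2 s2gt2.
have s11 : (0 < s1 - 1)%R by lra. have s21 : (0 < s2 - 1)%R by lra.
pose r1 := (s1 / (s1 - 1))%R; pose r2 := (s2 / (s2 - 1))%R.
have r1gt2 : (2 < r1)%R by rewrite ltr_pdivlMr//; lra.
have r2lt2 : (r2 < 2)%R by rewrite ltr_pdivrMr//; lra.
have r1gt0 : (0 < r1)%R by lra. have r2gt0 : (0 < r2)%R by rewrite divr_gt0//; lra.
pose q1 := (2 `^ (2 - r1) : R)%R; pose q2 := (2 `^ (r2 - 2) : R)%R.
have pow2_lt1 (r : R) : (r < 0)%R -> (0 <= (2 `^ r : R) < 1)%R.
  move=> r0; rewrite powR_ge0/= -(opprK r) powRN invf_lt1 ?powR_gt0//.
  have h : (0 < - r)%R by rewrite oppr_gt0.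
  by have := gt0_ltr_powR h (ler01 : 1%R \in Num.nneg) (ler0n R 2) (ltr1n R 2); rewrite powR1.
have q101 : (0 <= q1 < 1)%R by apply: pow2_lt1; rewrite subr_lt0.
have q201 : (0 <= q2 < 1)%R by apply: pow2_lt1; rewrite subr_lt0.
have iq1 : (0 < (1 - q1)^-1)%R by rewrite invr_gt0 subr_gt0; case/andP: q101.
have iq2 : (0 < (1 - q2)^-1)%R by rewrite invr_gt0 subr_gt0; case/andP: q201.
exists (1 + 1 + (1 - q2)^-1 * 2 `^ r2 + (1 - q1)^-1 * 4)%R.
  by rewrite !addr_gt0// mulr_gt0// powR_gt0.
move=> G H rho m nG nH pr m0 GL H1 H2; have nr := positive_weight_nnm pr.
pose S1 := level_sum (fun j => (2^-1 ^+ j) `^ r1)%R (fun j => 2^-1 ^+ j.+1)%R G.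
pose S2 := level_sum (fun j => (2 ^+ j.+1) `^ r2)%R (fun j => 2 ^+ j)%R G.
have nS1 : nnm S1 by apply: nnm_level_sum => // j; exact: powR_ge0.
have nS2 : nnm S2 by apply: nnm_level_sum => // j; exact: powR_ge0.
have pow2E j : (2 ^+ j = 2 `^ j%:R :> R)%R by rewrite powR_mulrn.
have S1int : \int[leb]_x (S1 x * (rho x)%:E) <= ((1 - q1)^-1)%:E * (4%:E * m).
  apply: int_level_sum => // [|j]; [by rewrite mule_ge0// lee_fin|].
  apply: (le_trans (lee_wpmul2l _ (GL _ _))); [by rewrite lee_fin powR_ge0|by rewrite exprn_gt0|].
  rewrite !muleA -!EFinM.
  suff -> : ((2^-1 ^+ j) `^ r1 * ((2^-1 ^+ j.+1) ^+ 2)^-1 = q1 ^+ j * 4 :> R)%R by [].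
  rewrite -exprM !exprVn invrK pow2E -powR_mulrn ?powR_ge0// -powRN -!powRrM.
  have -> : (4 = 2 `^ 2%:R :> R)%R by rewrite powR_mulrn// -natrX.
  rewrite pow2E -!powRD; last by apply/implyP => _; rewrite gt_eqF.
    congr (_ `^ _)%R; rewrite natrM -natr1; ring.
  by apply/implyP => _; rewrite gt_eqF.
have S2int : \int[leb]_x (S2 x * (rho x)%:E) <= ((1 - q2)^-1)%:E * ((2 `^ r2)%:E * m).
  apply: int_level_sum => // [|j]; [by rewrite mule_ge0// lee_fin powR_ge0|].
  apply: (le_trans (lee_wpmul2l _ (GL _ _))); [by rewrite lee_fin powR_ge0|by rewrite exprn_gt0|].
  rewrite !muleA -!EFinM.
  suff -> : ((2 ^+ j.+1) `^ r2 * ((2 ^+ j) ^+ 2)^-1 = q2 ^+ j * 2 `^ r2 :> R)%R by [].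
  rewrite -exprM !pow2E -powR_mulrn ?powR_ge0// -powRN -!powRrM.
  rewrite -!powRD; last by apply/implyP => _; rewrite gt_eqF.
    congr (_ `^ _)%R; rewrite natrM -natr1; ring.
  by apply/implyP => _; rewrite gt_eqF.
have pw x : G x * H x <= H x `^ s1 + H x `^ s2 + S2 x + S1 x.
  have G0 := nnm_ge0 x nG; have H0 := nnm_ge0 x nH.
  have [G1|G1] := leP (G x) 1.
    have := young_conj s1gt1 H0 G0; rewrite muleC => /le_trans; apply.
    apply: leeD; last by apply: powR_le_level_sum_small; rewrite ?G0.
    by rewrite -addeA; apply: leeDl; rewrite adde_ge0 ?poweR_ge0 ?(nnm_ge0 x nS2).
  have s2gt1 : (1 < s2)%R by lra.
  have := young_conj s2gt1 H0 G0; rewrite muleC => /le_trans; apply.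
  rewrite -[leLHS]adde0; apply: leeD; last exact: (nnm_ge0 x nS1).
  apply: leeD; last exact: powR_le_level_sum_large.
  by apply: leeDr; exact: poweR_ge0.
have nH1 : nnm (fun x => H x `^ s1 * (rho x)%:E) by apply: nnmM => //; exact: nnm_pow.
have nH2 : nnm (fun x => H x `^ s2 * (rho x)%:E) by apply: nnmM => //; exact: nnm_pow.
have nS1r : nnm (fun x => S1 x * (rho x)%:E) by exact: nnmM.
have nS2r : nnm (fun x => S2 x * (rho x)%:E) by exact: nnmM.
apply: (@le_trans _ _ (\int[leb]_x (H x `^ s1 * (rho x)%:E + H x `^ s2 * (rho x)%:E +
    S2 x * (rho x)%:E + S1 x * (rho x)%:E))).
  apply: nnm_le_int => //.
  - by apply: nnmM => //; exact: nnmM.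
  - by apply: nnmD => //; apply: nnmD => //; exact: nnmD.
  move=> x _; apply: (le_trans (lee_wpmul2r (nnm_ge0 x nr) (pw x))).
  by rewrite !ge0_muleDl ?adde_ge0 ?poweR_ge0 ?(nnm_ge0 x nS1) ?(nnm_ge0 x nS2).
rewrite (nnm_intD leb measurableT _ nS1r); last by apply: nnmD => //; exact: nnmD.
rewrite (nnm_intD leb measurableT _ nS2r); last exact: nnmD.
rewrite nnm_intD//.
have k2 : (0 <= (1 - q2)^-1 * 2 `^ r2)%R by rewrite mulr_ge0 ?powR_ge0// ltW.
have k1 : (0 <= (1 - q1)^-1 * 4)%R by rewrite mulr_ge0// ltW.
rewrite !EFinD !ge0_muleDl ?adde_ge0 ?lee_fin// !mul1e 2!EFinM -!muleA.
by apply: leeD => //; apply: leeD => //; exact: leeD.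
Qed.

(** Replacing [G] by [(b / a) G] gives both functions the same size [m = b^2], so the additive bound
    of the normalized form becomes the product [a b]. *)
Lemma weak_pairing (s1 s2 : R) : (1 < s1)%R -> (s1 < 2)%R -> (2 < s2)%R ->
  exists2 C : R, (0 < C)%R & forall G H rho (a b : R), nnm G -> nnm H ->
    positive_weight rho -> (0 < a)%R -> (0 < b)%R ->
    (forall t : R, (0 < t)%R ->
      \int[leb]_(x in superlevel G t) (rho x)%:E <= ((a / t) ^+ 2)%:E) ->
    \int[leb]_x (H x `^ s1 * (rho x)%:E) <= (b ^+ 2)%:E ->
    \int[leb]_x (H x `^ s2 * (rho x)%:E) <= (b ^+ 2)%:E ->
    \int[leb]_x (G x * H x * (rho x)%:E) <= (C * a * b)%:E.
Proof.
move=> s1gt1 s1lt2 s2gt2.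
have [C C0 HC] := weak_pairing_normalized s1gt1 s1lt2 s2gt2.
exists C => // G H rho a b nG nH pr a0 b0 GL H1 H2; have nr := positive_weight_nnm pr.
have r0 : (0 < b / a)%R by exact: divr_gt0.
have nG' : nnm (fun x => (b / a)%:E * G x) by apply: nnmMl => //; rewrite lee_fin ltW.
have := HC _ H rho (b ^+ 2)%:E nG' nH pr _ _ H1 H2.
have -> : \int[leb]_x ((b / a)%:E * G x * H x * (rho x)%:E) =
    (b / a)%:E * \int[leb]_x (G x * H x * (rho x)%:E).
  rewrite -nnm_intZ ?lee_fin ?(ltW r0)//; last by apply: nnmM => //; exact: nnmM.
  by apply: eq_integral => x _; rewrite !muleA.
have -> : ((C * a * b)%:E = ((b / a)^-1)%:E * (C%:E * (b ^+ 2)%:E) :> \bar R).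
  by rewrite -!EFinM; congr EFin; field; rewrite !gt_eqF.
rewrite lee_pdivlMl//; apply; first by rewrite lee_fin sqr_ge0.
move=> t t0; have -> : superlevel (fun x => (b / a)%:E * G x) t = superlevel G (t * (b / a)^-1).
  by apply/seteqP; split => x; rewrite /superlevel /= (mulrC t) (EFinM (b / a)^-1)
    lte_pdivrMl.
apply: (le_trans (GL _ _)); first by rewrite mulr_gt0// invr_gt0.
rewrite -EFinM lee_fin le_eqVlt; apply/orP; left; apply/eqP.
by field; rewrite !gt_eqF.
Qed.

End weak_pairing.

Section weak_type.
Context {R : realType} {n : nat}.
Local Notation T := (Rn R n.+1).
Local Notation leb := (@leb R n).
Local Notation c := (@unit_cube_vol R n).
Implicit Types (x : T) (u v w : T -> R) (f g : T -> \bar R)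
  (F : set ((T -> \bar R) * (T -> \bar R))).
Hypothesis c_gt0 : (0 < c)%R.

(** The bound is linear in [H] with a constant common to all [k], so it passes to nonnegative
    combinations, whatever their size; finiteness of the sum is settled separately. *)
Lemma series_cubes K (a : nat -> R) (H : nat -> T -> \bar R) : (0 < K)%R ->
  (forall k, 0 <= a k)%R -> (forall k, nnm (H k)) ->
  (forall k b l x, (0 < l)%R -> cube b l x ->
    \int[leb]_(y in (cube b l : set T)) H k y <= K%:E * H k x * (@vol R n l)%:E) ->
  forall b l x, (0 < l)%R -> cube b l x ->
    \int[leb]_(y in (cube b l : set T)) (\sum_(k <oo) ((a k)%:E * H k y)) <=
    K%:E * (\sum_(k <oo) ((a k)%:E * H k x)) * (@vol R n l)%:E.
Proof.
move=> K0 a0 nH HK b l x l0 xQ; have v0 := vol_gt0 c_gt0 l0.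
have mQ := @measurable_cube R n b l.
have naH k : nnm (fun y => (a k)%:E * H k y) by apply: nnmMl => //; rewrite lee_fin.
have aH0 k : 0 <= (a k)%:E * H k x by exact: (nnm_ge0 x (naH k)).
rewrite (nnm_int_series leb mQ naH) muleAC -EFinM -nneseriesZl//.
apply: lee_nneseries => [k _ _|k _]; first exact: nnm_int_ge0.
rewrite (nnm_intZ leb mQ) ?lee_fin// muleCA; apply: lee_wpmul2l; rewrite ?lee_fin//.
by rewrite EFinM muleAC; exact: HK.
Qed.

(** For [s = 2 - eta] the power of [v] is [eta / 2], and for [s = 2 + eta] it is [- eta / 2]; [eta]
    is as small as the balance of [v] and the reverse Hölder exponent of [u] require. *)
Lemma dual_weights K d u v : A1R K u -> balanced d v -> exists s1 s2 : R,
  [/\ (1 < s1)%R, (s1 < 2)%R, (2 < s2)%R,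
    ApR s1 (fun x => u x `^ (1 - s1) * v x `^ (1 - s1 / 2))%R &
    ApR s2 (fun x => u x `^ (1 - s2) * v x `^ (1 - s2 / 2))%R].
Proof.
move=> Au bv; have [pv d0 _] := bv.
have [e [K' [e0 Ru]]] := A1R_RHA1 c_gt0 Au.
have e10 : (0 < 1 + e)%R by lra.
(* The bound [1/3] gives [s - 1 >= 2/3], and the other one gives [(eta / 2) (1 + e) <= d e / 2];
   since [1/2 < 2/3], [cond] follows. *)
pose eta := (Num.min (3^-1) (d * e / (1 + e)) : R)%R.
have de0 : (0 < d * e)%R by exact: mulr_gt0.
have eta0 : (0 < eta)%R by rewrite lt_min invr_gt0 ltr0n/= divr_gt0.
have eta3 : (eta <= 3^-1)%R by rewrite ge_min lexx.
have etad' : (eta * (1 + e) <= d * e)%R by rewrite -ler_pdivlMr// ge_min lexx orbT.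
have etad : (eta / 2 < d)%R.
  have : (eta * (1 + e) < d * (1 + e))%R.
    by apply: (le_lt_trans etad'); rewrite ltr_pM2l//; lra.
  by rewrite ltr_pM2r// => h; lra.
have cond (s : R) : (2 - eta <= s)%R -> (eta / 2 * (1 + e) < d * ((s - 1) * e))%R.
  move=> hs; have : (2 / 3 * (d * e) <= (s - 1) * (d * e))%R by rewrite ler_pM2r//; lra.
  by move=> h; rewrite (_ : d * ((s - 1) * e) = (s - 1) * (d * e))%R; [lra|ring].
have eta20 : (0 < eta / 2)%R by rewrite divr_gt0.
exists (2 - eta)%R, (2 + eta)%R; split; [lra|lra|lra| |].
  have h1 : (1 < 2 - eta)%R by lra.
  have E x : (u x `^ (1 - (2 - eta)) * v x `^ (eta / 2) =
      u x `^ (1 - (2 - eta)) * v x `^ (1 - (2 - eta) / 2))%R.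
    by congr (_ * _ `^ _)%R; field.
  rewrite -(funext E).
  exact: (RHA1_balanced_ApR c_gt0 Ru bv e0 h1 eta20 etad (cond _ (lexx _))).
(* The power of [v] is negative from here on, so the balance is applied to [v^-1]. *)
have h1' : (1 < 2 + eta)%R by lra.
have h2 : (2 - eta <= 2 + eta)%R by lra.
have E x : (u x `^ (1 - (2 + eta)) * (v x `^ (-1)) `^ (eta / 2) =
    u x `^ (1 - (2 + eta)) * v x `^ (1 - (2 + eta) / 2))%R.
  by rewrite -powRrM; congr (_ * _ `^ _)%R; field.
rewrite -(funext E).
exact: (RHA1_balanced_ApR c_gt0 Ru (balancedV bv) e0 h1' eta20 etad (cond _ h2)).
Qed.

Lemma mule_nneseries_le (y : \bar R) (a : nat -> \bar R) : 0 <= y ->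
  (forall k, 0 <= a k) -> y * \sum_(k <oo) a k <= \sum_(k <oo) (y * a k).
Proof.
move=> y0 a0; have ya0 k : 0 <= y * a k by exact: mule_ge0.
have [yoo|] := leP +oo y; last first.
  by move=> /(ltey_EFin y0)[r r0 ->]; rewrite nneseriesZl.
have {yoo}-> : y = +oo by apply/eqP; rewrite eq_le yoo leey.
have [[k ak]|H] := pselect (exists k, 0 < a k).
  apply: (le_trans (leey _)).
  apply: le_trans (nneseries_term_le k _); first by rewrite gt0_mulye.
  by move=> i; rewrite mule_ge0.
have az k : a k = 0.
  by apply/eqP; rewrite eq_le a0 andbT leNgt; apply/negP => ak; apply: H; exists k.
rewrite eseries0 => [|k _ _]; last exact: az.
by rewrite mule0; apply: nneseries_ge0 => k _ _; rewrite az mule0.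
Qed.

(* With [Gam = (g / v ^ theta) ^ (1 / (2 theta))] and [Phi] likewise in terms of [f],
   the measure [uv] of a superlevel set at height [t] is quadratic in [1 / t], and
   [f ^ (1 / (2 theta)) W = Phi v ^ (1 / 2) W]. *)
Lemma weak_type_contradiction K d u v (A : R) (Phi Gam : nat -> T -> \bar R) (e : nat -> R) :
  A1R K u -> balanced d v -> (0 < A)%R -> (forall k, nnm (Phi k)) ->
  (forall k, nnm (Gam k)) -> (forall k, 0 < e k)%R ->
  (forall k, \int[leb]_(x in superlevel (Phi k) 1) (u x * v x)%:E = (e k ^+ 2)%:E) ->
  (forall k t, (0 < t)%R ->
    \int[leb]_(x in superlevel (Phi k) t) (u x * v x)%:E <= ((A * e k / t) ^+ 2)%:E) ->
  (forall k t, (0 < t)%R -> \int[leb]_(x in superlevel (Gam k) t) (u x * v x)%:E <=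
    ((A * e k * 4^-1 ^+ k / t) ^+ 2)%:E) ->
  (forall K' w, A1R K' w -> exists2 C : R, (0 < C)%R & forall k,
    \int[leb]_x (Phi k x * (v x `^ 2^-1 * w x)%:E) < +oo ->
    \int[leb]_x (Phi k x * (v x `^ 2^-1 * w x)%:E) <=
      C%:E * \int[leb]_x (Gam k x * (v x `^ 2^-1 * w x)%:E)) -> False.
Proof.
move=> Au bv A0 nPhi nGam e0 Ee Phile Gamle Hw.
have [pu _ _] := Au; have [pv _ _] := bv.
have u0 x : (0 < u x)%R by exact: weight_gt0.
have v0 x : (0 < v x)%R by exact: weight_gt0.
have [s1 [s2 [s1gt1 s1lt2 s2gt2 Aom1 Aom2]]] := dual_weights Au bv.
have s2gt1 : (1 < s2)%R by lra.
pose om (s : R) x := (u x `^ (1 - s) * v x `^ (1 - s / 2))%R.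
pose rho x := (u x * v x)%R; have prho : positive_weight rho by exact: positive_weightM.
pose sqv x := (v x `^ 2^-1)%R; have psqv : positive_weight sqv by exact: positive_weight_pow.
pose U x := (u x * sqv x)%R; have pU : positive_weight U by exact: positive_weightM.
have pUV : positive_weight (fun x => U x `^ (-1))%R by exact: positive_weight_pow.
have U0 x : (0 < U x)%R by exact: weight_gt0.
have pom s : positive_weight (om s).
  by apply: positive_weightM; exact: positive_weight_pow.
have nrho := positive_weight_nnm prho; have nsqv := positive_weight_nnm psqv.
have nU := positive_weight_nnm pU; have nUV := positive_weight_nnm pUV.
(* [om s] is built so that [U^s om s = u v] for every [s]. Hence [h = 1_E U] has the same integral
   [uv(E)] for both exponents. *)
have omE s x : (U x `^ s * om s x = rho x)%R.
  rewrite /om /rho /U /sqv (powRM _ (ltW (u0 x)) (powR_ge0 _ _)) -(powRrM (v x)) mulrACA.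
  rewrite -!powRD; [|by apply/implyP => _; rewrite gt_eqF..].
  rewrite (_ : s + (1 - s) = 1)%R; last by ring.
  rewrite (_ : 2^-1 * s + (1 - s / 2) = 1)%R; last by field.
  by rewrite !powRr1 ?ltW.
have omE' s x : (U x `^ (- s) * rho x = om s x)%R.
  rewrite -(omE s x) mulrA -powRD; last by apply/implyP => _; rewrite gt_eqF.
  by rewrite addNr powRr0 mul1r.
have UVE x : (U x `^ (-1) * rho x = sqv x)%R.
  rewrite powRN powRr1 ?(ltW (U0 x))// /U /rho.
  have -> : v x = (sqv x * sqv x)%R.
    rewrite /sqv -powRD; last by apply/implyP => _; rewrite gt_eqF.
    by rewrite (_ : 2^-1 + 2^-1 = 1)%R ?powRr1 ?ltW//; field.
  have sv0 : (0 < sqv x)%R by exact: weight_gt0.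
  by field; rewrite !gt_eqF.
have [B1 B10 HB1] := muckenhoupt c_gt0 s1gt1 Aom1.
have [B2 B20 HB2] := muckenhoupt c_gt0 s2gt1 Aom2.
pose L : R * (T -> R) -> Prop := fun z => z = (s1, om s1) \/ z = (s2, om s2).
have B120 : (0 < B1 + B2)%R by exact: addr_gt0.
have LP s w : L (s, w) -> [/\ (1 < s)%R, positive_weight w &
     forall t f, nnm f -> \int[leb]_x (M t f x `^ s * (w x)%:E) <=
                   (B1 + B2)%:E * \int[leb]_x (f x `^ s * (w x)%:E)].
  have bd (B s' : R) f : (B <= B1 + B2)%R -> nnm f ->
      B%:E * \int[leb]_x (f x `^ s' * (om s' x)%:E) <=
      (B1 + B2)%:E * \int[leb]_x (f x `^ s' * (om s' x)%:E).
    move=> BB nf; apply: lee_wpmul2r; last by rewrite lee_fin.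
    by apply: nnm_int_ge0; apply: nnmM; [exact: nnm_pow|exact: positive_weight_nnm].
  move=> [[-> ->]|[-> ->]]; split.
  - exact: s1gt1.
  - exact: pom.
  - by move=> t f nf; apply: (le_trans (HB1 t f nf)); apply: bd => //; rewrite lerDl ltW.
  - exact: s2gt1.
  - exact: pom.
  - by move=> t f nf; apply: (le_trans (HB2 t f nf)); apply: bd => //; rewrite lerDr ltW.
have [K1 K10 KP] := rubio_de_francia_cubes c_gt0 B120 LP.
pose E k := superlevel (Phi k) 1.
have mE k : measurable (E k) by exact: measurable_superlevel.
have nE k : nnm (fun x => (\1_(E k) x : R)%:E) by exact: nnm_indic.
pose h k x := (U x)%:E * (\1_(E k) x)%:E.
have nh k : nnm (h k) by exact: nnmM.
have {KP}[H HP] := choice (fun k => KP (h k) (nh k)).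
have nH k : nnm (H k) by have [] := HP k.
have hH k x : h k x <= H k x by have [_ /(_ x)] := HP k.
have Hcube k : forall b l x, (0 < l)%R -> cube b l x ->
    \int[leb]_(y in (cube b l : set T)) H k y <= K1%:E * H k x * (@vol R n l)%:E.
  by have [] := HP k.
have hint s k : (0 < s)%R -> \int[leb]_x (h k x `^ s * (om s x)%:E) = (e k ^+ 2)%:E.
  move=> s0; rewrite -Ee (nnm_int_indic leb _ (mE k)); apply: eq_integral => x _.
  rewrite /h poweRM ?lee_fin ?(ltW (U0 x))// muleAC -EFinM omE EFinM; congr (_ * _).
  by rewrite indicE; case: (_ \in _); rewrite ?poweR_EFin ?powR1// powR0// gt_eqF.
have Hint s k : (0 < s)%R -> L (s, om s) ->
    \int[leb]_x (H k x `^ s * (om s x)%:E) <= ((2 * e k) ^+ 2)%:E.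
  move=> s0 Ls; have [_ _ _ /(_ s (om s) Ls)] := HP k; rewrite hint// => /le_trans; apply.
  rewrite -EFinM lee_fin exprMn ler_pM2r ?exprn_gt0//; lra.
(* This is [H / U]. As [om s = U^-s u v], the two bounds on [H] become bounds in [L^s1] and [L^s2]
   of the single measure [u v], as [weak_pairing] needs. *)
pose Ht k x := H k x * (U x `^ (-1))%:E.
have nHt k : nnm (Ht k) by exact: nnmM.
have Htint s k : (0 < s)%R -> L (s, om s) ->
    \int[leb]_x (Ht k x `^ s * (rho x)%:E) <= ((2 * e k) ^+ 2)%:E.
  move=> s0 Ls; apply: le_trans (Hint s k s0 Ls).
  rewrite le_eqVlt; apply/orP; left; apply/eqP; apply: eq_integral => x _.
  rewrite /Ht poweRM ?lee_fin ?powR_ge0//; last exact: (nnm_ge0 x (nH k)).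
  by rewrite -muleA poweR_EFin -EFinM -powRrM mulN1r omE'.
have [C C0 HC] := weak_pairing s1gt1 s1lt2 s2gt2 (R := R) (n := n).
have pairing G (a : R) k : nnm G -> (0 < a)%R -> (forall t, (0 < t)%R ->
      \int[leb]_(x in superlevel G t) (rho x)%:E <= ((a / t) ^+ 2)%:E) ->
    \int[leb]_x (G x * (sqv x)%:E * H k x) <= (C * a * (2 * e k))%:E.
  move=> nG a0 Ga; have b0 : (0 < 2 * e k)%R by exact: mulr_gt0.
  have s10 : (0 < s1)%R by lra. have s20 : (0 < s2)%R by lra.
  have := HC G (Ht k) rho a (2 * e k)%R nG (nHt k) prho a0 b0 Ga
    (Htint s1 k s10 (or_introl erefl)) (Htint s2 k s20 (or_intror erefl)).
  congr (_ <= _); apply: eq_integral => x _.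
  by rewrite /Ht -!muleA; congr (_ * _); rewrite muleC -EFinM UVE.
(* [pairing] yields a factor [2 e k]; dividing by [e k] makes the contributions of all [H k]
   uniform, and [2^-k] makes them summable. *)
pose a k := (2^-1 ^+ k * (e k)^-1)%R.
have a0 k : (0 < a k)%R by rewrite mulr_gt0 ?exprn_gt0 ?invr_gt0.
pose Ws x := \sum_(k <oo) ((a k)%:E * H k x).
have naH k : nnm (fun x => (a k)%:E * H k x) by apply: nnmMl => //; rewrite lee_fin ltW.
have nWs : nnm Ws by exact: nnm_series.
have total G (b : R) : nnm G -> (0 < b)%R -> (forall t, (0 < t)%R ->
      \int[leb]_(x in superlevel G t) (rho x)%:E <= ((b / t) ^+ 2)%:E) ->
    \int[leb]_x (G x * (sqv x)%:E * Ws x) <= (4 * C * b)%:E.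
  move=> nG b0 Gb; have nGs : nnm (fun x => G x * (sqv x)%:E) by exact: nnmM.
  have nGsH k : nnm (fun x => G x * (sqv x)%:E * H k x) by exact: nnmM.
  have nterm k : nnm (fun x => (a k)%:E * (G x * (sqv x)%:E * H k x)).
    by apply: nnmMl => //; rewrite lee_fin ltW.
  apply: (@le_trans _ _ (\int[leb]_x (\sum_(k <oo) ((a k)%:E * (G x * (sqv x)%:E * H k x))))).
    apply: nnm_le_int => //; [exact: nnmM|exact: nnm_series|move=> x _].
    apply: (le_trans (mule_nneseries_le (nnm_ge0 x nGs) (fun k => nnm_ge0 x (naH k)))).
    by under eq_eseriesr do rewrite muleCA.
  rewrite nnm_int_series//.
  have -> : (4 * C * b)%:E = 2%:E * (2 * C * b)%:E :> \bar R.
    by rewrite -EFinM; congr EFin; ring.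
  apply: le_trans (half_nneseries_le (a := fun=> (2 * C * b)%:E) _); last first.
    by move=> k; rewrite lexx andbT lee_fin !mulr_ge0 ?ltW.
  apply: lee_nneseries => [k _ _|k _]; first exact: nnm_int_ge0.
  rewrite nnm_intZ ?lee_fin ?(ltW (a0 k))//.
  apply: (le_trans (lee_wpmul2l _ (pairing G b k nG b0 Gb))); first by rewrite lee_fin ltW.
  rewrite -!EFinM lee_fin /a le_eqVlt; apply/orP; left; apply/eqP.
  by have ek := e0 k; field; rewrite gt_eqF.
have WsH k x : (a k)%:E * H k x <= Ws x.
  by apply: (@nneseries_term_le _ (fun k => (a k)%:E * H k x)) => i; exact: (nnm_ge0 x (naH i)).
have PhiE (N : R) k (W : T -> \bar R) : nnm W -> (0 <= N)%R ->
    (forall x, E k x -> N%:E * (U x)%:E <= W x) ->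
    (N * e k ^+ 2)%:E <= \int[leb]_x (Phi k x * (sqv x)%:E * W x).
  move=> nw N0 Nw; rewrite EFinM -Ee (nnm_int_indic leb _ (mE k)).
  have nrE : nnm (fun x => (u x * v x)%:E * (\1_(E k) x : R)%:E) by exact: nnmM.
  rewrite -nnm_intZ ?lee_fin//; apply: nnm_le_int => //.
  - by apply: nnmMl => //; rewrite lee_fin.
  - by apply: nnmM => //; exact: nnmM.
  move=> x _; rewrite indicE; have [/set_mem Ex|_] := boolP (x \in E k); last first.
    by rewrite !mule0; apply: mule_ge0; [apply: mule_ge0|exact: (nnm_ge0 x nw)];
      [exact: (nnm_ge0 x (nPhi k))|exact: (nnm_ge0 x nsqv)].
  rewrite mule1 -muleA; apply: (@le_trans _ _ (1 * ((sqv x)%:E * W x))).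
    rewrite mul1e; apply: le_trans (lee_wpmul2l (nnm_ge0 x nsqv) (Nw x Ex)).
    rewrite -!EFinM lee_fin le_eqVlt; apply/orP; left; apply/eqP.
    have -> : (sqv x * (N * U x) = N * (u x * (sqv x * sqv x)))%R by rewrite /U; ring.
    congr (_ * (_ * _))%R; rewrite /sqv -powRD; last by apply/implyP => _; rewrite gt_eqF.
    by rewrite (_ : 2^-1 + 2^-1 = 1)%R ?powRr1 ?ltW//; field.
  apply: lee_wpmul2r; last exact: ltW.
  by apply: mule_ge0; [exact: (nnm_ge0 x nsqv)|exact: (nnm_ge0 x nw)].
have lower k : (2^-1 ^+ k * e k)%:E <= \int[leb]_x (Phi k x * (sqv x)%:E * Ws x).
  have -> : (2^-1 ^+ k * e k = a k * e k ^+ 2)%R.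
    by rewrite /a -mulrA expr2 (mulrA (e k)^-1%R) mulVf ?mul1r ?gt_eqF.
  apply: PhiE => //; first exact: ltW.
  move=> x Ex; apply: le_trans (WsH k x); apply: lee_wpmul2l; first by rewrite lee_fin ltW.
  by apply: le_trans (hH k x); rewrite /h indicE mem_set// mule1.
have upperPhi k : \int[leb]_x (Phi k x * (sqv x)%:E * Ws x) <= (4 * C * (A * e k))%:E.
  by apply: total => //; [exact: mulr_gt0|exact: Phile].
have upperGam k : \int[leb]_x (Gam k x * (sqv x)%:E * Ws x) <=
    (4 * C * (A * e k * 4^-1 ^+ k))%:E.
  by apply: total => //; [rewrite !mulr_gt0 ?exprn_gt0|exact: Gamle].
have Wsfin : exists x, Ws x < +oo.
  apply: contrapT => Hoo.
  (* If [Ws] were infinite everywhere, [PhiE] would apply with every [N]; this one makes the lower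
     bound exceed the upper bound [4 C A e_0] by 1. *)
  pose N := ((4 * C * (A * e 0%N) + 1) / e 0%N ^+ 2)%R.
  have e20 : (0 < e 0%N ^+ 2)%R by exact: exprn_gt0.
  have p0 : (0 < 4 * C * (A * e 0%N) + 1)%R by rewrite ltr_pwDr// !mulr_ge0 ?ltW.
  have N0 : (0 <= N)%R by rewrite divr_ge0 ?ltW.
  have := le_trans (PhiE N 0%N Ws nWs N0 _) (upperPhi 0%N).
  rewrite /N divfK ?gt_eqF// lee_fin gerDl ler10.
  suff H1 : forall x, E 0%N x -> N%:E * (U x)%:E <= Ws x by move=> /(_ H1).
  move=> x _; have [Wx|] := leP +oo (Ws x); first exact: le_trans (leey _) Wx.
  by move=> Wx; case: Hoo; exists x.
have Wsn0 : ~ {ae leb, forall x, Ws x = 0}.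
  move=> W0; have := lower 0%N.
  rewrite (_ : \int[leb]_x _ = 0) ?lee_fin ?leNgt ?expr0 ?mul1r ?e0//.
  rewrite -(integral0 leb (@setT T)); apply: (nnm_eq_ae_int (g := cst 0)) => //.
  - by apply: nnmM => //; exact: nnmM.
  - exact: nnm_cst.
  by apply: filterS W0 => x ->; rewrite mule0.
have Wscube := series_cubes K10 (fun k => ltW (a0 k)) nH Hcube.
have [W [AW WE _]] := everywhere_A1R c_gt0 nWs K10 Wscube Wsfin Wsn0.
have [pW _ _] := AW; have nW := positive_weight_nnm pW.
have [C2 C20 HC2] := Hw _ _ AW.
have WsE G : nnm G -> \int[leb]_x (G x * (v x `^ 2^-1 * W x)%:E) =
    \int[leb]_x (G x * (sqv x)%:E * Ws x).
  move=> nG; apply: nnm_eq_ae_int => //.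
  - apply: nnmM => //; apply: positive_weight_nnm; exact: positive_weightM.
  - by apply: nnmM => //; exact: nnmM.
  by apply: filterS WE => x ->; rewrite EFinM muleA.
(* Against the glued weight [Phi k] integrates to at least [2^-k e k] and [Gam k] to at most a
   multiple of [4^-k e k], so a constant valid for all [k] would bound [2^k]. *)
apply: (@not_all_pow2_le R (C2 * (4 * C * A))) => k.
have := HC2 k; rewrite !WsE// => /(_ (le_lt_trans (upperPhi k) (ltry _))) H2.
have := le_trans (lower k) (le_trans H2 (lee_wpmul2l (ltW C20 : 0 <= C2%:E) (upperGam k))).
rewrite -EFinM lee_fin.
have -> : (2^-1 ^+ k * e k = 4^-1 ^+ k * e k * 2 ^+ k :> R)%R.
  by rewrite mulrAC; congr (_ * _)%R; rewrite -exprMn; congr (_ ^+ _)%R; field.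
have -> : (C2 * (4 * C * (A * e k * 4^-1 ^+ k)) = 4^-1 ^+ k * e k * (C2 * (4 * C * A)) :> R)%R.
  by ring.
by rewrite ler_pM2l// mulr_gt0// exprn_gt0// invr_gt0.
Qed.

Lemma weakLnormE (p : R) mu f : (forall x, 0 <= f x) -> weakLnorm p mu f =
  ereal_sup [set t%:E * (\int[leb]_(x in superlevel f t) mu x) `^ p^-1
            | t in [set t : R | (0 < t)%R]].
Proof.
move=> f0; congr ereal_sup; apply: eq_imagel => t _; congr (_ * _ `^ _).
rewrite /weighted; congr (integral _ _ _); apply/seteqP.
by split => x; rewrite /superlevel /= gee0_abs.
Qed.

Lemma superlevel_poweR (a : R) f (t : R) : (0 < a)%R -> (0 < t)%R -> (forall x, 0 <= f x) ->
  superlevel (fun x => f x `^ a) t = superlevel f (t `^ a^-1)%R.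
Proof.
move=> a0 t0 f0.
have E x : (t%:E < f x `^ a) = ((t `^ a^-1)%:E < f x).
  rewrite !ltNge; congr negb; apply/idP/idP => H.
    rewrite -[leLHS](@poweRK _ a) ?gt_eqF// -poweR_EFin.
    by apply: le_poweR2r => //; [rewrite invr_ge0 ltW|exact: poweR_ge0].
  have -> : t%:E = (t `^ a^-1)%:E `^ a.
    by rewrite poweR_EFin -powRrM mulVf ?gt_eqF// powRr1 ?ltW.
  by apply: le_poweR2r => //; exact: ltW.
by apply/seteqP; split => x; rewrite /superlevel /= E.
Qed.

(** The hypothesis bounds the measure of [{f > s}] by [(a / s)^(1/theta)]; at [s = t^(2 theta)] this
    is quadratic in [1 / t]. *)
Lemma superlevel_quadratic (theta a : R) mu f : (0 < theta)%R -> (0 <= a)%R ->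
  nnm mu -> nnm f ->
  (forall t : R, (0 < t)%R ->
    t%:E * (\int[leb]_(x in superlevel f t) mu x) `^ theta <= a%:E) ->
  forall t : R, (0 < t)%R ->
    \int[leb]_(x in superlevel (fun x => f x `^ (2 * theta)^-1) t) mu x <=
    ((a `^ (2 * theta)^-1 / t) ^+ 2)%:E.
Proof.
move=> th0 a0 nmu nf H t t0; have th20 : (0 < 2 * theta)%R by exact: mulr_gt0.
rewrite superlevel_poweR ?invr_gt0// ?invrK; last by move=> x; exact: (nnm_ge0 x nf).
pose s := (t `^ (2 * theta))%R; have s0 : (0 < s)%R by exact: powR_gt0.
have := H s s0; rewrite -lee_pdivlMl// -EFinM.
set I := integral _ _ _ => HI; have I0 : 0 <= I by exact: nnm_int_ge0.
have := @le_poweR2r R theta^-1 _ _ _ (poweR_ge0 _ _) HI.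
rewrite poweRK ?gt_eqF// invr_ge0 => /(_ (ltW th0)) /le_trans; apply.
rewrite poweR_EFin lee_fin le_eqVlt; apply/orP; left; apply/eqP.
rewrite (_ : theta^-1 = (2 * theta)^-1 * 2%:R)%R; last by field; rewrite gt_eqF.
rewrite powRrM powR_mulrn ?powR_ge0//; congr (_ ^+ _)%R.
rewrite mulrC powRM ?invr_ge0 ?(ltW s0)//; congr (_ * _)%R.
by rewrite /s -powRN -powRrM mulNr divff ?gt_eqF// powR_inv1 ?ltW.
Qed.

Theorem weak_type F (theta : R) K d u v : (0 < theta)%R -> pairs_nnm F ->
  extrap F (2 * theta)^-1 -> A1R K u -> balanced d v ->
  let norm f := weakLnorm theta^-1 (fun x => (u x * v x)%:E)
                  (fun x => f x * (v x `^ (- theta))%:E) in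
  exists2 C : R, (0 < C)%R & forall f g, F (f, g) -> norm f < +oo ->
    norm f <= C%:E * norm g.
Proof.
move=> th0 nF EF Au bv norm.
have [pu _ _] := Au; have [pv _ _] := bv.
have v0 x : (0 < v x)%R by exact: weight_gt0.
have th20 : (0 < 2 * theta)%R by exact: mulr_gt0.
have nrho : nnm (fun x => (u x * v x)%:E).
  by apply: positive_weight_nnm; exact: positive_weightM.
pose nv (f : T -> \bar R) x := f x * (v x `^ (- theta))%:E.
have nnv f : nnm f -> nnm (nv f).
  by move=> nf; apply: nnmM => //; apply: positive_weight_nnm; exact: positive_weight_pow.
pose D f (t : R) := \int[leb]_(x in superlevel (nv f) t) (u x * v x)%:E.
have D0 f t : 0 <= D f t by exact: nnm_int_ge0.
have normE f : nnm f ->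
    norm f = ereal_sup [set t%:E * (D f t) `^ theta | t in [set t : R | (0 < t)%R]].
  move=> nf; rewrite /norm weakLnormE ?invrK// => x; exact: (nnm_ge0 x (nnv f nf)).
have Dscale (r t : R) f : (0 < r)%R -> D (fun x => r%:E * f x) t = D f (r^-1 * t)%R.
  move=> r0; rewrite /D; congr (integral _ _ _); apply/seteqP.
  by split => x; rewrite /superlevel /nv /= -muleA (EFinM r^-1) lte_pdivrMl.
apply: contrapT => Hn.
(* After the power [1/(2 theta)] this becomes the factor [4^-k] required of the functions
   [Gam k]. *)
pose rho k : R := ((4^-1 ^+ k) `^ (2 * theta))%R.
have rho0 k : (0 < rho k)%R by rewrite powR_gt0// exprn_gt0// invr_gt0.
have P k : exists z : (T -> \bar R) * (T -> \bar R) * R, [/\ scaled F z.1, (0 < z.2)%R,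
    D z.1.1 1%R = (z.2 ^+ 2)%:E,
    forall t : R, (0 < t)%R -> t%:E * D z.1.1 t `^ theta <= (2 * z.2 `^ (2 * theta))%:E &
    forall t : R, (0 < t)%R -> t%:E * D z.1.2 t `^ theta <=
      (2 * z.2 `^ (2 * theta) * rho k)%:E].
  apply: contrapT => Hk; apply: Hn; exists (rho k)^-1%R; first by rewrite invr_gt0.
  move=> f g Ffg fin; rewrite leNgt; apply/negP => lt; apply: Hk.
  have [nf ng] := nF _ _ Ffg.
  have ub h t : nnm h -> (0 < t)%R -> t%:E * D h t `^ theta <= norm h.
    by move=> nh t0; rewrite normE//; apply: ereal_sup_ubound; exists t.
  have norm0 h : nnm h -> 0 <= norm h.
    move=> nh; apply: le_trans (ub h 1%R nh ltr01).
    by rewrite mule_ge0 ?lee_fin// poweR_ge0.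
  have [a a0 aE] := ltey_EFin (norm0 f nf) fin.
  have {}a0 : (0 < a)%R.
    rewrite -lte_fin -aE; apply: le_lt_trans lt.
    by rewrite mule_ge0 ?norm0// lee_fin invr_ge0 ltW.
  (* There is a height [s] at which more than half of the norm is attained. Dividing the pair by [s]
     moves it to height 1, where the superlevel set becomes the set [E]. *)
  have a2 : (a / 2)%:E < norm f by rewrite aE lte_fin; lra.
  have [_ /= [s s0 <-] sa] : exists2 z, [set t%:E * (D f t) `^ theta | t in [set t : R | (0 < t)%R]] z &
      (a / 2)%:E < z by apply: ereal_sup_gt; rewrite -normE.
  have := ub f s nf s0; rewrite aE => sa'.
  have Dth : D f s `^ theta <= (s^-1 * a)%:E by rewrite EFinM lee_pdivlMl.
  have Dfin : D f s < +oo.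
    rewrite ltey; apply/eqP => Doo; move: Dth.
    by rewrite Doo poweRyr ?gt_eqF// leye_eq.
  have [m m0 mE] := ltey_EFin (D0 f s) Dfin.
  have m_th : (s^-1 * a < 2 * m `^ theta)%R.
    move: sa; rewrite mE poweR_EFin -EFinM lte_fin => sa.
    by rewrite mulrC ltr_pdivrMr//; lra.
  have {}m0 : (0 < m)%R.
    rewrite lt_neqAle m0 andbT eq_sym; apply/eqP => mz; move: m_th.
    by rewrite mz powR0 ?gt_eqF// mulr0 ltNge mulr_ge0 ?ltW// invr_gt0.
  (* The square root of the measure of the superlevel set, so that [z^(2 theta) = m^theta] is
     comparable to the norm of the rescaled [f]. *)
  pose z := (m `^ 2^-1)%R; have z0 : (0 < z)%R by exact: powR_gt0.
  have zth : (z `^ (2 * theta) = m `^ theta)%R.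
    by rewrite -powRrM mulrA mulVf ?mul1r.
  have r0 : (0 < s^-1)%R by rewrite invr_gt0.
  exists (((fun x => s^-1%:E * f x), (fun x => s^-1%:E * g x)), z); split => /=.
  - by exists s^-1%R, f, g.
  - exact: z0.
  - rewrite Dscale// invrK mulr1 mE; congr EFin.
    by rewrite -powR_mulrn ?powR_ge0// -powRrM mulVf ?powRr1 ?ltW.
  - move=> t t0; rewrite Dscale// invrK zth.
    have st0 : (0 < s * t)%R by exact: mulr_gt0.
    have := ub f _ nf st0; rewrite aE EFinM -muleA -lee_pdivlMl// -EFinM => /le_trans; apply.
    by rewrite lee_fin ltW.
  - move=> t t0; rewrite Dscale// invrK zth.
    have st0 : (0 < s * t)%R by exact: mulr_gt0.
    have ga : norm g <= (a * rho k)%:E.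
      by apply: ltW; move: lt; rewrite aE -lte_pdivlMl ?invr_gt0// invrK -EFinM mulrC.
    have := le_trans (ub g _ ng st0) ga; rewrite EFinM -muleA -lee_pdivlMl// -EFinM => /le_trans; apply.
    by rewrite lee_fin mulrA ler_pM2r// ltW.
have {P}[z zP] := choice P.
have nFs := pairs_nnm_scaled nF.
pose f k := (z k).1.1; pose g k := (z k).1.2; pose e k := (z k).2.
have Ffg k : scaled F (f k, g k) by rewrite -surjective_pairing; have [] := zP k.
have nf k : nnm (f k) by have [] := nFs _ _ (Ffg k).
have ng k : nnm (g k) by have [] := nFs _ _ (Ffg k).
pose al := ((2 * theta)^-1)%R; have al0 : (0 < al)%R by rewrite invr_gt0.
have al20 : (0 < 2 `^ al :> R)%R by exact: powR_gt0.
have e0 k : (0 < e k)%R by have [] := zP k.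
have eal k : ((2 * e k `^ (2 * theta)) `^ al = 2 `^ al * e k)%R.
  by rewrite powRM ?powR_ge0// -powRrM divff ?gt_eqF// powRr1 ?ltW.
have tth k : (0 <= 2 * e k `^ (2 * theta))%R by rewrite mulr_ge0 ?powR_ge0.
apply: (@weak_type_contradiction K d u v (2 `^ al)%R (fun k x => nv (f k) x `^ al)
  (fun k x => nv (g k) x `^ al) e) => //.
- by move=> k; apply: nnm_pow; exact: nnv.
- by move=> k; apply: nnm_pow; exact: nnv.
- move=> k; rewrite superlevel_poweR//; last by move=> x; exact: (nnm_ge0 x (nnv _ (nf k))).
  by rewrite powR1; have [_ _ + _ _] := zP k.
- move=> k; rewrite -eal; apply: superlevel_quadratic => //; first exact: nnv.
  by have [] := zP k.
- move=> k; have -> : (2 `^ al * e k * 4^-1 ^+ k = (2 * e k `^ (2 * theta) * rho k) `^ al)%R.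
    rewrite powRM ?(ltW (rho0 k))// eal; congr (_ * _)%R.
    by rewrite /rho -powRrM divff ?gt_eqF// powRr1// exprn_ge0.
  apply: superlevel_quadratic => //; [by rewrite mulr_ge0 ?(ltW (rho0 k))|exact: nnv|].
  by have [] := zP k.
move=> K' w Aw; have two1 : (1 < 2 :> R)%R by rewrite ltr1n.
have [C C0 HC] := extrap_scaled nF EF two1 (A1R_ApR2 Aw).
have fE h : nnm h -> \int[leb]_x (nv h x `^ al * (v x `^ 2^-1 * w x)%:E) =
    \int[leb]_x (h x `^ al * (w x)%:E).
  move=> nh; apply: eq_integral => x _.
  rewrite /nv poweRM ?lee_fin ?powR_ge0//; last exact: (nnm_ge0 x nh).
  rewrite -muleA; congr (_ * _); rewrite poweR_EFin -EFinM -powRrM mulrA -powRD; last first.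
    by apply/implyP => _; rewrite gt_eqF.
  rewrite (_ : - theta * al + 2^-1 = 0)%R ?powRr0 ?mul1r//.
  by rewrite /al; field; rewrite gt_eqF.
exists C => // k; rewrite !fE//; exact: HC.
Qed.

End weak_type.

(** * Degenerate cases, real representatives in the norms, and families of l^q sums *)

Section representatives_of_norms.
Context {R : realType} {n : nat}.
Local Notation T := (Rn R n.+1).
Local Notation leb := (@leb R n).
Local Notation c := (@unit_cube_vol R n).
Implicit Types (x : T) (p q : R) (w : T -> R) (f g h mu : T -> \bar R)
  (F : set ((T -> \bar R) * (T -> \bar R))).

Lemma ae_trivial (P : T -> Prop) : c = 0%R -> {ae leb, forall x, P x}.
Proof.
move=> c0; apply: ae_on_cubes => a l l0; exists (cube a l : set T); split.
- exact: measurable_cube.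
- by rewrite leb_cube// c0 mul0r.
- by move=> x /= H; apply: contrapT => nQ; apply: H.
Qed.

Lemma weakLnorm_ae_eq p mu mu' f f' : nnm mu -> nnm mu' -> nnm f -> nnm f' ->
  {ae leb, forall x, mu x = mu' x} ->
  {ae leb, forall x, mu x = 0 \/ f x = f' x} ->
  weakLnorm p mu f = weakLnorm p mu' f'.
Proof.
move=> nmu nmu' nf nf' mumu' ff'.
rewrite !weakLnormE; [|by move=> x; exact: (nnm_ge0 x nf')|by move=> x; exact: (nnm_ge0 x nf)].
congr ereal_sup; apply: eq_imagel => t _; congr (_ * _ `^ _).
have mS g : nnm g -> measurable (superlevel g t) by move=> ng; exact: measurable_superlevel.
rewrite (nnm_int_indic leb _ (mS f nf)) (nnm_int_indic leb _ (mS f' nf')).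
apply: nnm_eq_ae_int => //.
- by apply: nnmM => //; apply: nnm_indic; exact: mS.
- by apply: nnmM => //; apply: nnm_indic; exact: mS.
apply: filterS2 mumu' ff' => x mx [m0|fx]; first by rewrite -mx m0 !mul0e.
have E : (x \in superlevel f t) = (x \in superlevel f' t).
  by apply/idP/idP; rewrite !inE /superlevel /= fx.
by rewrite mx !indicE E.
Qed.

Lemma weakLnorm_eq0 p mu f : (0 < p)%R -> nnm mu -> nnm f ->
  {ae leb, forall x, mu x = 0} -> weakLnorm p mu f = 0.
Proof.
move=> p0 nmu nf mu0; have n0 : nnm (cst 0 : T -> \bar R) by exact: nnm_cst.
rewrite (@weakLnorm_ae_eq p mu (cst 0) f f)//; last by apply: filterS mu0 => x; left.
rewrite weakLnormE; last by move=> x; exact: (nnm_ge0 x nf).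
rewrite (_ : image _ _ = [set 0]) ?ereal_sup1//.
have pn0 : (p^-1 != 0)%R by rewrite gt_eqF// invr_gt0.
apply/seteqP; split => [_ /= [t t0 <-]|_ ->].
  by rewrite integral0 poweR0r// mule0.
by exists 1%R => //=; rewrite integral0 poweR0r// mule0.
Qed.

Lemma nnm_prod (I : Type) (r : seq I) (F : I -> T -> \bar R) :
  (forall i, nnm (F i)) -> nnm (fun x => \prod_(i <- r) F i x).
Proof.
move=> nF; elim: r => [|i r IH].
  by under eq_fun do rewrite big_nil; exact: nnm_cst.
by under eq_fun do rewrite big_cons; exact: nnmM.
Qed.

(** If [c = 0], if [u0] vanishes almost everywhere or if some [v_i] does, then so does the product,
    because [0 * +oo = 0], and all norms are 0. Otherwise the norms see the weights only up to null
    sets, and real representatives can be substituted. *)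
Lemma muckenhoupt_dichotomy (theta : R) (m : nat) (u0 : T -> \bar R)
    (v_ : 'I_m -> T -> \bar R) (delta : 'I_m -> R) :
  (0 < theta)%R -> A1 u0 -> (forall i, nnm (v_ i)) -> (forall i, 0 < delta i)%R ->
  (forall i, Ainfty (fun x => v_ i x `^ delta i)) ->
  let v0 x := \prod_(i < m) v_ i x in
  let norm f := weakLnorm theta^-1 (fun x => u0 x * v0 x) (fun x => f x / v0 x `^ theta) in
  (forall f, nnm f -> norm f = 0) \/
  (0 < c)%R /\ exists K d u v, [/\ A1R K u, balanced d v & forall f, nnm f ->
    norm f = weakLnorm theta^-1 (fun x => (u x * v x)%:E)
                  (fun x => f x * (v x `^ (- theta))%:E)].
Proof.
move=> th0 uA1 nv_ delta0 vA v0 norm.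
have nu0 : nnm u0 by apply/nnmP; have [[]] := uA1.
have nv0 : nnm v0 by exact: nnm_prod.
have nuv : nnm (fun x => u0 x * v0 x) by exact: nnmM.
have nfv f : nnm f -> nnm (fun x => f x / v0 x `^ theta).
  by move=> nf; apply: nnmM => //; apply: nnm_inv; exact: nnm_pow.
have th1 : (0 < theta^-1)%R by rewrite invr_gt0.
have deg : {ae leb, forall x, u0 x * v0 x = 0} -> forall f, nnm f -> norm f = 0.
  by move=> H f nf; apply: weakLnorm_eq0 => //; exact: nfv.
have [c0|c_gt0] := leP c 0%R.
  left; apply: deg; apply: ae_trivial.
  by apply/eqP; rewrite eq_le c0 unit_cube_vol_ge0.
have [uz|[K [u [Au uE]]]] := A1_A1R c_gt0 uA1.
  by left; apply: deg; apply: filterS uz => x ->; rewrite mul0e.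
have [[i vz]|Hv] := pselect (exists i, {ae leb, forall x, v_ i x = 0}).
  left; apply: deg; apply: filterS vz => x vx.
  by rewrite /v0 (bigD1 i)//= vx mul0e mule0.
have P i : exists vi : T -> R, (exists e, balanced e vi) /\ {ae leb, forall x, v_ i x = (vi x)%:E}.
  have di := delta0 i.
  have [wz|[p [w [p1 Aw wE]]]] := Ainfty_ApR c_gt0 (vA i).
    case: Hv; exists i; apply: filterS wz => x.
    by apply: poweR_eq0_eq0; exact: (nnm_ge0 x (nv_ i)).
  have [pw _] := Aw.
  (* This root may fail to be locally integrable, but [balanced] speaks only of a small power of
     it. *)
  exists (fun x => w x `^ (delta i)^-1)%R; split.
    exists (delta i / (2 * p))%R; apply: ApR_balanced => //.
      exact: positive_weight_pow.
    have E x : (w x = (w x `^ (delta i)^-1) `^ delta i)%R.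
      by rewrite -powRrM mulVf ?gt_eqF// powRr1 ?ltW// weight_gt0.
    by rewrite -(funext E).
  apply: filterS wE => x vw; rewrite -poweR_EFin -vw poweRK ?gt_eqF//.
  exact: (nnm_ge0 x (nv_ i)).
have {P}[vi viP] := choice P.
pose v x := (\prod_(i < m) vi i x)%R.
have [d bv] : exists d, balanced d v.
  by apply: balanced_prod => // i; have [] := viP i.
have vE : {ae leb, forall x, v0 x = (v x)%:E}.
  have : {ae leb, forall x, forall i, v_ i x = (vi i x)%:E}.
    by apply: filter_forall => i; have [] := viP i.
  apply: filterS => x vx; rewrite /v -prodEFin; apply: eq_bigr => i _; exact: vx.
right; split => //; exists K, d, u, v; split => // f nf.
have [pu _ _] := Au; have [pv _ _] := bv.
apply: weakLnorm_ae_eq => //.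
- by apply: positive_weight_nnm; exact: positive_weightM.
- exact: nfv.
- by apply: nnmM => //; apply: positive_weight_nnm; exact: positive_weight_pow.
- by apply: filterS2 uE vE => x -> ->.
apply: filterS vE => x vx; right; rewrite vx poweR_EFin inver gt_eqF ?powRN//.
by rewrite powR_gt0// weight_gt0.
Qed.

Definition lq (q : R) (J : set nat) (h : nat -> T -> \bar R) x : \bar R :=
  (\esum_(j in J) h j x `^ q) `^ q^-1.

(** Index sets [J] of naturals cover finite and infinite sequences at once; membership in [F] is
    demanded on [J] only. *)
Definition lq_family (q : R) F : set ((T -> \bar R) * (T -> \bar R)) :=
  [set fg | exists (J : set nat) (f_ g_ : nat -> T -> \bar R), (forall j, J j -> F (f_ j, g_ j)) /\ fg = (lq q J f_, lq q J g_)].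

Lemma esum_series (J : set nat) (a : nat -> \bar R) : (forall j, J j -> 0 <= a j) ->
  \esum_(j in J) a j = \sum_(j <oo) (if j \in J then a j else 0).
Proof.
move=> a0; rewrite esum_mkcond nneseries_esumT// => j.
by case: ifPn => // /set_mem /a0.
Qed.

Lemma nnm_esum (J : set nat) (h : nat -> T -> \bar R) : (forall j, J j -> nnm (h j)) ->
  nnm (fun x => \esum_(j in J) h j x).
Proof.
move=> nh.
rewrite (_ : (fun x => _) = (fun x => \sum_(j <oo) (if j \in J then h j else cst 0) x)).
  by apply: nnm_series => j; case: ifPn => [/set_mem/nh//|_]; exact: nnm_cst.
apply/funext => x; rewrite esum_series; last by move=> j /nh nhj; exact: (nnm_ge0 x nhj).
by apply: eq_eseriesr => j _; case: ifPn.
Qed.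

Lemma int_esum (J : set nat) (h : nat -> T -> \bar R) : (forall j, J j -> nnm (h j)) ->
  \int[leb]_x (\esum_(j in J) h j x) = \esum_(j in J) \int[leb]_x h j x.
Proof.
move=> nh; rewrite esum_series; last by move=> j /nh; exact: nnm_int_ge0.
transitivity (\int[leb]_x (\sum_(j <oo) (if j \in J then h j else cst 0) x)).
  apply: eq_integral => x _; rewrite esum_series; last by move=> j /nh nhj; exact: (nnm_ge0 x nhj).
  by apply: eq_eseriesr => j _; case: ifPn.
rewrite nnm_int_series//; last first.
  by move=> j; case: ifPn => [/set_mem/nh//|_]; exact: nnm_cst.
by apply: eq_eseriesr => j _; case: ifPn => // _; rewrite integral0.
Qed.

Lemma pairs_nnm_lq_family q F : pairs_nnm F -> pairs_nnm (lq_family q F).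
Proof.
move=> nF f g [J [f_ [g_ [HF [-> ->]]]]]; split; apply: nnm_pow; apply: nnm_esum => j Jj;
  by apply: nnm_pow; have [] := nF _ _ (HF j Jj).
Qed.

(** At the exponent [q] the power cancels the root and the integral exchanges with the sum, so the
    inequality is summed term by term. Finiteness of the sum gives that of every term, as the
    hypothesis on [F] demands. *)
Lemma extrap_lq_family q F : (0 < q)%R -> pairs_nnm F -> extrap F q ->
  extrap (lq_family q F) q.
Proof.
move=> q0 nF EF r w r1 Aw; have [C C0 HC] := EF r w r1 Aw; have [pw _] := Aw.
have nw := positive_weight_nnm pw.
exists C => // f g [J [f_ [g_ [HF [-> ->]]]]].
have nfg j : J j -> nnm (f_ j) /\ nnm (g_ j) by move=> /HF /nF.
have intE (h : nat -> T -> \bar R) : (forall j, J j -> nnm (h j)) ->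
    \int[leb]_x (lq q J h x `^ q * (w x)%:E) = \esum_(j in J) \int[leb]_x (h j x `^ q * (w x)%:E).
  move=> nh; rewrite -int_esum; last first.
    by move=> j /nh nhj; apply: nnmM => //; exact: nnm_pow.
  apply: eq_integral => x _; rewrite /lq poweRVK ?gt_eqF//; last first.
    by apply: esum_ge0 => j Jj; exact: poweR_ge0.
  rewrite !esum_series; [|by move=> *; rewrite ?mule_ge0 ?poweR_ge0 ?(nnm_ge0 x nw)..].
  rewrite muleC -nneseriesZl; last by move=> j _; case: ifPn => // _; exact: poweR_ge0.
  by apply: eq_eseriesr => j _; case: ifPn => _; rewrite ?mule0// muleC.
have nwf (h : nat -> T -> \bar R) j : nnm (h j) -> nnm (fun x => h j x `^ q * (w x)%:E).
  by move=> nh; apply: nnmM => //; exact: nnm_pow.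
rewrite !intE; [|by move=> j /nfg[]..].
move=> fin.
have fin_j j : J j -> \int[leb]_x (f_ j x `^ q * (w x)%:E) < +oo.
  move=> Jj; apply: le_lt_trans fin; have [nfj _] := nfg j Jj.
  rewrite esum_series; last by move=> i /nfg[nfi _]; apply: nnm_int_ge0; exact: nwf.
  have := @nneseries_term_le _ (fun i => if i \in J then \int[leb]_x (f_ i x `^ q * (w x)%:E) else 0) j.
  rewrite mem_set//; apply => i; case: ifPn => // /set_mem /nfg[nfi _].
  by apply: nnm_int_ge0; exact: nwf.
rewrite !esum_series; [|by move=> i /nfg[nfi ngi]; apply: nnm_int_ge0; exact: nwf..].
rewrite -nneseriesZl; last first.
  by move=> i _; case: ifPn => // /set_mem /nfg[_ ngi]; apply: nnm_int_ge0; exact: nwf.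
apply: lee_nneseries => [i _ _|i _].
  by case: ifPn => // /set_mem /nfg[nfi _]; apply: nnm_int_ge0; exact: nwf.
case: ifPn => [/set_mem Ji|_]; last by rewrite mule0.
by apply: HC; [exact: HF|exact: fin_j].
Qed.

End representatives_of_norms.

(** * Assembly of the scalar and vector-valued inequalities *)

Unset Implicit Arguments.
Set Strict Implicit.
Set Printing Implicit Defensive.

Theorem corollary1p8 (R : realType) (n m : nat)
    (F : set ((Rn R n.+1 -> \bar R) * (Rn R n.+1 -> \bar R)))
    (p0 theta : R) (u : Rn R n.+1 -> \bar R)
    (v_ : 'I_m -> Rn R n.+1 -> \bar R) (delta : 'I_m -> R)
    (Fmeas : forall f g, F (f, g) -> nonneg_measurable f /\ nonneg_measurable g)
    (p0_gt0 : (0 < p0)%R)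
    (Fhyp : exists C : \bar R -> R, forall w, Ainfty w ->
      forall f g, F (f, g) ->
        \int[leb]_x (f x `^ p0 * w x) < +oo ->
        \int[leb]_x (f x `^ p0 * w x) <=
          (C (Ainfty_const w))%:E * \int[leb]_x (g x `^ p0 * w x))
    (theta_ge1 : (1 <= theta)%R)
    (uA1 : A1 u)
    (m_gt0 : (0 < m)%N)
    (v_weight : forall i, nonneg_measurable (v_ i))
    (delta_gt0 : forall i, (0 < delta i)%R)
    (v_Ainfty : forall i, Ainfty (fun x => v_ i x `^ delta i)) :
  let v := fun x => \prod_(i < m) v_ i x in
  let norm := fun h =>
    weakLnorm theta^-1 (fun x => u x * v x) (fun x => h x / v x `^ theta) in
  (exists C : R, (0 < C)%R /\
    forall f g, F (f, g) -> norm f < +oo -> norm f <= C%:E * norm g) /\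
  (forall q : R, (0 < q)%R ->
    let lq := fun (J : set nat) (h : nat -> Rn R n.+1 -> \bar R) x =>
      (\esum_(j in J) h j x `^ q) `^ q^-1 in
    exists C : R, (0 < C)%R /\
      forall (J : set nat) (f_ g_ : nat -> Rn R n.+1 -> \bar R),
        (forall j, J j -> F (f_ j, g_ j)) ->
        norm (lq J f_) < +oo -> norm (lq J f_) <= C%:E * norm (lq J g_)).
Proof.
move=> v norm.
have th0 : (0 < theta)%R by exact: lt_le_trans theta_ge1.
have al0 : (0 < (2 * theta)^-1)%R by rewrite invr_gt0 mulr_gt0.
have nF : pairs_nnm F by move=> f g /Fmeas[mf mg]; split; exact/nnmP.
have nv i : nnm (v_ i) by apply/nnmP; exact: v_weight.
have nlq q := @pairs_nnm_lq_family R n q F nF.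
have [norm0|[c_gt0 [K [d [u' [v' [Au bv normE]]]]]]] :=
    muckenhoupt_dichotomy th0 uA1 nv delta_gt0 v_Ainfty.
  have le0 f g : nnm f -> nnm g -> norm f <= 1%:E * norm g.
    move=> nf ng; have -> : norm f = 0 by exact: norm0.
    have -> : norm g = 0 by exact: norm0.
    by rewrite mule0.
  split; first by exists 1%R; split => // f g /nF[nf ng] _; exact: le0.
  move=> q q0 lq_; exists 1%R; split => // J f_ g_ FJ _.
  have [nf ng] : nnm (lq q J f_) /\ nnm (lq q J g_).
    by apply: nlq; exists J, f_, g_.
  exact: le0.
have EF : extrap F p0.
  move=> q w q1 Aw; have [C HC] := Fhyp.
  have wA := ApR_Ainfty c_gt0 q1 Aw.
  (* The given bound may be nonpositive at this weight, whereas [extrap] asks for a positive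
     constant; hence the maximum with 1. *)
  pose Cw := C (Ainfty_const (fun x => (w x)%:E)).
  exists (Num.max 1 Cw)%R => [|f g Ffg fin]; first by rewrite lt_max ltr01.
  apply: (le_trans (HC _ wA f g Ffg fin)); apply: lee_wpmul2r.
    have [_ ng] := nF _ _ Ffg; have [pw _] := Aw.
    by apply: nnm_int_ge0; apply: nnmM; [exact: nnm_pow|exact: positive_weight_nnm].
  by rewrite lee_fin le_max lexx orbT.
have weak (G : set ((Rn R n.+1 -> \bar R) * (Rn R n.+1 -> \bar R))) : pairs_nnm G ->
    extrap G (2 * theta)^-1 -> exists C : R, (0 < C)%R /\
    forall f g, G (f, g) -> norm f < +oo -> norm f <= C%:E * norm g.
  move=> nG EG; have [C C0 HC] := weak_type c_gt0 th0 nG EG Au bv.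
  exists C; split => // f g Gfg; have [nf ng] := nG _ _ Gfg.
  have -> : norm f = _ := normE f nf; have -> : norm g = _ := normE g ng; exact: HC.
split; first by apply: weak => //; exact: extrapolation EF.
move=> q q0 lq_.
have [C [C0 HC]] : exists C : R, (0 < C)%R /\
    forall f g, lq_family q F (f, g) -> norm f < +oo -> norm f <= C%:E * norm g.
  apply: weak; first exact: nlq.
  (* Two extrapolations: for [F] from [p0] to [q], where sums can be formed, and then for the family
     of sums from [q] to [1/(2 theta)]. *)
  apply: (extrapolation c_gt0 q0 al0 (nlq q)).
  by apply: extrap_lq_family => //; exact: extrapolation EF.
exists C; split => // J f_ g_ FJ; apply: HC.
by exists J, f_, g_.
Qed.
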